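(* Let the tree $\mathcal{A}$, the function $h$, the weights $u,w$, the numbers $1<p\le\infty$, $1\le q<\infty$ and the weighted summation operator $S_{u,w,\mathcal{A}}$ be as in the context, with $\theta=0$, $\kappa=0$, $\kappa_w>0$, and with $$\rho_u(t)=|\log(t+2)|^{-\lambda_u},\quad\rho_w(t)=|\log(t+2)|^{-\lambda_w},\quad\tau(t)=|\log(t+2)|^{\nu},\qquad\lambda_u,\lambda_w,\nu\in\mathbb{R};$$ put $\lambda=\lambda_u+\lambda_w$. All relations $\asymp$ below hold for all sufficiently large $n\in\mathbb{N}$, with constants depending only on $\mathfrak{Z}=(p,q,u,w,h,m_*,c_* )$. 1. Let $\alpha-(1-\gamma)\left(\frac1q-\frac1p\right)_+>0$. Then $$e_n(S_{u,w,\mathcal{A}}:l_p(\mathcal{A})\to l_q(\mathcal{A}))\asymp n^{-\frac{\alpha}{1-\gamma}+\frac1q-\frac1p}(\log n)^{-\lambda-\frac{\alpha\nu}{1-\gamma}}.$$ 2. Let $\alpha-(1-\gamma)\left(\frac1q-\frac1p\right)_+=0$ and $\lambda>(1-\nu)\left(\frac1q-\frac1p\right)_+$. (a) If $p\ge q$, then $$e_n(S_{u,w,\mathcal{A}}:l_p(\mathcal{A})\to l_q(\mathcal{A}))\asymp(\log n)^{-\lambda+(1-\nu)\left(\frac1q-\frac1p\right)}.$$ (b) If $p<q$ and $\lambda\ne\frac1p-\frac1q$, then $$e_n(S_{u,w,\mathcal{A}}:l_p(\mathcal{A})\to l_q(\mathcal{A}))\asymp n^{\frac1q-\frac1p}(\log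 n)^{-\lambda+\frac1p-\frac1q}\quad\text{for }\lambda>\tfrac1p-\tfrac1q,$$ $$e_n(S_{u,w,\mathcal{A}}:l_p(\mathcal{A})\to l_q(\mathcal{A}))\asymp n^{-\lambda}\quad\text{for }\lambda<\tfrac1p-\tfrac1q.$$
   Context: Notation: $\log=\log_2$; $x_+=\max\{x,0\}$. $f_1\asymp f_2$ with constants depending only on a tuple of parameters means $C^{-1}f_2\le f_1\le Cf_2$ with $C>0$ depending only on these parameters. Entropy numbers: for normed spaces $X,Y$ and a linear continuous $T:X\to Y$, with $B_X,B_Y$ the unit balls, $e_k(T)=\inf\{\varepsilon>0:\exists y_1,\dots,y_{2^{k-1}}\in Y:\ T(B_X)\subset\bigcup_{i=1}^{2^{k-1}}(y_i+\varepsilon B_Y)\}$, $k\in\mathbb{N}$. $\mathcal{A}$ is a rooted tree with (at most countable) vertex set $\mathbf{V}(\mathcal{A})$, partially ordered by: $\xi\le\xi'$ iff $\xi$ lies on the simple path from the root to $\xi'$ (endpoints included). For $l\in\mathbb{Z}_+$, $\mathbf{V}_l^{\mathcal{A}}(\xi)$ is the set of vertices $\xi'\ge\xi$ at graph distance $l$ from $\xi$. For $f:\mathbf{V}(\mathcal{A})\to\mathbb{R}$, $\|f\|_{l_p(\mathcal{A})}=\left(\sum_{\xi\in\mathbf{V}(\mathcal{A})}|f(\xi)|^p\right)^{1/p}$ for $1\le p<\infty$, $\|f\|_{l_\infty(\mathcal{A})}=\sup_\xi|f(\xi)|$; $l_p(\mathcal{A})$ is the space of functions with finite norm. For weights $u,w:\mathbf{V}(\mathcal{A})\to[0,\infty)$,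 $$S_{u,w,\mathcal{A}}f(\xi)=w(\xi)\sum_{\xi'\le\xi}u(\xi')f(\xi'),\quad\xi\in\mathbf{V}(\mathcal{A}).$$ Standing assumptions: $\mathbf{V}(\mathcal{A})=\{\eta_{j,i}:j\in\mathbb{Z}_+,\ i\in I_j\}$, where for each $j$ the family $\{\mathbf{V}_1^{\mathcal{A}}(\eta_{j,i})\}_{i\in I_j}$ forms a partition of $\{\eta_{j+1,t}\}_{t\in I_{j+1}}$; for some $c_*\ge1$, $m_*\in\mathbb{N}$, $$c_*^{-1}\frac{h(2^{-m_*j})}{h(2^{-m_*(j+l)})}\le\mathrm{card}\,\mathbf{V}_l^{\mathcal{A}}(\eta_{j,i})\le c_*\frac{h(2^{-m_*j})}{h(2^{-m_*(j+l)})},\quad j,l\in\mathbb{Z}_+,\ i\in I_j.$$ Here $h:(0,1]\to(0,\infty)$ is nondecreasing and in some neighbourhood of zero $h(t)=t^\theta|\log t|^\gamma\tau(|\log t|)$, $\theta\ge0$, $\gamma\in\mathbb{R}$, with $\tau:(0,\infty)\to(0,\infty)$. The weights are $u(\eta_{j,i})=u_j$, $w(\eta_{j,i})=w_j$, $$u_j=2^{-\kappa_um_*j}(m_*j+1)^{-\alpha_u}\rho_u(m_*j+1),\qquad w_j=2^{-\kappa_wm_*j}(m_*j+1)^{-\alpha_w}\rho_w(m_*j+1),$$ with $\rho_u,\rho_w:(0,\infty)\to(0,\infty)$ and $\kappa_u,\kappa_w,\alpha_u,\alpha_w\in\mathbb{R}$. Put $\kappa=\kappa_u+\kappa_w$,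 $\alpha=\alpha_u+\alpha_w$. *)

(* Defs.v *)
From HB Require Import structures.
From mathcomp Require Export all_boot all_order all_algebra.
From mathcomp Require Export all_classical all_reals all_analysis.

Set Implicit Arguments.
Unset Strict Implicit.
Unset Printing Implicit Defensive.

Import Order.TTheory GRing.Theory Num.Theory.
Import numFieldNormedType.Exports.

Local Open Scope classical_set_scope.
Local Open Scope ring_scope.

Definition log2 (R : realType) (x : R) : R := ln x / ln 2.

(* 1/p for an extended real p > 0, with 1/oo = 0. *)
Definition recip (R : realType) (p : \bar R) : R := fine (p^-1)%E.

(* Extended-valued norms: the space l_p is {f | lp_norm p f < +oo}. Only p > 0
   is meaningful. *)
Definition lp_norm (R : realType) (V : choiceType) (p : \bar R) (f : V -> R)
    : \bar R :=
  match p with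
  | r%:E => poweR (\esum_(x in [set: V]) (`|f x| `^ r)%:E) r^-1
  | +oo%E => ereal_sup [set `|f x|%:E | x in [set: V]]
  | -oo%E => 0%E
  end.

(* E and F are vector spaces with extended-valued norms nE and nF; the normed
   spaces are X = {nE < +oo} and Y = {nF < +oo}. The value is +oo if T(B_X) has
   no finite covering by balls of Y, so a finite value entails that T maps X to
   Y boundedly. Indices k start at 1. *)
Definition entropy_number (R : realType) (E F : lmodType R)
    (nE : E -> \bar R) (nF : F -> \bar R) (T : E -> F) (k : nat) : \bar R :=
  ereal_inf [set eps%:E | eps in [set eps : R | 0 < eps /\
    exists y : 'I_(2 ^ k.-1) -> F,
      (forall i, (nF (y i) < +oo)%E) /\
      forall x : E, (nE x <= 1)%E ->
        exists i, (nF (T x - y i)%R <= eps%:E)%E]].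

Definition simple_path (V : eqType) (e : rel V) (x y : V) (s : seq V) : Prop :=
  [/\ path e x s, last x s = y & uniq (x :: s)].

Definition is_tree (V : eqType) (e : rel V) : Prop :=
  [/\ symmetric e, irreflexive e &
      forall x y : V, exists! s : seq V, simple_path e x y s].

Definition tree_le (V : eqType) (e : rel V) (root x y : V) : Prop :=
  exists2 s, simple_path e root y s & x \in root :: s.

Definition graph_dist (V : eqType) (e : rel V) (x y : V) (l : nat) : Prop :=
  (exists s, [/\ path e x s, last x s = y & size s = l]) /\
  (forall s, path e x s -> last x s = y -> (l <= size s)%N).

(* V_l(x): the vertices above x at distance l from x. *)
Definition descendants (V : eqType) (e : rel V) (root : V) (l : nat) (x : V)
    : set V :=
  [set y | tree_le e root x y /\ graph_dist e x y l].

(* The set of ancestors is finite, as a subset of a path. *)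
Definition summation_operator (R : realType) (V : choiceType) (e : rel V)
    (root : V) (u w : V -> R) (f : V -> R) : V -> R :=
  fun x => w x * \sum_(y \in [set y | tree_le e root y x]) u y * f y.

(* The vertices are eta j i, with distinct pairs (j, i) giving distinct
   vertices. *)
Definition admissible_tree (R : realType) (m : nat) (c : R) (h : R -> R)
    (V : countType) (e : rel V) (root : V)
    (I : nat -> Type) (eta : forall j, I j -> V) : Prop :=
  [/\ is_tree e,
      bijective (fun z : {j : nat & I j} => eta (projT1 z) (projT2 z)),
      forall j, partition [set: I j]
                  (fun i => descendants e root 1 (eta j i))
                  (range (eta j.+1)) &
      forall (j l : nat) (i : I j), exists2 k : nat,
        (descendants e root l (eta j i) #= `I_k)%card &
        c^-1 * (h (2 `^ (- (m * j)%:R)) / h (2 `^ (- (m * (j + l))%:R))) <= k%:R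
          <= c * (h (2 `^ (- (m * j)%:R)) / h (2 `^ (- (m * (j + l))%:R)))].

(* h is defined on (0, 1]; its values elsewhere are irrelevant. *)
Definition admissible_h (R : realType) (theta gamma : R) (tau h : R -> R)
    : Prop :=
  [/\ forall t, 0 < t <= 1 -> 0 < h t,
      forall s t, 0 < s -> s <= t -> t <= 1 -> h s <= h t &
      \forall t \near 0^'+,
        h t = t `^ theta * `|log2 t| `^ gamma * tau `|log2 t|].

Definition weight_seq (R : realType) (m : nat) (kappa alpha : R) (rho : R -> R)
    (j : nat) : R :=
  2 `^ (- (kappa * (m * j)%:R)) * (m * j + 1)%:R `^ (- alpha)
    * rho (m * j + 1)%:R.

(* t |-> |log (t + 2)|^a *)
Definition log_power (R : realType) (a t : R) : R := `|log2 (t + 2)| `^ a.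

(* e_n(S_{u,w,A} : l_p(A) -> l_q(A)) is equivalent to F n for all large n. The
   constant C and the threshold n0 depend on p, q, m, c, h and the weight
   sequences only, and are uniform over the trees A. *)
Definition entropy_asymp (R : realType) (p q : \bar R) (m : nat) (c : R)
    (h : R -> R) (useq wseq F : nat -> R) : Prop :=
  exists (C : R) (n0 : nat), 0 < C /\
  forall (V : countType) (e : rel V) (root : V)
         (I : nat -> Type) (eta : forall j, I j -> V) (u w : V -> R),
    admissible_tree m c h e root eta ->
    (forall j i, u (eta j i) = useq j) ->
    (forall j i, w (eta j i) = wseq j) ->
    forall n : nat, (n0 <= n)%N ->
      ((C^-1 * F n)%:E
         <= entropy_number (@lp_norm R V p) (@lp_norm R V q)
              (summation_operator e root u w) n
         <= (C * F n)%:E)%E.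

(* Main.v *)
Require Import Defs.
From HB Require Import structures.
From mathcomp Require Import ring lra zify.

Import Order.TTheory GRing.Theory Num.Theory.
Import numFieldNormedType.Exports.

Local Open Scope classical_set_scope.
Local Open Scope ring_scope.

Set Implicit Arguments.
Unset Strict Implicit.
Unset Printing Implicit Defensive.

(** Since [kappa_w > 0], the weight [w] decays exponentially along every branch,
    whereas the number of descendants at distance [l] grows only polynomially in
    [l], as [theta = 0]. A sum over a branch is therefore dominated by its last
    terms ([summation_bound]), and conversely [u w f] is a difference of two
    values of [S f] along an edge ([summation_inverse]). So the summation
    operator has, up to constants, the entropy numbers of the multiplication by
    [u w] ([summation_like_diagonal]), and the tree enters only through the
    numbers of vertices of its levels.

    As [kappa = 0], all exponential factors cancel in [u w], and the vertices of
    level [j] carry the weight [(m j + 1)^(-alpha) (log (m j + 3))^(-lambda)].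
    Levels are grouped into dyadic classes [2^i <= j + 1 < 2^(i+1)]. With
    [rho = 1 - gamma], which is positive since [h] is monotone, class [i] has
    about [2^(rho i) i^(-nu)] vertices ([tree_class_sizes]), and on it the weight
    is about [2^(-alpha i) i^(-lambda)] ([weight_class]). What remains is a
    diagonal operator [sigma] from [l_p] to [l_q] with these data.

    Upper bounds. The unit ball of [l_p] is covered by rounding coordinates
    towards zero on grids whose mesh [delta] depends on the coordinate; an
    exponential moment bound counts the rounded points ([chernoff_count],
    [net_of_ball]). If [p < q], the meshes with
    [sigma^q delta^(q-p) = eps^q] make the total error at most [eps]
    ([entropy_upper_lt]). If [q <= p], Hoelder's inequality reduces a finite head
    to the case of equal exponents and bounds the tail ([entropy_upper_ge]). The
    head consists of the classes with at most about [n] vertices, or, on the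
    boundary [alpha = rho (1/q - 1/p)_+], of those with a small power of [n].

    Lower bounds. A family of words with many pairwise far elements cannot be
    covered by few balls: the same moment bound counts the words in a Hamming
    ball, and the pigeonhole principle does the rest ([entropy_lower_code]). Sign
    vectors on one class of about [n] vertices give the power law
    ([lower_power]), sign vectors on the classes from [L] to [2 L] the boundary
    case [p > q] ([lower_ge_critical]). In the boundary case [p < q] one
    coordinate is chosen in each of [M] groups of [2^k] coordinates, with
    [k M] of the order of [n] ([entropy_lower_choices]): many groups with
    [k] about [log n], or a single group with [k = 4 n]. The two choices
    dominate for [lambda] above and below [1/p - 1/q], which is why the
    asymptotics change there. *)

(** * Powers, logarithms and their comparison *)

(** The common shape of class sizes and class weights. *)
HB.lock Definition gp (R : realType) (a b : R) (i : nat) : R :=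
  2 `^ (a * i%:R) * i.+1%:R `^ b.

Section PowerCalculus.
Variable R : realType.
Implicit Types (a b x y C : R) (i j k n : nat).

Lemma ler_powR2l r x y : 0 <= r -> 0 <= x -> x <= y -> x `^ r <= y `^ r.
Proof. by move=> r0 x0 xy; apply: ge0_ler_powR => //; rewrite nnegrE // (le_trans x0). Qed.

Lemma powRK r x : r != 0 -> 0 <= x -> (x `^ r) `^ r^-1 = x.
Proof. by move=> r0 x0; rewrite -powRrM divff // powRr1. Qed.

Lemma powRVK r x : r != 0 -> 0 <= x -> (x `^ r^-1) `^ r = x.
Proof. by move=> r0 x0; rewrite -powRrM mulVf // powRr1. Qed.

Lemma powR_le_inv r x y : 0 < r -> 0 <= x -> 0 <= y ->
  x `^ r <= y `^ r -> x <= y.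
Proof.
move=> r0 x0 y0 h; rewrite leNgt; apply/negP => yx.
by move: h; rewrite leNgt gt0_ltr_powR.
Qed.

Lemma powRV x r : 0 <= x -> (x^-1) `^ r = (x `^ r)^-1.
Proof. by move=> x0; rewrite -powR_inv1 // -powRrM mulN1r powRN. Qed.

Lemma powR_div x y r : 0 <= x -> 0 <= y -> (x / y) `^ r = x `^ r / y `^ r.
Proof. by move=> x0 y0; rewrite powRM ?invr_ge0 // powRV. Qed.

Lemma powRDr x r s : 0 < x -> x `^ (r + s) = x `^ r * x `^ s.
Proof. by move=> x0; rewrite powRD // (gt_eqF x0) implybT. Qed.

Lemma powR_le1 x y : 0 <= x -> x <= 1 -> 0 <= y -> x `^ y <= 1.
Proof. by move=> x0 x1 y0; have := ler_powR2l y0 x0 x1; rewrite powR1. Qed.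

Lemma le1_powR x y : 1 <= x -> 0 <= y -> 1 <= x `^ y.
Proof. by move=> x1 y0; rewrite -[leLHS](@powRr0 _ x); apply: ler_powR. Qed.

(** The form in which all two-sided estimates are raised to a power whose sign
    is not known. *)
Lemma powR_comparable C x y b : 0 < x -> 0 < y ->
  x <= C * y -> y <= C * x -> x `^ b <= C `^ `|b| * y `^ b.
Proof.
move=> x0 y0 xy yx.
have C0 : 0 < C by rewrite -(@pmulr_lgt0 _ y) // (lt_le_trans x0).
have [b0|b0] := leP 0 b.
  by rewrite ger0_norm // -powRM ?(ltW C0) ?(ltW y0) //; apply: ler_powR2l => //; apply: ltW.
have [d d0 ->] : exists2 d : R, 0 < d & b = - d by exists (- b); rewrite ?oppr_gt0 ?opprK.
rewrite normrN gtr0_norm // !powRN.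
have px := powR_gt0 d x0; have py := powR_gt0 d y0.
rewrite ler_pdivlMr // mulrC ler_pdivrMr // -powRM ?(ltW C0) ?(ltW x0) //.
by apply: ler_powR2l => //; apply: ltW.
Qed.

(** [c (1 + x) <= e^c e^(c x)], raised to a power at least [|B|]. *)
Lemma powR_le_exp B eta : 0 < eta ->
  exists2 C : R, 0 < C & forall x, 0 <= x -> (1 + x) `^ B <= C * expR (eta * x).
Proof.
move=> eta0.
pose B' : R := `|B| + 1; pose c : R := eta / B'.
have B'0 : 0 < B' by rewrite /B'; apply: ltr_pwDr.
have c0 : 0 < c by rewrite divr_gt0.
exists ((expR c / c) `^ B'); first by rewrite powR_gt0 // divr_gt0 // expR_gt0.
move=> x x0.
apply: (@le_trans _ _ ((1 + x) `^ B')).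
  apply: ler_powR; first by rewrite lerDl.
  by rewrite /B' (le_trans (ler_norm _)) // lerDl.
have -> : eta * x = c * x * B' by rewrite /c; field; rewrite gt_eqF.
have ec0 : 0 <= expR c / c by rewrite divr_ge0 ?expR_ge0 ?(ltW c0).
rewrite expRM -powRM ?expR_ge0 //.
apply: ler_powR2l; rewrite ?(ltW B'0) ?addr_ge0 //.
rewrite mulrAC -expRD ler_pdivlMr //.
have := expR_ge1Dx (c + c * x); nra.
Qed.

Lemma ln2_gt0 : 0 < ln 2 :> R.
Proof. by apply: ln_gt0; rewrite ltr1n. Qed.

Lemma pow2_log2 x : 0 < x -> 2 `^ (log2 x) = x.
Proof.
move=> x0; have := ln2_gt0; move=> /lt0r_neq0 l2; rewrite /powR pnatr_eq0 /= /log2 divfK //.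
by rewrite lnK.
Qed.

Lemma log2_le x y : 0 < x -> x <= y -> log2 x <= log2 y.
Proof.
move=> x0 xy; rewrite /log2 ler_pM2r ?invr_gt0 ?ln2_gt0 // ler_ln ?posrE //.
exact: lt_le_trans xy.
Qed.

Lemma log2_pow2 x : log2 (2 `^ x) = x :> R.
Proof. by rewrite /log2 ln_powR mulfK // gt_eqF // ln2_gt0. Qed.

Lemma log2_le_pow x y : 0 < x -> x <= 2 `^ y -> log2 x <= y.
Proof. by move=> x0 h; rewrite -[leRHS]log2_pow2; apply: log2_le. Qed.

Lemma pow2_le_log x y : 0 < x -> 2 `^ y <= x -> y <= log2 x.
Proof. by move=> x0 h; rewrite -[leLHS]log2_pow2; apply: log2_le => //; rewrite powR_gt0. Qed.

Lemma pow2_exp x : 2 `^ x = expR (x * ln 2) :> R.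
Proof. by rewrite /powR pnatr_eq0. Qed.

Lemma log2_ge1 x : 2 <= x -> 1 <= log2 x.
Proof. by move=> x2; apply: pow2_le_log; rewrite ?powRr1 //; apply: lt_le_trans x2. Qed.

Lemma powR2n n : 2 `^ n%:R = (2 ^ n)%:R :> R.
Proof. by rewrite powR_mulrn // natrX. Qed.

(** [powR_le_exp] in the variable [log2 n]. *)
Lemma log_small a b C : 0 < a -> exists n0, forall n, (n0 <= n)%N ->
  [/\ (2 <= n)%N, 1 <= log2 n%:R :> R & C * log2 n%:R `^ b <= n%:R `^ a].
Proof.
move=> a0.
have a2 : 0 < a * ln 2 / 2 by rewrite divr_gt0 // mulr_gt0 // ln2_gt0.
have [D D0 hD] := @powR_le_exp b (a * ln 2 / 2) a2.
have [D' D'0 hD'] : exists2 D' : R, 0 < D' & forall x, 1 <= x -> x `^ b <= D' * (1 + x) `^ b.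
  exists (2 `^ `|b|); first by rewrite powR_gt0.
  by move=> x x1; apply: powR_comparable; lra.
pose M := (1 + `|C| * D' * D) `^ (2 / a).
exists (maxn 2 (Num.truncn M).+1) => n; rewrite geq_max => /andP[n2 nM].
have n2R : 2 <= n%:R :> R by rewrite ler_nat.
have l1 := log2_ge1 n2R.
split => //.
have n0 : 0 < n%:R :> R by lra.
apply: (@le_trans _ _ (`|C| * D' * D * n%:R `^ (a / 2))).
  have -> : n%:R `^ (a / 2) = expR (a * ln 2 / 2 * log2 n%:R).
    rewrite /powR gt_eqF //; congr expR; rewrite /log2; field.
    by rewrite gt_eqF // ln2_gt0.
  have h1 := hD (log2 n%:R) (le_trans ler01 l1).
  have h2 := hD' _ l1.
  apply: (@le_trans _ _ (`|C| * log2 n%:R `^ b)).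
    by rewrite ler_wpM2r ?powR_ge0 // ler_norm.
  rewrite -!mulrA ler_wpM2l // (le_trans h2) //.
  by apply: (ler_wpM2l (ltW D'0)); rewrite !mulrA in h1 *.
have -> : n%:R `^ a = n%:R `^ (a / 2) * n%:R `^ (a / 2) :> R.
  by rewrite -powRDr //; congr (_ `^ _); lra.
rewrite ler_wpM2r ?powR_ge0 //.
apply: (@le_trans _ _ (M `^ (a / 2))).
  rewrite /M -powRrM (_ : 2 / a * (a / 2) = 1); last by field; rewrite gt_eqF.
  rewrite powRr1; last by rewrite addr_ge0 // ?mulr_ge0 // ltW.
  lra.
apply: ler_powR2l; rewrite ?powR_ge0 ?divr_ge0 ?ltW //.
by apply: lt_le_trans (truncnS_gt _) _; rewrite ler_nat.
Qed.

Lemma gpE a b i : gp a b i = 2 `^ (a * i%:R) * i.+1%:R `^ b.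
Proof. by rewrite gp.unlock. Qed.

Lemma gp_gt0 a b i : 0 < gp a b i.
Proof. by rewrite gpE mulr_gt0 // powR_gt0. Qed.

Lemma gpM a b a' b' i : gp a b i * gp a' b' i = gp (a + a') (b + b') i.
Proof. by rewrite !gpE mulrDl !powRDr //; ring. Qed.

Lemma gp_powR a b c i : gp a b i `^ c = gp (a * c) (b * c) i.
Proof.
rewrite !gpE powRM ?powR_ge0 // -!powRrM.
by congr (_ `^ _ * _ `^ _); ring.
Qed.

Lemma gp0 i : gp 0 0 i = 1 :> R.
Proof. by rewrite gpE mul0r !powRr0 mulr1. Qed.

Lemma gpV a b i : (gp a b i)^-1 = gp (- a) (- b) i.
Proof.
apply: (mulfI (lt0r_neq0 (gp_gt0 a b i))).
by rewrite divff ?gpM ?subrr ?gp0 // lt0r_neq0 ?gp_gt0.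
Qed.

(** This moves a polynomial factor from the index of summation to the end of a
    geometric sum; the loss is absorbed by the geometric factor. *)
Lemma succ_powR_dist b i k :
  i.+1%:R `^ b <= k.+1%:R `^ `|b| * (i + k).+1%:R `^ b
  /\ (i + k).+1%:R `^ b <= k.+1%:R `^ `|b| * i.+1%:R `^ b.
Proof.
have h1 : i.+1%:R <= k.+1%:R * (i + k).+1%:R :> R by rewrite -natrM ler_nat; nia.
have h2 : (i + k).+1%:R <= k.+1%:R * i.+1%:R :> R by rewrite -natrM ler_nat; nia.
by split; apply: powR_comparable.
Qed.

Lemma geo_poly_sum a b : a < 0 ->
  exists2 C : R, 0 < C & forall n, \sum_(k < n) gp a b k <= C.
Proof.
move=> a0.
have al : 0 < - a * ln 2 / 2.
  by rewrite divr_gt0 // mulr_gt0 ?oppr_gt0 ?ln2_gt0.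
have [D D0 hD] := @powR_le_exp b (- a * ln 2 / 2) al.
pose r := expR (a * ln 2 / 2) : R.
have r1 : r < 1 by rewrite /r expR_lt1; nra.
have r0 : 0 < r by rewrite expR_gt0.
exists (D / (1 - r)); first by rewrite divr_gt0 // subr_gt0.
move=> n; apply: (@le_trans _ _ (\sum_(k < n) D * r ^+ k)).
  apply: ler_sum => k _; rewrite gpE.
  have -> : r ^+ k = 2 `^ (a * k%:R) * expR (- a * ln 2 / 2 * k%:R).
    by rewrite pow2_exp -expRD /r -expRM_natr; congr expR; field.
  rewrite mulrCA ler_wpM2l ?powR_ge0 //.
  by rewrite -natr1 addrC; apply: hD.
rewrite -mulr_sumr ler_pM2l // -(@ler_pM2l _ (1 - r)) ?subr_gt0 //.
rewrite divff; last by rewrite gt_eqF // subr_gt0.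
by rewrite -opprB mulNr -subrX1 opprB gerBl exprn_ge0 // ltW.
Qed.

Lemma gp_sum_dec a b : a < 0 -> exists2 C : R, 0 < C &
  forall L n, \sum_(L <= i < n) gp a b i <= C * gp a b L.
Proof.
move=> a0; have [C C0 hC] := @geo_poly_sum a `|b| a0.
exists C => // L n.
have [nL|Ln] := leqP n L.
  by rewrite big_geq // mulr_ge0 ?ltW // gp_gt0.
rewrite -{1}[L]add0n big_addn big_mkord.
apply: (@le_trans _ _ (\sum_(i < n - L) gp a `|b| i * gp a b L)); last first.
  by rewrite -mulr_suml ler_wpM2r // ltW // gp_gt0.
apply: ler_sum => i _; rewrite addnC.
have [_ h] := succ_powR_dist b L i.
rewrite !gpE natrD mulrDr powRDr // [leRHS](_ : _ = 2 `^ (a * L%:R) * 2 `^ (a * i%:R) * (i.+1%:R `^ `|b| * L.+1%:R `^ b)); last by ring.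
by rewrite ler_wpM2l // mulr_ge0 ?powR_ge0.
Qed.

Lemma gp_sum_inc a b : 0 < a -> exists2 C : R, 0 < C &
  forall L, \sum_(i < L.+1) gp a b i <= C * gp a b L.
Proof.
move=> a0; have [C C0 hC] := @geo_poly_sum (- a) `|b| ltac:(lra).
exists C => // L.
apply: (@le_trans _ _ (\sum_(i < L.+1) gp (- a) `|b| i * gp a b L)); last first.
  by rewrite -mulr_suml ler_wpM2r // ltW // gp_gt0.
rewrite (reindex_inj rev_ord_inj) /=.
apply: ler_sum => i _; rewrite subSS.
have iL : (i <= L)%N by rewrite -ltnS.
have [h _] := succ_powR_dist b (L - i) i.
rewrite subnK // in h.
rewrite !gpE natrB // (_ : a * (L%:R - i%:R) = - a * i%:R + a * L%:R); last by ring.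
rewrite powRDr // [leRHS](_ : _ = 2 `^ (- a * i%:R) * 2 `^ (a * L%:R) * (i.+1%:R `^ `|b| * L.+1%:R `^ b)); last by ring.
by rewrite ler_wpM2l // mulr_ge0 ?powR_ge0.
Qed.

(** Telescoping against [(i + 1)^(b + 1)]; convexity is replaced by
    [1 + x <= e^x]. *)
Lemma powR_sum_dec b : b < -1 -> exists2 C : R, 0 < C &
  forall L n, \sum_(L <= i < n) i.+1%:R `^ b <= C * L.+1%:R `^ (b + 1).
Proof.
move=> b1; have [beta eb1 be0] : exists2 beta : R, b + 1 = - beta & 0 < beta.
  by exists (- (b + 1)); lra.
pose C : R := 2 * (1 + beta) / beta.
have C0 : 0 < C by rewrite divr_gt0 // mulr_gt0 //; lra.
have step i : i.+1%:R `^ b <= C * (i.+1%:R `^ (b + 1) - i.+2%:R `^ (b + 1)).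
  pose y : R := i.+2%:R^-1.
  have y0 : 0 < y by rewrite invr_gt0.
  have e1 : i.+1%:R = i.+2%:R * (1 - y) :> R.
    by rewrite mulrBr divff ?pnatr_eq0 // mulr1 -[i.+2%:R]natr1 addrK.
  have i2 : 0 < i.+2%:R :> R by [].
  have i1 : 0 < i.+1%:R :> R by [].
  have y1 : 0 < 1 - y by rewrite -(pmulr_rgt0 _ i2) -e1.
  have hq : (1 - y) `^ beta <= (1 + beta * y)^-1.
    apply: (@le_trans _ _ (expR (- (beta * y)))).
      rewrite (_ : - (beta * y) = (- y) * beta); last by ring.
      by rewrite expRM; apply: ler_powR2l; rewrite ?(ltW be0) ?(ltW y1) //; exact: expR_ge1Dx.
    rewrite expRN lef_pV2 ?posrE ?expR_gt0 //; first exact: expR_ge1Dx.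
    by have := mulr_gt0 be0 y0; lra.
  have eb : i.+2%:R `^ (b + 1) = i.+1%:R `^ (b + 1) * (1 - y) `^ beta :> R.
    rewrite eb1; have := powR_gt0 beta y1; move=> /lt0r_neq0 z0.
    rewrite !powRN e1 (powRM _ (ltW i2) (ltW y1)).
    rewrite invfM.
    by rewrite mulfVK.
  have es : i.+1%:R `^ (b + 1) = i.+1%:R `^ b * i.+1%:R :> R.
    by rewrite powRDr // powRr1.
  rewrite eb -[X in C * (X - _)]mulr1 -mulrBr es.
  rewrite [leRHS](_ : _ = i.+1%:R `^ b * (C * (i.+1%:R * (1 - (1 - y) `^ beta)))); last by ring.
  rewrite -[leLHS]mulr1 ler_wpM2l ?powR_ge0 //.
  apply: (@le_trans _ _ (C * (i.+1%:R * (1 - (1 + beta * y)^-1)))); last first.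
    by rewrite !ler_pM2l //; lra.
  have by0 : 0 < 1 + beta * y by have := mulr_gt0 be0 y0; lra.
  rewrite (_ : 1 - (1 + beta * y)^-1 = beta * y / (1 + beta * y)); last first.
    by field; rewrite gt_eqF.
  rewrite /C (_ : _ * _ = (2 * i.+1%:R * y) * ((1 + beta) / (1 + beta * y))); last first.
    by field; rewrite !gt_eqF.
  have ya : 1 <= 2 * i.+1%:R * y.
    by rewrite /y ler_pdivlMr // mul1r -natrM ler_nat; lia.
  have yb : 1 <= (1 + beta) / (1 + beta * y).
    by rewrite ler_pdivlMr // mul1r lerD2l; nra.
  by rewrite -[leLHS]mulr1 ler_pM.
exists C => // L n.
have [nL|/ltnW Ln] := leqP n L.
  by rewrite big_geq // mulr_ge0 ?powR_ge0 // ltW.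
apply: (@le_trans _ _ (\sum_(L <= i < n) C * (i.+1%:R `^ (b + 1) - i.+2%:R `^ (b + 1)))).
  by apply: ler_sum => i _.
rewrite -mulr_sumr ler_pM2l //.
rewrite (telescope_sumr_eq (fun i => - i.+1%:R `^ (b + 1))) //.
  by rewrite opprK addrC gerBl powR_ge0.
by move=> i _; rewrite opprK addrC.
Qed.

(** Solve [2^(rho y) = B D n (log n)^nu] for [y] and round up. Since [y] is of the
    order of [log n], the factor [(log n)^nu] cancels the logarithmic factor of
    the class size up to the constant [D]. *)
Lemma class_of_size rho nu : 0 < rho -> exists2 C : R, 1 <= C &
  forall B, 0 < B -> exists n0, forall n, (n0 <= n)%N ->
  [/\ (2 <= n)%N, 1 <= log2 n%:R :> R & exists L,
    [/\ B * n%:R <= gp rho (- nu) L, gp rho (- nu) L <= C * (B * n%:R),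
        log2 n%:R <= C * L.+1%:R & L.+1%:R <= C * log2 n%:R]].
Proof.
move=> rho0.
have ir0 : 0 < rho^-1 by rewrite invr_gt0.
pose C0 : R := 2 * rho + 2 * rho^-1 + 2.
have C01 : 1 <= C0 by rewrite /C0; lra.
pose D := C0 `^ `|nu|.
have D1 : 1 <= D by rewrite le1_powR.
have D0 : 0 < D by lra.
have p20 : 0 < 2 `^ rho :> R by rewrite powR_gt0.
exists (C0 + 2 `^ rho * D * D); first by rewrite -[leLHS]addr0 lerD // !mulr_ge0 // ltW.
move=> B B0.
have BD0 : 0 < B * D by rewrite mulr_gt0.
have h20 : 0 < 2^-1 :> R by rewrite invr_gt0.
have [n1 h1] := @log_small (2^-1) (- nu) (B * D)^-1 h20.
have [n2 h2] := @log_small 1 nu (B * D) ltr01.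
exists (maxn n1 n2) => n; rewrite geq_max => /andP[/h1[n2' l1 s1] /h2[_ _ s2]].
split => //.
set l := log2 n%:R in l1 s1 s2 *.
have nR : 2 <= n%:R :> R by rewrite ler_nat.
have n0 : 0 < n%:R :> R by lra.
have l0 : 0 < l by lra.
have en : n%:R = 2 `^ l :> R by rewrite pow2_log2.
pose X := B * D * n%:R * l `^ nu.
have X0 : 0 < X by rewrite !mulr_gt0 // powR_gt0.
have ln0 : 0 < l `^ nu by rewrite powR_gt0.
have Xlo : 2 `^ (l / 2) <= X.
  have e2 : n%:R = 2 `^ (l / 2) * 2 `^ (l / 2) :> R.
    by rewrite -powRDr // en; congr (_ `^ _); field.
  have e3 : n%:R `^ 2^-1 = 2 `^ (l / 2) :> R by rewrite en -powRrM.
  move: s1; rewrite e3 powRN -invfM invf_ple ?posrE ?powR_gt0 ?mulr_gt0 // => s1.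
  have p0 : 0 < 2 `^ (l / 2) :> R by rewrite powR_gt0.
  rewrite /X e2 [leRHS](_ : _ = B * D * l `^ nu * 2 `^ (l / 2) * 2 `^ (l / 2)); last by ring.
  rewrite -[leLHS]mul1r ler_pM2r //.
  by rewrite -ler_pdivrMr // mul1r.
have Xhi : X <= 2 `^ (2 * l).
  rewrite (_ : 2 `^ (2 * l) = n%:R * n%:R); last by rewrite en -powRDr //; congr (_ `^ _); ring.
  rewrite /X mulrAC ler_pM2r //.
  by move: s2; rewrite powRr1 // ltW.
have y1 := pow2_le_log X0 Xlo.
have y2 := log2_le_pow X0 Xhi.
pose y := log2 X / rho.
have y0 : 0 <= y by rewrite divr_ge0 // ?(ltW rho0) //; lra.
have /andP[ty1 ty2] := truncn_itv y0.
exists (Num.truncn y).+1.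
set L := (Num.truncn y).+1 in ty2 *.
have yL : y <= L%:R by rewrite ltW.
have Ly : L%:R <= y + 1 by rewrite -natr1 lerD2r.
have ey : rho * y = log2 X by rewrite /y; field; rewrite gt_eqF.
have eyl : y = rho^-1 * log2 X by rewrite /y mulrC.
have c1 : l <= C0 * L.+1%:R.
  have q1 : rho * y <= rho * L.+1%:R.
    by rewrite ler_pM2l // (le_trans yL) // ler_nat.
  have q2 : 0 <= (2 * rho^-1 + 2) * L.+1%:R by rewrite mulr_ge0 //; lra.
  rewrite /C0 [leRHS](_ : _ = 2 * (rho * L.+1%:R) + (2 * rho^-1 + 2) * L.+1%:R); last by ring.
  lra.
have c2 : L.+1%:R <= C0 * l.
  have q1 : y <= rho^-1 * (2 * l) by rewrite eyl ler_pM2l.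
  have q2 : 0 <= rho * l by rewrite mulr_ge0 // ltW.
  rewrite /C0 -natr1; nra.
have L0 : 0 < L.+1%:R :> R by [].
have cn1 : L.+1%:R `^ (- nu) <= D * l `^ (- nu).
  by rewrite /D -normrN; apply: powR_comparable.
have cn2 : l `^ (- nu) <= D * L.+1%:R `^ (- nu).
  by rewrite /D -normrN; apply: powR_comparable.
have g1 : X <= 2 `^ (rho * L%:R).
  by rewrite -[leLHS]pow2_log2 // -ey ler_powR ?ler1n // ler_pM2l.
have g2 : 2 `^ (rho * L%:R) <= 2 `^ rho * X.
  rewrite -[X]pow2_log2 // -ey -powRDr // ler_powR ?ler1n //.
  have : rho * L%:R <= rho * (y + 1) by rewrite ler_pM2l.
  lra.
have lnn : l `^ nu * l `^ (- nu) = 1 by rewrite powRN divff // gt_eqF.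
have lp0 : 0 < l `^ (- nu) by rewrite powR_gt0.
have Lp0 : 0 < L.+1%:R `^ (- nu) :> R by rewrite powR_gt0.
have CC : C0 <= C0 + 2 `^ rho * D * D by rewrite lerDl !mulr_ge0 // ltW.
split.
- rewrite gpE; apply: (@le_trans _ _ (X * L.+1%:R `^ (- nu))); last by rewrite ler_pM2r.
  apply: (@le_trans _ _ (B * n%:R * l `^ nu * (D * L.+1%:R `^ (- nu)))).
    apply: (@le_trans _ _ (B * n%:R * l `^ nu * l `^ (- nu))).
      by rewrite -mulrA lnn mulr1.
    by rewrite ler_wpM2l // !mulr_ge0 // ltW.
  by rewrite [leLHS](_ : _ = X * L.+1%:R `^ (- nu)) // /X; ring.
- apply: (@le_trans _ _ (2 `^ rho * X * (D * l `^ (- nu)))).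
    by rewrite gpE; apply: ler_pM; rewrite ?powR_ge0.
  rewrite [leLHS](_ : _ = (2 `^ rho * D * D) * (B * n%:R) * (l `^ nu * l `^ (- nu))); last by rewrite /X; ring.
  by rewrite lnn mulr1 ler_wpM2r ?mulr_ge0 ?(ltW B0) // lerDr (le_trans ler01).
- by apply: (le_trans c1); rewrite ler_pM2r.
- by apply: (le_trans c2); rewrite ler_pM2r.
Qed.

End PowerCalculus.

(** * Norms through finite sums *)

Section FiniteSums.
Variables (R : realType) (V : choiceType).
Implicit Types (f g : V -> R) (B r : R) (s t : seq V).

(** The bound [B] on the [l_r]-norm in a form that involves only finite sums;
    all estimates below are made in this form. *)
Definition lr_bound r f B :=
  forall s, uniq s -> \sum_(v <- s) `|f v| `^ r <= B `^ r.

Lemma lp_norm_finP r f B : 0 < r -> 0 <= B ->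
  (lp_norm r%:E f <= B%:E)%E <-> lr_bound r f B.
Proof.
move=> r0 B0; have rV0 : 0 < r^-1 by rewrite invr_gt0.
have F0 v : (0 <= (`|f v| `^ r)%:E)%E by rewrite lee_fin powR_ge0.
split => [h s us|h].
  apply: (@powR_le_inv _ r^-1); rewrite ?powR_ge0 ?sumr_ge0 //.
  rewrite powRK ?gt_eqF // -lee_fin -poweR_EFin; apply: le_trans h.
  apply: gt0_ler_poweR; rewrite ?(ltW rV0) //.
  - by rewrite in_itv /= leey lee_fin sumr_ge0.
  - by rewrite in_itv /= leey esum_ge0.
  apply: esum_ge; exists [set` s]; first by split => //; exact: finite_seq.
  by rewrite -fsbig_seq // sumEFin.
apply: (@le_trans _ _ (((B `^ r)%:E `^ r^-1)%E)); last first.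
  by rewrite poweR_EFin powRK ?gt_eqF.
apply: gt0_ler_poweR; rewrite ?(ltW rV0) //.
- by rewrite in_itv /= leey esum_ge0.
- by rewrite in_itv /= leey lee_fin powR_ge0.
apply: ge_ereal_sup => _ [A [finA _] <-].
rewrite fsbig_finite //= sumEFin lee_fin.
exact: h.
Qed.

Lemma lp_norm_yP f B : (lp_norm +oo%E f <= B%:E)%E <-> forall v, `|f v| <= B.
Proof.
split => [h v|h].
  by rewrite -lee_fin; apply: le_trans h; apply: ereal_sup_ubound; exists v.
by apply: ge_ereal_sup => _ [v _ <-]; rewrite lee_fin.
Qed.

Lemma recip_EFin r : recip r%:E = r^-1 :> R.
Proof. exact: fine_invr. Qed.

Lemma recip_y : recip +oo%E = 0 :> R.
Proof. by rewrite /recip invey. Qed.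

Lemma recip_bounds (p : \bar R) : (1 < p)%E -> 0 <= recip p < 1.
Proof.
case: p => [r||] //; rewrite ?recip_y ?lexx ?ltr01 // lte_fin => r1.
by rewrite recip_EFin invr_ge0 invf_lt1 ?(lt_trans ltr01) // (le_trans ler01) // ltW.
Qed.

Lemma recip_lt (p : \bar R) (q : R) : (1 < p)%E -> (p < q%:E)%E -> q^-1 < recip p.
Proof.
case: p => [r||] //; rewrite !lte_fin recip_EFin => r1 rq.
by rewrite ltf_pV2 // posrE; lra.
Qed.

Lemma recip_le (p : \bar R) (q : R) : 1 <= q -> (q%:E <= p)%E -> recip p <= q^-1.
Proof.
case: p => [r||] //; rewrite ?recip_y ?invr_ge0 ?lee_fin => q1 qr; last by lra.
by rewrite recip_EFin lef_pV2 // posrE; lra.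
Qed.

(** The unit ball of [l_p], with a description that does not distinguish
    [p = oo] from finite [p]. *)
Lemma lp_ballP (p : \bar R) f : (1 < p)%E ->
  (lp_norm p f <= 1)%E <-> exists z : V -> R,
    [/\ forall v, 0 <= z v, forall s, uniq s -> \sum_(v <- s) z v <= 1 &
        forall v, `|f v| <= z v `^ recip p].
Proof.
case: p => [r||] //; last first.
  move=> _; rewrite recip_y -[1%E]/(1%:E) lp_norm_yP; split => [h|[z [_ _ h]] v].
    by exists (fun=> 0); split => // [s _|v]; rewrite ?big1 ?ler01 // powRr0.
  by rewrite (le_trans (h v)) // powRr0.
rewrite lte_fin => r1; have r0 : 0 < r by lra.
rewrite -[1%E]/(1%:E) (lp_norm_finP f r0 ler01) recip_EFin; split => [h|[z [z0 z1 h]] s us].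
  exists (fun v => `|f v| `^ r); split => [v|s us|v]; first exact: powR_ge0.
    by have := h s us; rewrite powR1.
  by rewrite powRK // gt_eqF.
rewrite powR1; apply: le_trans (z1 s us); apply: ler_sum => v _.
rewrite -(@powRVK _ r (z v)) ?gt_eqF //.
by apply: ler_powR2l; rewrite ?(ltW r0).
Qed.

Lemma lr_boundW r f B B' : 0 <= r -> 0 <= B -> B <= B' -> lr_bound r f B -> lr_bound r f B'.
Proof.
move=> r0 B0 BB h s us; apply: (le_trans (h s us)).
exact: ler_powR2l.
Qed.

Lemma sum_le_subset (F : V -> R) s t : (forall v, 0 <= F v) ->
  uniq s -> uniq t -> (forall v, v \in s -> F v != 0 -> v \in t) ->
  \sum_(v <- s) F v <= \sum_(v <- t) F v.
Proof.
move=> F0 us ut st.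
have -> : \sum_(v <- s) F v = \sum_(v <- [seq v <- s | F v != 0]) F v.
  rewrite big_filter [RHS]big_mkcond /=; apply: eq_bigr => v _.
  by case: eqP.
set s' := [seq v <- s | F v != 0].
have us' : uniq s' by rewrite filter_uniq.
have st' : {subset s' <= t} by move=> v; rewrite mem_filter => /andP[Fv vs]; apply: st.
rewrite [leRHS](perm_big (s' ++ [seq v <- t | v \notin s'])) /=.
  by rewrite big_cat /= lerDl sumr_ge0.
apply: uniq_perm => //.
  rewrite cat_uniq us' filter_uniq // andbT; apply/hasPn => v.
  by rewrite mem_filter => /andP[].
by move=> v; rewrite mem_cat [X in _ || X]mem_filter; case: (boolP (v \in s')) => [/st' ->|].
Qed.

Lemma lr_bound_finite r f t : 0 < r -> (forall v, v \notin t -> f v = 0) ->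
  exists2 B, 0 <= B & lr_bound r f B.
Proof.
move=> r0 ft; exists ((\sum_(v <- undup t) `|f v| `^ r) `^ r^-1).
  exact: powR_ge0.
move=> s us; rewrite powRVK ?gt_eqF //; last first.
  by apply: sumr_ge0 => v _; exact: powR_ge0.
apply: sum_le_subset => //; rewrite ?undup_uniq // => v _.
rewrite mem_undup; apply: contraR => /ft ->.
by rewrite normr0 powR0 // gt_eqF.
Qed.

(** The crude triangle inequality: no constant matters here. *)
Lemma powR_normB r (x y : R) : 0 <= r ->
  `|x - y| `^ r <= 2 `^ r * (`|x| `^ r + `|y| `^ r).
Proof.
move=> r0; wlog xy : x y / `|y| <= `|x|.
  move=> h; have [/h //|/ltW/h] := leP `|y| `|x|.
  by rewrite distrC [_ + `|y| `^ r]addrC.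
apply: (@le_trans _ _ (2 `^ r * `|x| `^ r)).
  rewrite -powRM //; apply: ler_powR2l => //.
  by apply: (le_trans (ler_normB _ _)); rewrite mulrDl mul1r lerD2l.
by rewrite ler_wpM2l ?powR_ge0 // lerDl powR_ge0.
Qed.

Lemma lr_boundB r f g B : 1 <= r -> 0 <= B ->
  lr_bound r f B -> lr_bound r g B -> lr_bound r (f - g) (4 * B).
Proof.
move=> r1 B0 hf hg s us; have r0 : 0 <= r by lra.
apply: (@le_trans _ _ (\sum_(v <- s) 2 `^ r * (`|f v| `^ r + `|g v| `^ r))).
  by apply: ler_sum => v _; apply: powR_normB.
rewrite -mulr_sumr big_split /=.
apply: (@le_trans _ _ (2 `^ r * (B `^ r + B `^ r))).
  by rewrite ler_wpM2l ?powR_ge0 // lerD ?hf ?hg.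
rewrite [leLHS](_ : _ = 2 `^ r * 2 * B `^ r); last by ring.
rewrite powRM // ler_wpM2r ?powR_ge0 // (_ : 4 = 2 * 2); last by ring.
rewrite (@powRM _ 2 2) // ler_wpM2l ?powR_ge0 //.
by rewrite -[leLHS](@powRr1 _ 2) // ler_powR // ler1n.
Qed.

(** Interpolation between two summable sequences: the substitute for Hölder's
    inequality. *)
Lemma powR_interpolate (x y a b : R) : 0 <= x -> 0 <= y -> 0 <= a -> 0 <= b ->
  a + b = 1 -> x `^ a * y `^ b <= x + y.
Proof.
move=> x0 y0 a0 b0 ab; wlog xy : x y a b x0 y0 a0 b0 ab / x <= y.
  move=> h; have [|/ltW] := leP x y; first exact: h.
  by move=> yx; rewrite mulrC addrC; apply: h => //; rewrite addrC.
have [y00|y00] := eqVneq y 0.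
  have -> : x = 0 by apply/eqP; rewrite eq_le x0 andbT -y00.
  rewrite y00 addr0.
  have [a00|a00] := eqVneq a 0; last by rewrite powR0 // mul0r.
  by rewrite (@powR0 _ b) ?mulr0 //; apply/eqP; lra.
apply: (@le_trans _ _ (y `^ a * y `^ b)).
  by rewrite ler_wpM2r ?powR_ge0 //; apply: ler_powR2l.
by rewrite -powRD ?ab ?oner_eq0 // powRr1 // lerDr.
Qed.

End FiniteSums.

(** * Counting words by their cost *)

(** The exponential moment bound. It counts both the points of a net and the
    words in a Hamming ball. *)
Lemma chernoff_count (R : realType) (G A : finType) (k : G -> A -> R) (b : R) :
  #|[pred c : {ffun G -> A} | \sum_g k g (c g) <= b]|%:R
    <= expR b * \prod_g \sum_a expR (- k g a).
Proof.
rewrite bigA_distr_bigA /= mulr_sumr -sum1_card natr_sum.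
rewrite [leLHS]big_mkcond /=; apply: ler_sum => c _.
rewrite inE -expR_sum -expRD sumrN; case: ifP => h; last exact: expR_ge0.
by rewrite -[leLHS]expR0 ler_expR subr_ge0.
Qed.

(** * Nets by rounding towards zero *)

Section Net.
Variable R : realType.

(** A letter is a signed magnitude; [None] is zero and has to be the only letter
    of magnitude zero, since most coordinates are rounded to it. *)
Definition letter (M : nat) := option (bool * 'I_M)%type.

Definition magnitude M (a : letter M) : nat := oapp (fun z => (nat_of_ord z.2).+1) 0%N a.

Definition letter_value M (a : letter M) : R :=
  oapp (fun z : bool * 'I_M => (-1) ^+ z.1 * z.2.+1%:R) 0 a.

Lemma round_to_letter M (x d : R) : 0 < d -> (Num.truncn (`|x| / d) <= M)%N ->
  exists a : letter M, magnitude a = Num.truncn (`|x| / d) /\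
    (`|x - d * letter_value a| <= d /\ `|x - d * letter_value a| <= `|x|).
Proof.
move=> d0; set k := Num.truncn _ => kM.
have xd0 : 0 <= `|x| / d by rewrite divr_ge0 // ltW.
have /andP[k1 k2] := truncn_itv xd0; rewrite -/k in k1 k2.
have {}k1 : k%:R * d <= `|x| by rewrite -ler_pdivlMr.
have {}k2 : `|x| <= (k%:R + 1) * d by rewrite natr1 -ler_pdivrMr // ltW.
case: k kM k1 k2 => [|k] kM k1 k2.
  exists None; split => //=; rewrite mulr0 subr0; split => //; lra.
exists (Some (x < 0, Ordinal kM)); split => //=.
have -> : `|x - d * ((-1) ^+ (x < 0)%R * k.+1%:R)| = `|x| - k.+1%:R * d.
  rewrite {1}[x]numEsign mulrCA -mulrBr normrMsign ger0_norm //; last by lra.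
  by rewrite mulrC.
split; last by rewrite gerBl mulr_ge0 // ltW.
lra.
Qed.

Lemma sum_letters M (y : R) : 0 < y ->
  \sum_(a : letter M) expR (- (y * (magnitude a)%:R)) <= 1 + 2 / (expR y - 1).
Proof.
move=> y0; have e1 : 1 < expR y by rewrite expR_gt1.
rewrite (bigD1 None) //= mulr0 oppr0 expR0 lerD2l.
rewrite (reindex_omap Some id) /=; last by case.
under eq_bigl => z do rewrite eqxx.
rewrite -(pair_big xpredT xpredT (fun (b : bool) (k : 'I_M) => expR (- (y * k.+1%:R)))) /=.
rewrite big_bool /=.
set T := \sum_(k < M) _; rewrite [leLHS](_ : _ = 2 * T) ?ler_pM2l //; last by ring.
rewrite /T {T}; set r := expR (- y); have r1 : r < 1 by rewrite /r expR_lt1; lra.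
have r0 : 0 < r by exact: expR_gt0.
have er : expR y = r^-1 by rewrite /r expRN invrK.
have -> : (expR y - 1)^-1 = r / (1 - r) by rewrite er; field; rewrite !gt_eqF ?subr_gt0.
have -> : \sum_(k < M) expR (- (y * k.+1%:R)) = r * \sum_(k < M) r ^+ k.
  by rewrite mulr_sumr; apply: eq_bigr => k _; rewrite -exprS /r -expRM_natr mulNr.
rewrite ler_pM2l // -(@ler_pM2l _ (1 - r)) ?subr_gt0 //.
rewrite divff; last by rewrite gt_eqF // subr_gt0.
by rewrite -opprB mulNr -subrX1 opprB gerBl exprn_ge0 // ltW.
Qed.

Variable V : choiceType.

(** Coordinates are rounded towards zero on grids whose mesh may depend on the
    coordinate, so the error is at most both the mesh and the coordinate. Since
    [k <= k^p] for integers, the rounded points are words of bounded linear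
    cost, and only few of them are needed. *)
Lemma net_of_ball (s : seq V) (delta : V -> R) (p t : R) (N : nat) :
  uniq s -> 1 <= p -> 0 < t -> (forall v, v \in s -> 0 < delta v) ->
  expR t * \prod_(v <- s) (1 + 2 / (expR (t * delta v `^ p) - 1)) <= N%:R ->
  exists y : 'I_N -> V -> R,
    (forall i v, v \notin s -> y i v = 0) /\
    forall x : V -> R, \sum_(v <- s) `|x v| `^ p <= 1 ->
      exists i, forall v, v \in s ->
        `|x v - y i v| <= delta v /\ `|x v - y i v| <= `|x v|.
Proof.
move=> us p1 t0 d0 hN; have p0 : 0 < p by lra.
pose M := (\max_(v <- s) Num.truncn (delta v)^-1)%N.
pose v_ (g : 'I_(size s)) := tnth (in_tuple s) g.
have vs g : v_ g \in s by exact: mem_tnth.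
pose cost (g : 'I_(size s)) (a : letter M) : R :=
  t * delta (v_ g) `^ p * (magnitude a)%:R.
pose Z := [pred c : {ffun 'I_(size s) -> letter M} | \sum_g cost g (c g) <= t].
pose decode (c : {ffun 'I_(size s) -> letter M}) (v : V) : R :=
  oapp (fun g => delta v * letter_value (c g)) 0 (insub (index v s)).
have ZN : (#|Z| <= N)%N.
  rewrite -(ler_nat R); apply: le_trans hN; apply: (le_trans (chernoff_count _ _)).
  rewrite ler_wpM2l ?expR_ge0 // [leRHS]big_tnth.
  apply: ler_prod => g _; rewrite sumr_ge0 => [|a _]; last exact: expR_ge0.
  by apply: sum_letters; rewrite mulr_gt0 // powR_gt0 // d0.
exists (fun i => decode (nth [ffun=> None] (enum Z) i)); split => [i v vns|x hx].
  by rewrite /decode insubF // index_mem (negbTE vns).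
have x1 v : v \in s -> `|x v| <= 1.
  move=> sv; apply: (@powR_le_inv _ p) => //; rewrite powR1.
  by apply: le_trans hx; rewrite (big_rem v) //= lerDl sumr_ge0.
have hr g : exists a : letter M,
    magnitude a = Num.truncn (`|x (v_ g)| / delta (v_ g)) /\
    (`|x (v_ g) - delta (v_ g) * letter_value a| <= delta (v_ g) /\
     `|x (v_ g) - delta (v_ g) * letter_value a| <= `|x (v_ g)|).
  apply: round_to_letter; first exact: d0.
  apply: (@leq_trans (Num.truncn (delta (v_ g))^-1)).
    apply: le_truncn; rewrite -[leRHS]mul1r ler_wpM2r ?x1 //.
    by rewrite invr_ge0 ltW // d0.
  exact: (@leq_bigmax_seq _ s xpredT (fun v => Num.truncn (delta v)^-1) (v_ g)).
have [c hc] := choice hr.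
have cZ : [ffun g => c g] \in Z.
  rewrite inE -[leRHS]mulr1 -subr_ge0; move: hx; rewrite big_tnth => hx.
  rewrite subr_ge0; apply: le_trans (ler_wpM2l (ltW t0) hx).
  rewrite mulr_sumr; apply: ler_sum => g _.
  rewrite ffunE /cost -mulrA ler_pM2l // -/(v_ g).
  have [-> _] := hc g; have dg := d0 _ (vs g).
  set k := Num.truncn _.
  have kx : k%:R * delta (v_ g) <= `|x (v_ g)|.
    by rewrite -ler_pdivlMr // truncn_le divr_ge0 // ltW.
  apply: (@le_trans _ _ ((k%:R * delta (v_ g)) `^ p)); last first.
    by apply: ler_powR2l; rewrite ?(ltW p0) ?mulr_ge0 // ltW.
  rewrite powRM ?(ltW dg) // mulrC ler_wpM2r ?powR_ge0 //.
  case: (k) => [|k']; first by rewrite powR0 // gt_eqF.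
  by rewrite le1r_powR // ler1n.
have iN : (index [ffun g => c g] (enum Z) < N)%N.
  by apply: leq_trans ZN; rewrite cardE index_mem mem_enum.
exists (Ordinal iN) => v sv /=.
have ivs : (index v s < size s)%N by rewrite index_mem.
rewrite nth_index ?mem_enum // /decode insubT /=.
have ev : v_ (Sub (index v s) ivs) = v by rewrite /v_ (tnth_nth v) /= nth_index.
rewrite ffunE.
by have [_] := hc (Sub (index v s) ivs); rewrite ev.
Qed.

End Net.

(** * Entropy numbers of operators comparable to a diagonal one *)

Section LikeDiagonal.
Variables (R : realType) (V : choiceType).
Implicit Types (p : \bar R) (q C : R) (sigma : V -> R) (S : (V -> R) -> V -> R).

(** Up to the constant [C], such an [S] has the entropy numbers of the diagonal
    operator [sigma]. Finiteness of either norm is part of the comparison. *)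
Definition like_diagonal q C sigma S :=
  [/\ 0 < C, forall f g, S (f - g) = S f - S g &
      forall f B, 0 <= B ->
        (lr_bound q (sigma \* f) B -> lr_bound q (S f) (C * B)) /\
        (lr_bound q (S f) B -> lr_bound q (sigma \* f) (C * B))].

Lemma entropy_upper p q C sigma S eps n : 1 <= q -> like_diagonal q C sigma S ->
  0 < eps ->
  (exists y : 'I_(2 ^ n.-1) -> V -> R,
    (forall i, exists s : seq V, forall v, v \notin s -> y i v = 0) /\
    forall x, (lp_norm p x <= 1)%E ->
      exists i, lr_bound q (sigma \* (x - y i)) eps) ->
  (entropy_number (@lp_norm R V p) (@lp_norm R V q%:E) S n <= (C * eps)%:E)%E.
Proof.
move=> q1 [C0 SB hS] eps0 [y [ysupp hy]]; have q0 : 0 < q by lra.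
apply: ereal_inf_lbound; exists (C * eps) => //; split; first by rewrite mulr_gt0.
exists (fun i => S (y i)); split => [i|x /hy[i hi]].
  have [s hs] := ysupp i.
  have [|B B0 hB] := @lr_bound_finite R V q (sigma \* y i) s q0.
    by move=> v /hs /= ->; rewrite mulr0.
  have CB0 : 0 <= C * B by rewrite mulr_ge0 // ltW.
  apply: le_lt_trans (ltry (C * B)); rewrite (lp_norm_finP _ q0 CB0).
  by have [+ _] := hS (y i) B B0; apply.
exists i; rewrite -SB lp_norm_finP ?mulr_ge0 ?(ltW C0) ?(ltW eps0) //.
by have [+ _] := hS (x - y i) eps (ltW eps0); apply.
Qed.

(** Pigeonhole: if the balls are fewer than the words divided by the size of a
    Hamming ball, some ball of the covering contains two words that are far
    apart. *)
Lemma entropy_lower p q C sigma S (Cd : finType) (X : Cd -> V -> R)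
    (near : rel Cd) (F D : R) n : 1 <= q -> like_diagonal q C sigma S ->
  (forall c, (lp_norm p (X c) <= 1)%E) ->
  0 <= F -> (forall c, #|[pred c' | near c c']|%:R <= F) ->
  (2 ^ n.-1)%:R * F < #|Cd|%:R ->
  (forall c c' B, 0 <= B -> ~~ near c c' ->
     lr_bound q (sigma \* (X c - X c')) B -> D <= B) ->
  ((D / (4 * C))%:E <=
    entropy_number (@lp_norm R V p) (@lp_norm R V q%:E) S n)%E.
Proof.
move=> q1 [C0 SB hS] hX F0 hF hcard hD; have q0 : 0 < q by lra.
apply: le_ereal_inf_tmp => _ [eps [eps0 [y [_ hy]]] <-]; rewrite lee_fin.
have hi c : exists i, (lp_norm q%:E (S (X c) - y i)%R <= eps%:E)%E by apply: hy.
have [f hf] := choice hi.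
have [c0 [c' [efc ncc]]] : exists c c', f c = f c' /\ ~~ near c c'.
  apply: contrapT => hn.
  have allnear c c' : f c = f c' -> near c c'.
    by move=> e; apply: contrapT => /negP nn; apply: hn; exists c, c'.
  move: hcard; apply/negP; rewrite -leNgt.
  have -> : #|Cd| = (\sum_(i < 2 ^ n.-1) #|[pred c | f c == i]|)%N.
    rewrite -sum1_card (partition_big f xpredT) //=.
    by apply: eq_bigr => i _; rewrite sum1_card.
  rewrite natr_sum mulr_natl -[X in _ *+ X]card_ord -sumr_const.
  apply: ler_sum => i _.
  have [[c fc]|nc] := pselect (exists c, f c = i).
    apply: le_trans (hF c); rewrite ler_nat; apply: subset_leq_card.
    by apply/fintype.subsetP => c'; rewrite !inE => /eqP fc'; apply: allnear; rewrite fc.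
  by rewrite eq_card0 // => c; rewrite !inE; apply/negP => /eqP fc; apply: nc; exists c.
have b1 : lr_bound q (S (X c0) - y (f c0)) eps.
  by rewrite -lp_norm_finP // ltW.
have b2 : lr_bound q (S (X c') - y (f c0)) eps.
  by rewrite efc -lp_norm_finP // ltW.
have := lr_boundB q1 (ltW eps0) b1 b2.
have -> : S (X c0) - y (f c0) - (S (X c') - y (f c0)) = S (X c0 - X c').
  by rewrite SB opprB addrA subrK.
have e40 : 0 <= 4 * eps by rewrite mulr_ge0 // ltW.
have [_ h2] := hS (X c0 - X c') (4 * eps) e40.
move=> /h2 /(hD _ _ _ _ ncc) => h.
rewrite ler_pdivrMr ?mulr_gt0 // (le_trans (h _)) ?mulr_ge0 ?(ltW C0) ?(ltW eps0) //.
by rewrite [leLHS](_ : _ = eps * (4 * C)) //; ring.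
Qed.

End LikeDiagonal.

(** * Classes of prescribed size *)

Section Classes.
Variables (R : realType) (V : choiceType).
Implicit Types (C rho nu : R) (cls : V -> nat) (phi : nat -> R).

(** The last two bounds are the law of the class sizes; the first one makes room
    for [2^i] points in class [i] for every [rho] and [nu]. *)
Definition class_sizes C rho nu cls := forall i, exists s : seq V,
  [/\ uniq s, forall v, (v \in s) = (cls v == i), (2 ^ i <= size s)%N &
      C^-1 * gp rho (- nu) i <= (size s)%:R <= C * gp rho (- nu) i].

Lemma class_range C rho nu cls a K : 0 < C -> class_sizes C rho nu cls ->
  exists s : seq V, [/\ uniq s, forall v, (v \in s) = (a <= cls v < K)%N &
    forall phi, (forall i, 0 <= phi i) ->
      C^-1 * \sum_(a <= i < K) gp rho (- nu) i * phi i <= \sum_(v <- s) phi (cls v)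
        <= C * \sum_(a <= i < K) gp rho (- nu) i * phi i].
Proof.
move=> C0 hc; elim: K => [|K [s [us hs hphi]]].
  exists [::]; split => // [v|phi _]; first by rewrite ltn0 andbF.
  by rewrite big_geq // big_nil !mulr0 lexx.
have [aK|Ka] := leqP a K; last first.
  exists [::]; split => // [v|phi _]; last by rewrite big_geq // big_nil !mulr0 lexx.
  by rewrite in_nil; apply/esym/negP => /andP[]; lia.
have [c [uc hcK _ /andP[c1 c2]]] := hc K.
exists (s ++ c); split => [|v|phi phi0].
- rewrite cat_uniq us uc andbT; apply/hasPn => v.
  by rewrite hcK hs => /eqP ->; rewrite ltnn andbF.
- rewrite mem_cat hs hcK ltnS [(cls v <= K)%N]leq_eqVlt orbC.
  by case: eqP => [->|_] //=; rewrite aK.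
have /andP[h1 h2] := hphi _ phi0.
have ec : \sum_(v <- c) phi (cls v) = (size c)%:R * phi K.
  rewrite (eq_big_seq (fun=> phi K)); last by move=> v; rewrite hcK => /eqP ->.
  by rewrite big_const_seq count_predT iter_addr addr0 mulr_natl.
have e D : D * (gp rho (- nu) K * phi K) = D * gp rho (- nu) K * phi K by rewrite mulrA.
rewrite big_nat_recr //= big_cat /= ec !mulrDr !e.
by apply/andP; split; apply: lerD => //; rewrite ler_wpM2r.
Qed.

Lemma class_sum_le C rho nu cls phi a K s : 0 < C -> class_sizes C rho nu cls ->
  (forall i, 0 <= phi i) -> uniq s -> (forall v, v \in s -> (a <= cls v < K)%N) ->
  \sum_(v <- s) phi (cls v) <= C * \sum_(a <= i < K) gp rho (- nu) i * phi i.
Proof.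
move=> C0 hc phi0 us hs; have [t [ut ht hphi]] := class_range a K C0 hc.
have /andP[_ h] := hphi phi phi0; apply: le_trans h.
by apply: sum_le_subset => // v vs _; rewrite ht hs.
Qed.

End Classes.

(** * Upper bounds *)

Section Upper.
Variable R : realType.

Lemma powR_subadditive (y a : R) : 0 <= y -> 0 <= a -> a <= 1 ->
  (1 + y) `^ a <= 1 + y `^ a.
Proof.
move=> y0 a0 a1; have s0 : 0 < 1 + y by lra.
rewrite -[leLHS]mul1r -ler_pdivlMr ?powR_gt0 // mulrDl.
have e : 1 = 1 / (1 + y) + y / (1 + y) by rewrite -mulrDl divff // gt_eqF.
have -> : 1 / (1 + y) `^ a = (1 / (1 + y)) `^ a.
  by rewrite powR_div ?(ltW s0) // powR1.
rewrite -powR_div ?(ltW s0) // {1}e; apply: lerD.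
  by apply: ger1_powR => //; rewrite divr_gt0 // ler_pdivrMr //; lra.
have [->|yn] := eqVneq y 0; first by rewrite mul0r powR_ge0.
have y0' : 0 < y by rewrite lt0r yn.
by apply: ger1_powR => //; rewrite divr_gt0 // ler_pdivrMr //; lra.
Qed.

(** The contribution of one coordinate to the size of a net, for a mesh with
    [t delta^p = x]. Small exponents [K] are used for fine meshes, large ones
    for coarse meshes. *)
Lemma letter_sum_powR (K : R) : 0 < K -> exists2 C : R, 0 < C &
  forall x, 0 < x -> 1 + 2 / (expR x - 1) <= expR (C * x `^ (- K)).
Proof.
move=> K0; pose k := (Num.truncn K).+1.
have Kk : K < k%:R by exact: truncnS_gt.
have k0 : 0 < k%:R :> R by [].
pose eta := K / k%:R.
have eta0 : 0 < eta by rewrite divr_gt0.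
have eta1 : eta <= 1 by rewrite ler_pdivrMr // mul1r ltW.
have f0 : 0 < k`!%:R :> R by rewrite ltr0n fact_gt0.
have f20 : 0 < 2 * k`!%:R :> R by rewrite mulr_gt0.
exists ((2 * k`!%:R) `^ eta / eta); first by rewrite divr_gt0 // powR_gt0.
move=> x x0.
have ex : x ^+ k / k`!%:R <= expR x - 1.
  by rewrite lerBrDl; apply: expR_ge1Dxn; exact: ltW.
have xk0 : 0 < x ^+ k by rewrite exprn_gt0.
have e0 : 0 < expR x - 1 by apply: lt_le_trans ex; rewrite divr_gt0.
set y := 2 / _.
have y0 : 0 < y by rewrite divr_gt0.
have yx : y <= 2 * k`!%:R / x ^+ k.
  rewrite /y -mulrA ler_pM2l // -[leRHS]invrK lef_pV2 ?posrE ?invr_gt0 ?divr_gt0 //.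
  by rewrite invfM invrK mulrC.
have h1 : 1 + y <= expR (y `^ eta / eta).
  apply: (@powR_le_inv _ eta); rewrite ?expR_ge0 //; first by rewrite addr_ge0 // ltW.
  rewrite -expRM divfK ?gt_eqF //.
  by apply: le_trans (expR_ge1Dx _); apply: powR_subadditive; rewrite ?(ltW y0) ?(ltW eta0).
apply: (le_trans h1); rewrite ler_expR mulrAC ler_pM2r ?invr_gt0 //.
have -> : x `^ (- K) = (x ^+ k)^-1 `^ eta.
  rewrite powRV ?(ltW xk0) // -powR_mulrn ?(ltW x0) // -powRrM powRN.
  by congr (_ `^ _)^-1; rewrite /eta mulrC divfK // gt_eqF.
rewrite -powRM ?invr_ge0 ?(ltW xk0) ?(ltW f20) //.
by apply: ler_powR2l; rewrite ?(ltW eta0) ?(ltW y0).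
Qed.

Lemma letter_sum_exp (x : R) : 2 <= expR x ->
  1 + 2 / (expR x - 1) <= expR (4 * expR (- x)).
Proof.
move=> h; apply: le_trans (expR_ge1Dx _); rewrite lerD2l expRN.
have e0 : 0 < expR x by exact: expR_gt0.
by rewrite ler_pdivrMr; [rewrite mulrAC ler_pdivlMr //; nra|lra].
Qed.

Lemma ln2_ge : 2^-1 <= ln 2 :> R.
Proof.
rewrite -ler_expR lnK ?posrE //.
have := expR_ge1Dx (- 2^-1 : R); rewrite expRN.
have e0 : 0 < expR 2^-1 :> R by exact: expR_gt0.
move=> h; rewrite -[expR _]invrK -[leRHS]invrK lef_pV2 ?posrE ?invr_gt0 //.
apply: le_trans h; lra.
Qed.

Variable V : choiceType.
Implicit Types (sigma delta cost x y z : V -> R) (s hs : seq V).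

(** [net_of_ball] with [t = n / 4] and [2^(n-1)] points. *)
Lemma net_of_ball_pow2 hs delta cost (p : R) n : uniq hs -> 1 <= p -> (4 <= n)%N ->
  (forall v, v \in hs -> 0 < delta v) ->
  (forall v, v \in hs ->
     1 + 2 / (expR (n%:R / 4 * delta v `^ p) - 1) <= expR (cost v)) ->
  \sum_(v <- hs) cost v <= n%:R / 8 ->
  exists y : 'I_(2 ^ n.-1) -> V -> R,
    (forall i v, v \notin hs -> y i v = 0) /\
    forall x : V -> R, \sum_(v <- hs) `|x v| `^ p <= 1 ->
      exists i, forall v, v \in hs ->
        `|x v - y i v| <= delta v /\ `|x v - y i v| <= `|x v|.
Proof.
move=> us p1 n4 d0 hcost hsum.
have nR : 4 <= n%:R :> R by rewrite ler_nat.
have t0 : 0 < n%:R / 4 :> R by lra.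
apply: (net_of_ball us p1 t0 d0).
apply: (@le_trans _ _ (expR (n%:R / 4) * \prod_(v <- hs) expR (cost v))).
  rewrite ler_pM2l ?expR_gt0 // big_seq [leRHS]big_seq.
  apply: ler_prod => v vs; rewrite hcost // andbT addr_ge0 // divr_ge0 //.
  by rewrite subr_ge0 ltW // expR_gt1 mulr_gt0 // powR_gt0 // d0.
rewrite -expR_sum -expRD -powR2n pow2_exp ler_expR.
apply: (@le_trans _ _ (n%:R / 4 + n%:R / 8)); first by rewrite lerD2l.
have en : n.-1%:R = n%:R - 1 :> R by rewrite -subn1 natrB //; lia.
rewrite en; have := ln2_ge; nra.
Qed.

Lemma le1_of_sum x (r : R) (v : V) : 0 < r -> (forall s, uniq s -> \sum_(v <- s) `|x v| `^ r <= 1) -> `|x v| <= 1.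
Proof.
move=> r0 h; apply: (@powR_le_inv _ r) => //; rewrite powR1.
by have := h [:: v] isT; rewrite big_seq1.
Qed.

(** The case [p < q]. The meshes are chosen so that every coordinate
    contributes at most [eps^q |x_v|^p] to the error; coordinates with
    [sigma <= eps] can be dropped. *)
Lemma entropy_upper_lt (p q C eps : R) sigma S hs cost n :
  1 <= p -> p < q -> like_diagonal q C sigma S -> (4 <= n)%N -> 0 < eps ->
  (forall v, 0 < sigma v) -> uniq hs -> (forall v, v \notin hs -> sigma v <= eps) ->
  (forall v, v \in hs ->
     1 + 2 / (expR (n%:R / 4 * (eps / sigma v) `^ (p^-1 - q^-1)^-1) - 1) <= expR (cost v)) ->
  \sum_(v <- hs) cost v <= n%:R / 8 ->
  (entropy_number (@lp_norm R V p%:E) (@lp_norm R V q%:E) S n <= (C * eps)%:E)%E.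
Proof.
move=> p1 pq hS n4 eps0 sig0 us tail hcost hsum.
have p0 : 0 < p by lra.
have q0 : 0 < q by lra.
have q1 : 1 <= q by lra.
have qp0 : 0 < q - p by rewrite subr_gt0.
pose delta v := (eps / sigma v) `^ (q / (q - p)).
have d0 v : 0 < delta v by rewrite powR_gt0 // divr_gt0.
have dp v : delta v `^ p = (eps / sigma v) `^ (p^-1 - q^-1)^-1.
  rewrite -powRrM; congr (_ `^ _).
  have -> : p^-1 - q^-1 = (q - p) / (p * q) by field; rewrite !gt_eqF.
  by rewrite invf_div mulrAC [q * p]mulrC.
have dq v : sigma v `^ q * delta v `^ (q - p) = eps `^ q.
  rewrite -powRrM divfK ?gt_eqF // powR_div ?(ltW (sig0 v)) ?(ltW eps0) //.
  by rewrite mulrC divfK // gt_eqF // powR_gt0.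
have [|y [y0 hy]] := @net_of_ball_pow2 hs delta cost p n us p1 n4 (fun v _ => d0 v) _ hsum.
  by move=> v vs; rewrite dp hcost.
apply: (entropy_upper q1 hS eps0).
exists y; split => [i|x]; first by exists hs => v; exact: y0.
rewrite -[1%E]/(1%:E) (lp_norm_finP x p0 ler01) => hx.
have hx1 s : uniq s -> \sum_(v <- s) `|x v| `^ p <= 1 by move=> /hx; rewrite powR1.
have [i hi] := hy x (hx1 _ us); exists i => s us'.
apply: (@le_trans _ _ (\sum_(v <- s) eps `^ q * `|x v| `^ p)); last first.
  rewrite -mulr_sumr -[leRHS]mulr1 ler_wpM2l ?powR_ge0 //; exact: hx1.
apply: ler_sum => v _ /=; rewrite normrM (gtr0_norm (sig0 v)) powRM ?(ltW (sig0 v)) //.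
have eqp (a : R) : 0 <= a -> a `^ q = a `^ (q - p) * a `^ p.
  by move=> a0; rewrite -powRD subrK // gt_eqF.
have [vs|vns] := boolP (v \in hs).
  have [h1 h2] := hi v vs.
  rewrite -(dq v) -mulrA ler_wpM2l ?powR_ge0 // eqp //.
  by apply: ler_pM; rewrite ?powR_ge0 //; apply: ler_powR2l; rewrite ?(ltW p0) ?(ltW qp0).
have -> : (x - y i) v = x v by rewrite -[LHS]/(x v - y i v) (y0 _ _ vns) subr0.
apply: ler_pM; rewrite ?powR_ge0 //.
  by apply: ler_powR2l; rewrite ?(ltW q0) ?(ltW (sig0 v)) ?tail.
rewrite eqp // -[leRHS]mul1r ler_wpM2r ?powR_ge0 //.
by apply: powR_le1; rewrite ?(ltW qp0) // (@le1_of_sum x p).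
Qed.

(** The case [q <= p]. On the head the unit ball of [l_p] is contained in a
    multiple of the unit ball of [l_q], which is covered with meshes
    proportional to [1 / sigma]; the tail is estimated by its norm. The weight
    [b] is [sigma^(1/d)], normalized, and arbitrary if [d = 0]. *)
Lemma entropy_upper_ge (p : \bar R) (q C h T : R) sigma S hs cost (b : V -> R) n :
  (1 < p)%E -> 1 <= q -> recip p <= q^-1 ->
  like_diagonal q C sigma S -> (4 <= n)%N -> 0 < h -> 0 < T ->
  (forall v, 0 < sigma v) -> uniq hs -> (0 < size hs)%N ->
  (forall v, 0 <= b v) ->
  (forall s, uniq s -> (forall v, v \in s -> v \notin hs) -> \sum_(v <- s) b v <= 1) ->
  (forall v, v \notin hs -> sigma v <= T * b v `^ (q^-1 - recip p)) ->
  (forall v, v \in hs ->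
     1 + 2 / (expR (n%:R / 4 * (h / sigma v) `^ q) - 1) <= expR (cost v)) ->
  \sum_(v <- hs) cost v <= n%:R / 8 ->
  (entropy_number (@lp_norm R V p) (@lp_norm R V q%:E) S n
    <= (C * (3 * (2 * (size hs)%:R `^ (q^-1 + (q^-1 - recip p)) * h + T)))%:E)%E.
Proof.
move=> p1 q1 pq hS n4 h0 T0 sig0 us hs0 b0 b1 tail hcost hsum.
have q0 : 0 < q by lra.
set d := q^-1 - recip p in tail *.
have d0 : 0 <= d by rewrite subr_ge0.
have /andP[rp0 _] := recip_bounds p1.
have dq0 : 0 <= d * q by rewrite mulr_ge0 // ltW.
have rq0 : 0 <= recip p * q by rewrite mulr_ge0 // ltW.
have drq : d * q + recip p * q = 1 by rewrite /d -mulrDl subrK mulVf ?gt_eqF.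
set N : R := (size hs)%:R.
have N0 : 0 < N by rewrite ltr0n.
pose M := 2 * N `^ d.
have M0 : 0 < M by rewrite mulr_gt0 // powR_gt0.
have dl0 v : v \in hs -> 0 < h / sigma v by move=> _; rewrite divr_gt0.
have [y [y0 hy]] := net_of_ball_pow2 us q1 n4 dl0 hcost hsum.
pose P := 2 * N `^ (q^-1 + d) * h.
have P0 : 0 < P by rewrite !mulr_gt0 // powR_gt0.
have eps0 : 0 < 3 * (P + T) by lra.
apply: (entropy_upper q1 hS eps0).
exists (fun i v => M * y i v); split => [i|x /(lp_ballP _ p1) [z [z0 z1 hz]]].
  by exists hs => v vs; rewrite y0 // mulr0.
have xq v : `|x v| `^ q <= z v `^ (recip p * q).
  by rewrite powRrM; apply: ler_powR2l; rewrite ?(ltW q0).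
have [|i hi] := hy (fun v => M^-1 * x v).
  apply: (@le_trans _ _ (\sum_(v <- hs) M `^ (- q) * (N `^ (d * q) * (N^-1 + z v)))).
    apply: ler_sum => v _; rewrite normrM normfV (gtr0_norm M0).
    rewrite powRM ?invr_ge0 ?(ltW M0) // powRV ?(ltW M0) // -powRN.
    rewrite ler_wpM2l ?powR_ge0 // (le_trans (xq v)) //.
    have Ni0 : 0 <= N^-1 by rewrite invr_ge0 ltW.
    have h1 := powR_interpolate Ni0 (z0 v) dq0 rq0 drq.
    have -> : z v `^ (recip p * q) = N `^ (d * q) * (N^-1 `^ (d * q) * z v `^ (recip p * q)).
      by rewrite mulrA powRV ?(ltW N0) // divff ?mul1r // gt_eqF // powR_gt0.
    by rewrite ler_wpM2l ?powR_ge0.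
  rewrite -!mulr_sumr big_split /= big_const_seq count_predT iter_addr addr0.
  rewrite -[N^-1 *+ _]mulr_natl -/N divff ?gt_eqF //.
  apply: (@le_trans _ _ (M `^ (- q) * (N `^ (d * q) * 2))).
    rewrite !ler_wpM2l ?powR_ge0 //; have := z1 hs us; lra.
  rewrite /M powRM ?powR_ge0 // -powRrM mulrN powRN [N `^ (- _)]powRN.
  rewrite [leLHS](_ : _ = 2 / 2 `^ q * (N `^ (d * q) / N `^ (d * q))); last by ring.
  rewrite divff ?gt_eqF ?powR_gt0 // mulr1 ler_pdivrMr ?powR_gt0 // mul1r.
  by rewrite -[leLHS](@powRr1 _ 2) // ler_powR // ler1n.
exists i => s us'.
have err v : `|(sigma \* (x - (fun v => M * y i v))) v| `^ q <=
    (if v \in hs then (M * h) `^ q else 0) + T `^ q * (if v \in hs then 0 else b v) + T `^ q * z v.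
  have -> : (sigma \* (x - (fun v => M * y i v))) v = sigma v * (x v - M * y i v) by [].
  rewrite normrM (gtr0_norm (sig0 v)).
  case: (boolP (v \in hs)) => [vs|vns].
    rewrite mulr0 addr0 -[leLHS]addr0; apply: lerD; last by rewrite mulr_ge0 ?powR_ge0.
    have [h1 _] := hi v vs; apply: ler_powR2l; rewrite ?(ltW q0) ?mulr_ge0 ?(ltW (sig0 v)) //.
    rewrite (_ : x v - M * y i v = M * (M^-1 * x v - y i v)); last by rewrite mulrBr mulVKf ?gt_eqF.
    rewrite normrM (gtr0_norm M0) mulrCA ler_pM2l // mulrC -ler_pdivlMr //.
  rewrite (y0 i _ vns) mulr0 subr0 add0r -mulrDr.
  apply: (@le_trans _ _ ((T * b v `^ d) `^ q * z v `^ (recip p * q))).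
    rewrite [leLHS]powRM ?(ltW (sig0 v)) //; apply: ler_pM; rewrite ?powR_ge0 //.
    by apply: ler_powR2l; rewrite ?(ltW q0) ?(ltW (sig0 v)) ?tail.
  rewrite powRM ?(ltW T0) ?powR_ge0 // -powRrM -mulrA ler_wpM2l ?powR_ge0 //.
  exact: powR_interpolate.
apply: (@le_trans _ _ (\sum_(v <- s) _)); first by apply: ler_sum => v _; exact: err.
rewrite !big_split /= -!mulr_sumr.
have s1 : \sum_(v <- s) (if v \in hs then (M * h) `^ q else 0) <= P `^ q.
  rewrite -big_mkcond /= -big_filter.
  rewrite big_const_seq count_predT iter_addr addr0 -mulr_natl.
  apply: (@le_trans _ _ (N * (M * h) `^ q)).
    rewrite ler_wpM2r ?powR_ge0 // ler_nat uniq_leq_size ?filter_uniq // => v.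
    by rewrite mem_filter => /andP[].
  rewrite -{1}(@powRVK _ q N) ?gt_eqF ?(ltW N0) // -powRM ?powR_ge0 ?(mulr_ge0 (ltW M0) (ltW h0)) //.
  rewrite le_eqVlt; apply/orP; left; apply/eqP; congr (_ `^ _).
  by rewrite /P /M (powRDr q^-1 d N0); ring.
have s2 : \sum_(v <- s) (if v \in hs then 0 else b v) <= 1.
  have -> : \sum_(v <- s) (if v \in hs then 0 else b v) = \sum_(v <- [seq v <- s | v \notin hs]) b v.
    by rewrite big_filter [RHS]big_mkcond; apply: eq_bigr => v _; case: ifP.
  by apply: b1; rewrite ?filter_uniq // => v; rewrite mem_filter => /andP[].
have s3 := z1 s us'.
apply: (@le_trans _ _ (P `^ q + T `^ q * 1 + T `^ q * 1)).
  by apply: lerD; [apply: lerD => //|]; rewrite ler_wpM2l ?powR_ge0.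
have PT : P `^ q <= (P + T) `^ q by apply: ler_powR2l; lra.
have TP : T `^ q <= (P + T) `^ q by apply: ler_powR2l; lra.
rewrite !mulr1; apply: (@le_trans _ _ (3 * (P + T) `^ q)); first by lra.
rewrite [leRHS]powRM //; last by lra.
rewrite ler_wpM2r ?powR_ge0 //.
by rewrite -[leLHS](@powRr1 _ 3) // ler_powR // ler1n.
Qed.

End Upper.

Section UpperLaws.
Variable R : realType.
Implicit Types (a b C rho nu alpha lambda r : R) (i j L K n : nat).

(** The index set and the operator are quantified inside, so that the constants
    are uniform over all trees. *)
Definition upper_law (p : \bar R) (q C0 rho nu alpha lambda : R) (F : nat -> R) :=
  exists (C : R) (n0 : nat), 0 < C /\
  forall (V : choiceType) (cls : V -> nat) (S : (V -> R) -> V -> R),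
    class_sizes C0 rho nu cls ->
    like_diagonal q C0 (fun v => gp (- alpha) (- lambda) (cls v)) S ->
    forall n, (n0 <= n)%N ->
    (entropy_number (@lp_norm R V p) (@lp_norm R V q%:E) S n <= (C * F n)%:E)%E.

(** [L] is the class in which a set of about [n] points ends. *)
Definition at_scale C rho nu n L :=
  [/\ n%:R <= C * gp rho (- nu) L, gp rho (- nu) L <= C * n%:R,
      log2 n%:R <= C * L.+1%:R & L.+1%:R <= C * log2 n%:R].

Lemma scale_exists rho nu B : 0 < rho -> 0 < B ->
  exists2 C : R, 1 <= C & exists n0, forall n, (n0 <= n)%N ->
    [/\ (4 <= n)%N, 1 <= log2 n%:R :> R & exists L,
      at_scale C rho nu n L /\ B * n%:R <= gp rho (- nu) L].
Proof.
move=> rho0 B0; have [C C1 hC] := class_of_size nu rho0.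
have [n1 h1] := hC B B0.
pose C' := C + C * B + B^-1.
have C0 : 0 < C by lra.
have CB0 : 0 < C * B by rewrite mulr_gt0.
have BV0 : 0 < B^-1 by rewrite invr_gt0.
exists C'; first by rewrite /C'; lra.
exists (maxn 4 n1) => n; rewrite geq_max => /andP[n4 /h1[_ l1 [L [g1 g2 l2 l3]]]].
have n0 : 0 <= n%:R :> R by [].
have l0 : 0 <= log2 n%:R :> R by lra.
have L0 : 0 <= L.+1%:R :> R by [].
have g0 := ltW (gp_gt0 rho (- nu) L).
split => //; exists L; split => //; split.
- apply: (@le_trans _ _ (B^-1 * gp rho (- nu) L)); first by rewrite -ler_pdivrMl ?invrK.
  by rewrite ler_wpM2r // /C'; lra.
- by apply: (le_trans g2); rewrite mulrA ler_wpM2r // /C'; lra.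
- by apply: (le_trans l2); rewrite ler_wpM2r // /C'; lra.
- by apply: (le_trans l3); rewrite ler_wpM2r // /C'; lra.
Qed.

Lemma scale_weight C rho nu alpha lambda n L : 0 < rho -> 0 < n%:R :> R -> 0 < log2 n%:R :> R ->
  at_scale C rho nu n L ->
  let D := C `^ `|alpha / rho| * C `^ `|- lambda - alpha * nu / rho| in
  let F := n%:R `^ (- (alpha / rho)) * log2 n%:R `^ (- lambda - alpha * nu / rho) in
  gp (- alpha) (- lambda) L <= D * F /\ F <= D * gp (- alpha) (- lambda) L.
Proof.
move=> rho0 n0 l0 [h1 h2 h3 h4] D F.
have e : gp (- alpha) (- lambda) L =
    gp rho (- nu) L `^ (- (alpha / rho)) * L.+1%:R `^ (- lambda - alpha * nu / rho).
  have e1 : rho * - (alpha / rho) = - alpha by rewrite mulrN mulrC divfK // gt_eqF.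
  have e2 : - nu * - (alpha / rho) + (- lambda - alpha * nu / rho) = - lambda.
    by rewrite mulrNN mulrA [nu * _]mulrC addrC subrK.
  by rewrite gp_powR e1 !gpE -mulrA -powRDr // e2.
have g0 := gp_gt0 rho (- nu) L.
have L0 : 0 < L.+1%:R :> R by [].
have i1 : gp rho (- nu) L `^ (- (alpha / rho)) <= C `^ `|alpha / rho| * n%:R `^ (- (alpha / rho)).
  by rewrite -[X in C `^ X]normrN; apply: powR_comparable.
have i2 : n%:R `^ (- (alpha / rho)) <= C `^ `|alpha / rho| * gp rho (- nu) L `^ (- (alpha / rho)).
  by rewrite -[X in C `^ X]normrN; apply: powR_comparable.
have [j1 j2] : L.+1%:R `^ (- lambda - alpha * nu / rho) <=
   C `^ `|- lambda - alpha * nu / rho| * log2 n%:R `^ (- lambda - alpha * nu / rho) /\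
   log2 n%:R `^ (- lambda - alpha * nu / rho) <=
   C `^ `|- lambda - alpha * nu / rho| * L.+1%:R `^ (- lambda - alpha * nu / rho).
  by split; apply: powR_comparable.
by rewrite e /D /F; split; rewrite mulrACA; apply: ler_pM; rewrite ?powR_ge0.
Qed.

(** The number [r] decides whether the class sizes or the powers of the weights
    win; either way the sum is dominated by its term at [L]. *)
Lemma sum_below rho nu alpha lambda r : 0 < rho - alpha * r ->
  exists2 C : R, 0 < C & forall L,
    \sum_(0 <= i < L.+1) gp rho (- nu) i *
      (gp (- alpha) (- lambda) i / gp (- alpha) (- lambda) L) `^ r <= C * gp rho (- nu) L.
Proof.
move=> h; have [C C0 hC] := @gp_sum_inc _ _ (- nu - lambda * r) h.
exists C => // L.
have e i : gp rho (- nu) i * gp (- alpha) (- lambda) i `^ r =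
    gp (rho - alpha * r) (- nu - lambda * r) i.
  by rewrite gp_powR gpM !mulNr.
have g0 := powR_gt0 r (gp_gt0 (- alpha) (- lambda) L).
rewrite -(ler_pM2r g0) mulr_suml big_mkord -mulrA e.
apply: le_trans (hC L); apply: ler_sum => i _.
rewrite powR_div ?(ltW (gp_gt0 _ _ _)) // mulrA divfK ?gt_eqF //.
by rewrite e.
Qed.

Lemma sum_above rho nu alpha lambda r : rho - alpha * r < 0 ->
  exists2 C : R, 0 < C & forall L K,
    \sum_(L <= i < K) gp rho (- nu) i *
      (gp (- alpha) (- lambda) i / gp (- alpha) (- lambda) L) `^ r <= C * gp rho (- nu) L.
Proof.
move=> h; have [C C0 hC] := @gp_sum_dec _ _ (- nu - lambda * r) h.
exists C => // L K.
have e i : gp rho (- nu) i * gp (- alpha) (- lambda) i `^ r =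
    gp (rho - alpha * r) (- nu - lambda * r) i.
  by rewrite gp_powR gpM !mulNr.
have g0 := powR_gt0 r (gp_gt0 (- alpha) (- lambda) L).
rewrite -(ler_pM2r g0) mulr_suml -mulrA e.
apply: le_trans (hC L K); apply: ler_sum => i _.
rewrite powR_div ?(ltW (gp_gt0 _ _ _)) // mulrA divfK ?gt_eqF //.
by rewrite e.
Qed.

Lemma gp_vanish a b eps : a < 0 -> 0 < eps -> exists K, forall i, (K <= i)%N -> gp a b i <= eps.
Proof.
move=> a0 eps0; have a2 : a / 2 < 0 by lra.
have [C C0 hC] := @geo_poly_sum _ (a / 2) b a2.
exists (Num.truncn (2 * log2 (C / eps) / - a)).+1 => i Ki.
have Ce0 : 0 < C / eps by rewrite divr_gt0.
have ai : log2 (C / eps) <= - (a / 2 * i%:R).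
  have : 2 * log2 (C / eps) / - a <= i%:R.
    by apply/ltW/(lt_le_trans (truncnS_gt _)); rewrite ler_nat.
  rewrite ler_pdivrMr ?oppr_gt0 //; lra.
have -> : gp a b i = 2 `^ (a / 2 * i%:R) * gp (a / 2) b i.
  by rewrite !gpE mulrA -powRDr //; congr (2 `^ _ * _); field.
have g1 : gp (a / 2) b i <= C.
  by apply: le_trans (hC i.+1); rewrite big_ord_recr /= lerDr sumr_ge0 // => j _; rewrite ltW // gp_gt0.
apply: (@le_trans _ _ ((C / eps)^-1 * C)); last by rewrite invf_div mulfVK // gt_eqF.
apply: ler_pM; rewrite ?powR_ge0 ?(ltW (gp_gt0 _ _ _)) //.
rewrite -[leLHS]invrK -powRN lef_pV2 ?posrE ?powR_gt0 //.
by rewrite -[leLHS]pow2_log2 // ler_powR // ler1n.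
Qed.

Section Cost.
Variables (C0 rho nu alpha lambda : R).

(** The cost of a net whose meshes follow the weights up to the class [L] and
    beyond: below [L] the meshes are fine, and a small power of the logarithm
    of the number of letters is summed; above [L] they are coarse. *)
Lemma cost_two_sided r C : 0 < C0 -> 0 < rho -> 0 < alpha -> 0 < r -> 1 <= C -> exists2 A : R, 0 < A &
  forall (V : choiceType) (cls : V -> nat) (hs : seq V) n L,
    class_sizes C0 rho nu cls -> uniq hs -> at_scale C rho nu n L ->
    exists2 cost : V -> R, (forall v, 1 + 2 / (expR (A *
        (gp (- alpha) (- lambda) L / gp (- alpha) (- lambda) (cls v)) `^ r) - 1) <= expR (cost v)) &
      \sum_(v <- hs) cost v <= n%:R / 8.
Proof.
move=> C00 rho0 al0 r0 C1.
(* the two exponents lie on either side of the critical value [rho / (alpha r)] *)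
pose eta : R := rho / (2 * alpha * r); pose K : R := 2 * rho / (alpha * r).
have eta0 : 0 < eta by rewrite divr_gt0 // !mulr_gt0.
have K0 : 0 < K by rewrite divr_gt0 // !mulr_gt0.
have etaK : eta <= K.
  by rewrite /K (_ : _ / _ = 4 * eta); [lra|rewrite /eta; field; rewrite !gt_eqF].
have heta : 0 < rho - alpha * (r * eta).
  by rewrite (_ : alpha * (r * eta) = rho / 2); [lra|rewrite /eta; field; rewrite !gt_eqF].
have hK : rho - alpha * (r * K) < 0.
  by rewrite (_ : alpha * (r * K) = 2 * rho); [lra|rewrite /K; field; rewrite !gt_eqF].
have [D1 D10 hD1] := letter_sum_powR eta0.
have [D2 D20 hD2] := letter_sum_powR K0.
have [E1 E10 hE1] := @sum_below rho nu alpha lambda _ heta.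
have [E2 E20 hE2] := @sum_above rho nu alpha lambda _ hK.
pose Q := 8 * C0 * (D1 * E1 + D2 * E2) * C.
have Q0 : 0 < Q by rewrite !mulr_gt0 ?addr_gt0 ?mulr_gt0 //; lra.
pose A := (1 + Q) `^ eta^-1.
have A1 : 1 <= A by rewrite le1_powR ?invr_ge0 ?(ltW eta0) //; lra.
have A0 : 0 < A by lra.
have Aeta : A `^ (- eta) * Q <= 1.
  rewrite powRN /A powRVK ?gt_eqF //; last by lra.
  by rewrite mulrC ler_pdivrMr; lra.
have AK : A `^ (- K) <= A `^ (- eta) by rewrite ler_powR // lerN2.
exists A => // V cls hs n L hc us [_ hsc _ _].
pose ra i := gp (- alpha) (- lambda) i / gp (- alpha) (- lambda) L.
have ra0 i : 0 < ra i by rewrite divr_gt0 ?gp_gt0.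
pose phi1 i := D1 * A `^ (- eta) * ra i `^ (r * eta).
pose phi2 i := D2 * A `^ (- K) * ra i `^ (r * K).
pose phi i := if (i <= L)%N then phi1 i else phi2 i.
have phi10 i : 0 <= phi1 i by rewrite !mulr_ge0 ?powR_ge0 ?(ltW D10).
have phi20 i : 0 <= phi2 i by rewrite !mulr_ge0 ?powR_ge0 ?(ltW D20).
have phi0 i : 0 <= phi i by rewrite /phi; case: ifP.
have inv v : (A * (gp (- alpha) (- lambda) L / gp (- alpha) (- lambda) (cls v)) `^ r) =
    A * (ra (cls v) `^ r)^-1.
  by rewrite -powRV ?(ltW (ra0 _)) // invf_div.
exists (fun v => phi (cls v)) => [v|].
  have p0 : 0 < A * (ra (cls v) `^ r)^-1 by rewrite mulr_gt0 // invr_gt0 powR_gt0.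
  have ex k : (A * (ra (cls v) `^ r)^-1) `^ (- k) = A `^ (- k) * ra (cls v) `^ (r * k).
    rewrite powRM ?(ltW A0) ?invr_ge0 ?powR_ge0 //; congr (_ * _).
    by rewrite powRV ?powR_ge0 // powRN invrK powRrM.
  rewrite inv /phi; case: ifP => _.
    by apply: (le_trans (hD1 _ p0)); rewrite ler_expR ex mulrA.
  by apply: (le_trans (hD2 _ p0)); rewrite ler_expR ex mulrA.
pose M := (maxn L (\max_(v <- hs) cls v)).+1.
have hM v : v \in hs -> (0 <= cls v < M)%N.
  by move=> vs; rewrite ltnS leq_max; apply/orP; right; apply: (@leq_bigmax_seq _ hs xpredT cls).
apply: (le_trans (class_sum_le C00 hc phi0 us hM)).
have LM : (L.+1 <= M)%N by rewrite ltnS leq_maxl.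
rewrite (@big_cat_nat _ _ _ L.+1) //=.
have g0 := gp_gt0 rho (- nu) L.
have s1 : \sum_(0 <= i < L.+1) gp rho (- nu) i * phi i <= D1 * A `^ (- eta) * (E1 * gp rho (- nu) L).
  rewrite (eq_big_nat _ _ (F2 := fun i => D1 * A `^ (- eta) * (gp rho (- nu) i * ra i `^ (r * eta)))).
    by rewrite -mulr_sumr ler_wpM2l ?mulr_ge0 ?powR_ge0 ?(ltW D10) // hE1.
  by move=> i; rewrite ltnS => /andP[_ iL]; rewrite /phi iL /phi1 mulrCA.
have s2 : \sum_(L.+1 <= i < M) gp rho (- nu) i * phi i <= D2 * A `^ (- K) * (E2 * gp rho (- nu) L).
  apply: (@le_trans _ _ (\sum_(L <= i < M) D2 * A `^ (- K) * (gp rho (- nu) i * ra i `^ (r * K)))).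
    rewrite [leRHS]big_ltn ?ltnS ?leq_maxl // -[leLHS]add0r; apply: lerD.
      by rewrite !mulr_ge0 ?powR_ge0 ?(ltW D20) ?(ltW g0).
    apply: ler_sum_nat => i /andP[Li _].
    by rewrite /phi leqNgt Li /= /phi2 mulrCA.
  by rewrite -mulr_sumr ler_wpM2l ?mulr_ge0 ?powR_ge0 ?(ltW D20) // hE2.
apply: (@le_trans _ _ (C0 * (A `^ (- eta) * (D1 * E1 + D2 * E2) * gp rho (- nu) L))).
  rewrite ler_pM2l //; apply: (le_trans (lerD s1 s2)).
  apply: (@le_trans _ _ (D1 * A `^ (- eta) * (E1 * gp rho (- nu) L) + D2 * A `^ (- eta) * (E2 * gp rho (- nu) L))).
    by rewrite lerD2l ler_wpM2r ?mulr_ge0 ?(ltW E20) ?(ltW g0) // ler_pM2l.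
  by rewrite [leRHS](_ : _ = D1 * A `^ (- eta) * (E1 * gp rho (- nu) L) + D2 * A `^ (- eta) * (E2 * gp rho (- nu) L)) //; ring.
apply: (@le_trans _ _ (C0 * (A `^ (- eta) * (D1 * E1 + D2 * E2) * (C * n%:R)))).
  by rewrite ler_pM2l // ler_wpM2l ?mulr_ge0 ?powR_ge0 ?addr_ge0 ?mulr_ge0 // ltW.
rewrite [leLHS](_ : _ = A `^ (- eta) * Q * (n%:R / 8)); last by rewrite /Q; field.
by rewrite -[leRHS]mul1r ler_wpM2r // divr_ge0.
Qed.

(** If the argument of the cost grows at least linearly in the class, with a
    slope above the growth rate of the class sizes, the classes from [L0] on
    cost a bounded amount. *)
Lemma cost_linear : 0 < C0 -> 0 < rho -> exists2 A : R, 1 <= A & exists2 C : R, 0 < C &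
  forall (V : choiceType) (cls : V -> nat) (hs : seq V) (x : nat -> R) (L0 : nat) (e0 : R),
    class_sizes C0 rho nu cls -> uniq hs -> 0 <= e0 ->
    (forall i, (i < L0)%N -> 1 + 2 / (expR (x i) - 1) <= expR e0) ->
    (forall v, v \in hs -> (L0 <= cls v)%N -> A * (cls v).+1%:R <= x (cls v)) ->
    exists2 cost : V -> R,
      (forall v, v \in hs -> 1 + 2 / (expR (x (cls v)) - 1) <= expR (cost v)) &
      \sum_(v <- hs) cost v <= C0 * (\sum_(0 <= i < L0) gp rho (- nu) i) * e0 + C.
Proof.
move=> C00 rho0; pose A := 2 * rho * ln 2 + 1 : R.
have l2 := @ln2_gt0 R.
have rl : 0 < rho * ln 2 by rewrite mulr_gt0.
have A1 : 1 <= A by rewrite /A; lra.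
have nr : - rho < 0 by lra.
have [D D0 hD] := @geo_poly_sum _ (- rho) (- nu) nr.
exists A => //; exists (C0 * (4 * D)); first by rewrite !mulr_gt0.
move=> V cls hs x L0 e0 hc us e00 hlow hhigh.
pose phi i := if (i < L0)%N then e0 else 4 * expR (- (A * i.+1%:R)).
have phi0 i : 0 <= phi i by rewrite /phi; case: ifP => // _; rewrite mulr_ge0 ?expR_ge0.
exists (fun v => phi (cls v)) => [v vs|].
  rewrite /phi; case: ltnP => [/hlow //|Lv].
  have Ax := hhigh v vs Lv.
  apply: (le_trans (letter_sum_exp _)).
    have : 1 <= x (cls v).
      by apply: le_trans Ax; rewrite -[leLHS]mulr1; apply: ler_pM; rewrite ?ler1n //.
    have := expR_ge1Dx (x (cls v)); lra.
  by rewrite ler_expR ler_pM2l // ler_expR lerN2.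
pose M := (maxn L0 (\max_(v <- hs) cls v)).+1.
have hM v : v \in hs -> (0 <= cls v < M)%N.
  by move=> vs; rewrite ltnS leq_max; apply/orP; right; apply: (@leq_bigmax_seq _ hs xpredT cls).
apply: (le_trans (class_sum_le C00 hc phi0 us hM)).
have LM : (L0 <= M)%N by rewrite leqW // leq_maxl.
rewrite (@big_cat_nat _ _ _ L0) //= mulrDr -mulrA; apply: lerD; rewrite ler_pM2l //.
  rewrite mulr_suml; apply: ler_sum_nat => i /andP[_ iL].
  by rewrite /phi iL.
apply: (@le_trans _ _ (\sum_(0 <= i < M) 4 * gp (- rho) (- nu) i)); last first.
  by rewrite -mulr_sumr big_mkord ler_pM2l.
rewrite [leRHS](@big_cat_nat _ _ _ L0) //= -[leLHS]add0r; apply: lerD.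
  by apply: sumr_ge0 => i _; rewrite mulr_ge0 // ltW // gp_gt0.
apply: ler_sum_nat => i /andP[Li _].
rewrite /phi ltnNge Li /= mulrCA ler_pM2l // !gpE mulrAC ler_wpM2r ?powR_ge0 //.
rewrite !pow2_exp -expRD ler_expR -natr1 /A.
have i0 : 0 <= i%:R :> R by [].
have := mulr_ge0 (ltW rl) i0; nra.
Qed.

End Cost.

End UpperLaws.

Section UpperCases.
Variable R : realType.
Implicit Types (a b C rho nu alpha lambda r : R) (i j L K n : nat).

(** Cut at [log2 n / (4 rho)]: the head has about [n^(1/4)] points up to
    logarithms and can afford very fine meshes, while the first class of the tail
    is still of the order of [log n]. *)
Lemma small_head C0 rho nu : 0 < C0 -> 0 < rho -> exists2 C : R, 1 <= C &
  exists n0, forall n, (n0 <= n)%N ->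
    [/\ (4 <= n)%N, 1 <= log2 n%:R :> R & exists L,
      [/\ (0 < L)%N, C0 * \sum_(0 <= i < L) gp rho (- nu) i <= n%:R `^ 2^-1,
          log2 n%:R <= 4 * rho * L%:R & L.+1%:R <= C * log2 n%:R]].
Proof.
move=> C00 rho0; have [D D0 hD] := @gp_sum_inc _ rho (- nu) rho0.
have ir0 : 0 < (4 * rho)^-1 by rewrite invr_gt0 mulr_gt0.
pose E := (4 * rho)^-1 + 2 + 4 * rho.
have E1 : 1 <= E by rewrite /E; lra.
exists E => //; have q0 : 0 < 4^-1 :> R by rewrite invr_gt0.
have [n1 h1] := @log_small _ 4^-1 (- nu) (C0 * (D * E `^ `|nu|)) q0.
exists (maxn 4 n1) => n; rewrite geq_max => /andP[n4 /h1[_ l1 hl]].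
split => //; set l := log2 n%:R in l1 hl *.
have n0 : 0 < n%:R :> R by rewrite ltr0n (leq_trans _ n4).
pose y := (4 * rho)^-1 * l.
have l0 : 0 < l by exact: lt_le_trans l1.
have y0 : 0 <= y by rewrite mulr_ge0 // ltW.
have /andP[t1 t2] := truncn_itv y0.
exists (Num.truncn y).+1; set L := Num.truncn y in t1 t2 *.
have el : l = 4 * rho * y by rewrite /y mulVKf // gt_eqF // mulr_gt0.
have lL : l <= 4 * rho * L.+1%:R by rewrite el ler_pM2l ?mulr_gt0 // ltW.
have yl : y + 2 <= ((4 * rho)^-1 + 2) * l.
  by rewrite mulrDl -/y lerD2l -[leLHS]mulr1 ler_pM2l.
have Ll : L.+2%:R <= E * l.
  rewrite -2!natr1 -addrA; apply: (@le_trans _ _ (y + 2)); first by rewrite lerD2r.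
  apply: (le_trans yl); rewrite ler_pM2r // /E.
  by rewrite lerDl mulr_ge0 // ltW.
split => //.
apply: (@le_trans _ _ (C0 * (D * (2 `^ (l / 4) * (E `^ `|nu| * l `^ (- nu)))))).
  rewrite ler_pM2l // big_mkord (le_trans (hD L)) // ler_pM2l // gpE.
  apply: ler_pM; rewrite ?powR_ge0 //.
    rewrite ler_powR ?ler1n //; apply: (@le_trans _ _ (rho * y)); first by rewrite ler_pM2l.
    by rewrite el mulrAC [4 * _]mulrC mulfK.
  rewrite -[X in E `^ X]normrN; apply: powR_comparable => //.
    by apply: le_trans Ll; rewrite ler_nat.
  apply: (le_trans lL); rewrite ler_pM2r // /E.
  by rewrite lerDr addr_ge0 // ltW.
have en : n%:R `^ 4^-1 = 2 `^ (l / 4) by rewrite powRrM pow2_log2.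
rewrite [leLHS](_ : _ = n%:R `^ 4^-1 * (C0 * (D * E `^ `|nu|) * l `^ (- nu))); last by rewrite en; ring.
apply: (@le_trans _ _ (n%:R `^ 4^-1 * n%:R `^ 4^-1)).
  by rewrite ler_wpM2l ?powR_ge0.
rewrite -powRDr // (_ : 4^-1 + 4^-1 = 2^-1 :> R) //.
by clear; field.
Qed.

Lemma ler_powRN (k x y : R) : 0 <= k -> 0 < y -> y <= x -> x `^ (- k) <= y `^ (- k).
Proof.
move=> k0 y0 yx; rewrite !powRN lef_pV2 ?posrE ?powR_gt0 ?(lt_le_trans y0) //.
by apply: ler_powR2l; rewrite ?(ltW y0).
Qed.

(** The number [t delta^p] of [net_of_ball] for [t = x / 4]. *)
Lemma mesh_power (r A x y z : R) : 0 < r -> 0 < A -> 0 < x -> 0 < y -> 0 < z ->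
  x / 4 * ((4 * A) `^ r^-1 * x `^ (- r^-1) * y / z) `^ r = A * (y / z) `^ r :> R.
Proof.
move=> r0 A0 x0 y0 z0.
have yz0 : 0 <= y / z by rewrite divr_ge0 // ltW.
have A40 : 0 <= 4 * A by rewrite mulr_ge0 // ltW.
rewrite [X in X `^ r](_ : _ = (4 * A) `^ r^-1 * (x `^ (- r^-1) * (y / z))); last by rewrite !mulrA.
rewrite (@powRM _ ((4 * A) `^ r^-1)) ?(mulr_ge0 (powR_ge0 _ _) yz0) ?powR_ge0 //.
rewrite (@powRM _ (x `^ _)) ?powR_ge0 // powRVK ?gt_eqF //.
rewrite -(@powRrM _ x) mulNr mulVf ?gt_eqF // powR_inv1 ?(ltW x0) //.
by field; rewrite gt_eqF.
Qed.

(** Here [eps] is of the order of [n^(1/q - 1/p)] times the weight of the class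
    [L] of about [n] points. The factor [A] in the meshes is what keeps the size
    of the net below [2^(n-1)]. *)
Lemma upper_lt_power (p q : R) C0 rho nu alpha lambda :
  1 < p -> p < q -> 0 < C0 -> 0 < rho -> 0 < alpha ->
  upper_law p%:E q C0 rho nu alpha lambda (fun n =>
    n%:R `^ (- (alpha / rho) + (q^-1 - p^-1)) * log2 n%:R `^ (- lambda - alpha * nu / rho)).
Proof.
move=> p1 pq C00 rho0 al0.
have p0 : 0 < p by lra.
have q0 : 0 < q by lra.
have p1' : 1 <= p by lra.
pose s := p^-1 - q^-1.
have s0 : 0 < s by rewrite subr_gt0 ltf_pV2.
have rs0 : 0 < s^-1 by rewrite invr_gt0.
have [C C1 [n0 hn]] := scale_exists nu rho0 (@ltr01 R).
have [A A0 hA] := @cost_two_sided _ C0 rho nu alpha lambda _ _ C00 rho0 al0 rs0 C1.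
pose D := C `^ `|alpha / rho| * C `^ `|- lambda - alpha * nu / rho|.
have CR : 0 < C by lra.
exists (C0 * ((4 * A) `^ s * D)), n0; split.
  by rewrite !mulr_gt0 // powR_gt0 ?mulr_gt0.
move=> V cls S hc hS n /hn[n4 l1 [L [hL _]]].
have nR : 0 < n%:R :> R by rewrite ltr0n (leq_trans _ n4).
have l0 : 0 < log2 n%:R :> R by lra.
have [w1 _] := scale_weight alpha lambda rho0 nR l0 hL.
pose sig i := gp (- alpha) (- lambda) i.
have sig0 i : 0 < sig i by exact: gp_gt0.
pose eps := (4 * A) `^ s * n%:R `^ (- s) * sig L.
have eps0 : 0 < eps by rewrite !mulr_gt0 ?powR_gt0 ?mulr_gt0.
have [K hK] := @gp_vanish _ (- alpha) (- lambda) eps ltac:(by rewrite oppr_lt0) eps0.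
have [hs [us hhs _]] := class_range 0 K C00 hc.
have [cost hcost hsum] := hA V cls hs n L hc us hL.
apply: le_trans (_ : _ <= (C0 * eps)%:E)%E _.
  apply: (@entropy_upper_lt _ V p q C0 eps _ S hs cost n p1' pq hS n4 eps0) => //.
    by move=> v; rewrite hhs /= -leqNgt; exact: hK.
  move=> v _; apply: le_trans (hcost v).
  rewrite le_eqVlt; apply/orP; left; apply/eqP.
  congr (1 + 2 / (expR _ - 1)).
  have := mesh_power rs0 A0 nR (sig0 L) (sig0 (cls v)); rewrite invrK => e.
  exact: e.
have -> : - (alpha / rho) + (q^-1 - p^-1) = - s + - (alpha / rho) by rewrite /s opprB addrC.
rewrite lee_fin (powRDr (- s) (- (alpha / rho)) nR).
set ll := log2 n%:R `^ _ in w1 *; set nn := n%:R `^ (- (alpha / rho)) in w1 *.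
rewrite [leRHS](_ : _ = C0 * ((4 * A) `^ s * n%:R `^ (- s) * (D * (nn * ll)))); last by ring.
by rewrite /eps ler_pM2l // ler_wpM2l // mulr_ge0 ?powR_ge0.
Qed.

(** The head consists of the classes up to the one with about [n] points; head
    and tail contribute errors of the same order. *)
Lemma upper_ge_power (p : \bar R) (q : R) C0 rho nu alpha lambda :
  (1 < p)%E -> 1 <= q -> recip p <= q^-1 -> 0 < C0 -> 0 < rho ->
  0 < alpha -> 0 < alpha - rho * (q^-1 - recip p) ->
  upper_law p q C0 rho nu alpha lambda (fun n =>
    n%:R `^ (- (alpha / rho) + (q^-1 - recip p)) * log2 n%:R `^ (- lambda - alpha * nu / rho)).
Proof.
move=> p1 q1 pq C00 rho0 al0; set d := q^-1 - recip p => ald.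
have d0 : 0 <= d by rewrite subr_ge0.
have q0 : 0 < q by lra.
have [C C1 [n0 hn]] := scale_exists nu rho0 (@ltr01 R).
have [A A0 hA] := @cost_two_sided _ C0 rho nu alpha lambda _ _ C00 rho0 al0 q0 C1.
have r0 : 0 < rho - alpha * 0 by rewrite mulr0 subr0.
have [E1 E10 hE1] := @sum_below _ rho nu alpha lambda 0 r0.
have nal : - alpha < 0 by rewrite oppr_lt0.
have [E2 E20 hE2] := @gp_sum_dec _ (- alpha) (- lambda) nal.
have [E3 E30 hE3] : exists2 E3 : R, 0 < E3 & 0 < d -> forall L K,
    \sum_(L <= i < K) gp rho (- nu) i *
      (gp (- alpha) (- lambda) i / gp (- alpha) (- lambda) L) `^ d^-1 <= E3 * gp rho (- nu) L.
  have [dp|dn] := ltP 0 d; last by exists 1 => // dp; move: (lt_le_trans dp dn); rewrite ltxx.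
  have hr : rho - alpha * d^-1 < 0.
    rewrite subr_lt0 ltr_pdivlMr //; lra.
  by have [E3 E30 hE3] := @sum_above _ rho nu alpha lambda _ hr; exists E3.
have CR : 0 < C by lra.
pose D := C `^ `|alpha / rho| * C `^ `|- lambda - alpha * nu / rho|.
pose Q := 2 * (C0 * E1 * C) `^ (q^-1 + d) * (4 * A) `^ q^-1 + (E2 + (C0 * E3 * C) `^ d).
have Q0 : 0 < Q.
  by rewrite addr_gt0 ?addr_gt0 ?mulr_gt0 ?powR_gt0 // !mulr_gt0.
exists (C0 * (3 * (Q * D))), n0; split.
  by rewrite !mulr_gt0 // powR_gt0.
move=> V cls S hc hS n /hn[n4 l1 [L [hL _]]].
have nR : 0 < n%:R :> R by rewrite ltr0n (leq_trans _ n4).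
have l0 : 0 < log2 n%:R :> R by lra.
have [w1 _] := scale_weight alpha lambda rho0 nR l0 hL.
pose sig i := gp (- alpha) (- lambda) i.
have sig0 i : 0 < sig i by exact: gp_gt0.
have [hs [us hhs hphi]] := class_range 0 L.+1 C00 hc.
have [cost hcost hsum] := hA V cls hs n L hc us hL.
have [_ gLn _ _] := hL.
have sz : (size hs)%:R = \sum_(v <- hs) (fun=> 1 : R) (cls v).
  by rewrite big_const_seq count_predT iter_addr addr0.
have /andP[sz1 sz2] := hphi (fun=> 1) (fun=> ler01).
have hs0 : (0 < size hs)%N.
  rewrite -(ltr0n R) sz; apply: lt_le_trans sz1; rewrite mulr_gt0 ?invr_gt0 //.
  rewrite big_nat_recr //= mulr1 ltr_wpDl ?gp_gt0 // sumr_ge0 // => i _.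
  by rewrite mulr1 ltW // gp_gt0.
have szn : (size hs)%:R <= C0 * E1 * C * n%:R.
  rewrite sz (le_trans sz2) // -!mulrA ler_pM2l //.
  apply: (@le_trans _ _ (E1 * gp rho (- nu) L)).
    apply: le_trans (hE1 L); apply: ler_sum => i _.
    by rewrite powRr0.
  by rewrite ler_pM2l.
pose h := (4 * A) `^ q^-1 * n%:R `^ (- q^-1) * sig L.
have h0 : 0 < h by rewrite !mulr_gt0 ?powR_gt0 ?mulr_gt0.
pose T := (E2 + (C0 * E3 * C) `^ d) * n%:R `^ d * sig L.
have T0 : 0 < T by rewrite !mulr_gt0 ?powR_gt0 // addr_gt0 // powR_gt0 // !mulr_gt0.
pose Z := C0 * E3 * C * n%:R * sig L `^ d^-1.
have Z0 : 0 < Z by rewrite !mulr_gt0 // powR_gt0.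
pose b v := if d == 0 then 0 else sig (cls v) `^ d^-1 / Z.
have tl v : v \notin hs -> (L < cls v)%N by rewrite hhs /= -leqNgt.
apply: (@le_trans _ _ (C0 * (3 * (2 * (size hs)%:R `^ (q^-1 + d) * h + T)))%:E).
  apply: (@entropy_upper_ge _ V p q C0 h T _ S hs cost b n p1 q1 pq hS n4 h0 T0) => //.
  - by move=> v; rewrite /b; case: eqP => // _; rewrite divr_ge0 ?powR_ge0 // ltW.
  - move=> s us' hsn; rewrite /b; have [dz|dn0] := eqVneq d 0.
      by rewrite big1.
    have dp : 0 < d by rewrite lt0r dn0.
    rewrite -mulr_suml ler_pdivrMr // mul1r.
    pose M := (\max_(v <- s) cls v).+1.
    have hM v : v \in s -> (L <= cls v < M)%N.
      move=> vs; rewrite ltnW ?tl ?hsn //= ltnS.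
      exact: (@leq_bigmax_seq _ s xpredT cls).
    apply: (le_trans (class_sum_le (phi := fun i => sig i `^ d^-1) C00 hc (fun i => powR_ge0 _ _) us' hM)).
    rewrite /Z -!mulrA ler_pM2l // -ler_pdivrMr ?mulr_gt0 ?powR_gt0 //.
    have := hE3 dp L M; rewrite -(ler_pM2r (powR_gt0 d^-1 (sig0 L))).
    rewrite mulr_suml => e3.
    rewrite ler_pdivrMr ?mulr_gt0 ?powR_gt0 //.
    apply: (@le_trans _ _ (E3 * gp rho (- nu) L * sig L `^ d^-1)).
      apply: le_trans e3; apply: ler_sum => i _.
      by rewrite powR_div ?(ltW (gp_gt0 _ _ _)) // -mulrA divfK // gt_eqF // powR_gt0.
    by rewrite !mulrA ler_wpM2r ?powR_ge0 // -!mulrA ler_pM2l.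
  - move=> v vns; rewrite -/d -/(sig (cls v)); have [dz|dn0] := eqVneq d 0.
      rewrite dz powRr0 mulr1 /T dz !powRr0 mulr1.
      apply: (@le_trans _ _ (E2 * sig L)); last by rewrite ler_pM2r // lerDl.
      apply: le_trans (hE2 L (cls v).+1).
      have Lv := ltnW (tl v vns).
      by rewrite big_nat_recr //= lerDr sumr_ge0 // => i _; rewrite ltW // gp_gt0.
    rewrite /b (negbTE dn0) powR_div ?powR_ge0 ?(ltW Z0) // powRVK ?(ltW (sig0 _)) //.
    rewrite mulrCA -[leLHS]mulr1 ler_pM2l // ler_pdivlMr ?powR_gt0 // mul1r.
    rewrite /Z powRM ?powR_ge0 ?mulr_ge0 ?(ltW C00) ?(ltW E30) ?(ltW CR) //.
    rewrite powRVK ?(ltW (sig0 _)) // /T ler_pM2r //.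
    rewrite powRM ?mulr_ge0 ?(ltW C00) ?(ltW E30) ?(ltW CR) //.
    by rewrite ler_wpM2r ?powR_ge0 // lerDr ltW.
  - move=> v _; apply: le_trans (hcost v).
    rewrite le_eqVlt; apply/orP; left; apply/eqP.
    congr (1 + 2 / (expR _ - 1)).
    exact: (mesh_power q0 A0 nR (sig0 L) (sig0 (cls v))).
have hN : 2 * (size hs)%:R `^ (q^-1 + d) * h <=
    2 * (C0 * E1 * C) `^ (q^-1 + d) * (4 * A) `^ q^-1 * (n%:R `^ d * sig L).
  apply: (@le_trans _ _ (2 * (C0 * E1 * C * n%:R) `^ (q^-1 + d) * h)).
    rewrite ler_pM2r // ler_pM2l //; apply: ler_powR2l => //.
    by rewrite addr_ge0 // invr_ge0 ltW.
  rewrite powRM ?mulr_ge0 ?(ltW C00) ?(ltW E10) ?(ltW CR) // (powRDr q^-1 d nR) /h powRN.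
  rewrite le_eqVlt; apply/orP; left; apply/eqP; field.
  by rewrite gt_eqF // powR_gt0.
rewrite lee_fin [- (alpha / rho) + d]addrC (powRDr d (- (alpha / rho)) nR).
set ll := log2 n%:R `^ _ in w1 *; set nn := n%:R `^ (- (alpha / rho)) in w1 *.
rewrite [leRHS](_ : _ = C0 * (3 * (Q * (n%:R `^ d * (D * (nn * ll)))))); last by ring.
rewrite ler_pM2l // ler_pM2l //.
apply: (@le_trans _ _ (Q * (n%:R `^ d * sig L))).
  rewrite [leRHS]mulrDl; apply: lerD => //.
  by rewrite /T -mulrA.
by rewrite ler_pM2l // ler_wpM2l ?powR_ge0.
Qed.

(** On the boundary all classes have the same weight in the norm, apart from
    logarithms. The head is so small that it can be covered with an error of the
    order of [1 / n], and only the norm of the tail counts. *)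
Lemma upper_ge_critical (p : \bar R) (q : R) C0 rho nu lambda :
  (1 < p)%E -> 1 <= q -> recip p <= q^-1 -> 0 < C0 -> 0 < rho ->
  (1 - nu) * (q^-1 - recip p) < lambda ->
  upper_law p q C0 rho nu (rho * (q^-1 - recip p)) lambda (fun n =>
    log2 n%:R `^ (- lambda + (1 - nu) * (q^-1 - recip p))).
Proof.
move=> p1 q1 pq C00 rho0; set d := q^-1 - recip p => hlam.
have d0 : 0 <= d by rewrite subr_ge0.
have q0 : 0 < q by lra.
have qi0 : 0 < q^-1 by rewrite invr_gt0.
set alpha := rho * d.
pose sig i := gp (- alpha) (- lambda) i.
have sig0 i : 0 < sig i by exact: gp_gt0.
have [E1 E10 hE1] : exists2 E : R, 0 < E & forall i, sig i <= E.
  have [dz|dn0] := eqVneq d 0.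
    exists 1 => // i; rewrite /sig /alpha dz mulr0 oppr0 gpE mul0r powRr0 mul1r.
    rewrite dz mulr0 in hlam.
    by rewrite powRN invf_le1 ?powR_gt0 // le1_powR ?ler1n // ltW.
  have nal : - alpha < 0 by rewrite oppr_lt0 mulr_gt0 // lt0r dn0.
  have [E E0 hE] := @geo_poly_sum _ (- alpha) (- lambda) nal.
  exists E => // i; apply: le_trans (hE i.+1); rewrite big_ord_recr /= lerDr.
  by apply: sumr_ge0 => j _; rewrite ltW // gp_gt0.
have [C C1 [n1 hn1]] := small_head nu C00 rho0.
(* [a] makes the error on the head [1 / n]; [K] is so small that a coordinate
   of the head costs at most [n^(1/4)] *)
pose a := (q^-1 + d) / 2 + 1.
have a0 : 0 < a by rewrite /a; lra.
pose K := (4 * a * q)^-1.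
have K0 : 0 < K by rewrite invr_gt0 !mulr_gt0.
have [D D0 hD] := letter_sum_powR K0.
have q4 : 0 < 4^-1 :> R by rewrite invr_gt0.
have [n2 hn2] := @log_small R 4^-1 0 (8 * (D * (4^-1 * (E1 `^ q)^-1) `^ (- K))) q4.
have [n3 hn3] := @log_small R 1 (lambda - (1 - nu) * d) 1 ltr01.
pose kap := - nu - lambda * d^-1.
have [E2 E20 hE2] : exists2 E : R, 0 < E & 0 < d -> forall L n,
    \sum_(L <= i < n) i.+1%:R `^ kap <= E * L.+1%:R `^ (kap + 1).
  have [dp|dn] := ltP 0 d; last by exists 1 => // dp; move: (lt_le_trans dp dn); rewrite ltxx.
  have hk : kap < -1.
    rewrite /kap; have : 1 - nu < lambda * d^-1 by rewrite ltr_pdivlMr.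
    lra.
  by have [E E0 hE] := powR_sum_dec hk; exists E.
have CR : 0 < C by lra.
pose w := - lambda + (1 - nu) * d.
pose B := C + 4 * rho.
have B0 : 0 < B by rewrite addr_gt0 // mulr_gt0.
pose Q := 2 + (1 + (C0 * E2) `^ d) * B `^ `|w|.
have Q0 : 0 < Q by rewrite addr_gt0 // mulr_gt0 ?powR_gt0 // addr_gt0 // powR_gt0 // mulr_gt0.
exists (C0 * (3 * Q)), (maxn n1 (maxn n2 n3)); split; first by rewrite !mulr_gt0.
move=> V cls S hc hS n; rewrite !geq_max => /and3P[/hn1[n4 l1 [L [L0 hL lL Ll]]] /hn2[_ _ s2] /hn3[_ _ s3]].
rewrite powRr0 mulr1 in s2; rewrite mul1r powRr1 // in s3.
have nR : 0 < n%:R :> R by rewrite ltr0n (leq_trans _ n4).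
have n1R : 1 <= n%:R :> R by rewrite ler1n (leq_trans _ n4).
set l := log2 n%:R in l1 lL Ll s3 *.
have l0 : 0 < l by exact: lt_le_trans l1.
have [hs [us hhs hphi]] := class_range 0 L C00 hc.
have sz : (size hs)%:R = \sum_(v <- hs) (fun=> 1 : R) (cls v).
  by rewrite big_const_seq count_predT iter_addr addr0.
have /andP[sz1 sz2] := hphi (fun=> 1) (fun=> ler01).
have hs0 : (0 < size hs)%N.
  rewrite -(ltr0n R) sz; apply: lt_le_trans sz1; rewrite mulr_gt0 ?invr_gt0 //.
  rewrite big_ltn // mulr1 ltr_pwDl ?gp_gt0 // sumr_ge0 // => i _.
  by rewrite mulr1 ltW // gp_gt0.
have szn : (size hs)%:R <= n%:R `^ 2^-1 :> R.
  rewrite sz (le_trans sz2) // (le_trans _ hL) // ler_pM2l //.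
  by apply: ler_sum => i _; rewrite mulr1.
pose h := n%:R `^ (- a).
have h0 : 0 < h by rewrite powR_gt0.
pose e0 := D * (4^-1 * (E1 `^ q)^-1) `^ (- K) * n%:R `^ 4^-1.
have e00 : 0 <= e0 by rewrite !mulr_ge0 ?powR_ge0 // ltW.
pose T := (1 + (C0 * E2) `^ d) * L.+1%:R `^ w.
have T0 : 0 < T by rewrite mulr_gt0 ?powR_gt0 // addr_gt0 // powR_gt0 // mulr_gt0.
pose Z := C0 * (E2 * L.+1%:R `^ (kap + 1)).
have Z0 : 0 < Z by rewrite !mulr_gt0 // powR_gt0.
pose b v := if d == 0 then 0 else sig (cls v) `^ d^-1 / Z.
have tl v : v \notin hs -> (L <= cls v)%N by rewrite hhs /= -leqNgt.
apply: (@le_trans _ _ (C0 * (3 * (2 * (size hs)%:R `^ (q^-1 + d) * h + T)))%:E).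
  apply: (@entropy_upper_ge _ V p q C0 h T _ S hs (fun=> e0) b n p1 q1 pq hS n4 h0 T0) => //.
  - by move=> v; rewrite /b; case: eqP => // _; rewrite divr_ge0 ?powR_ge0 // ltW.
  - move=> s us' hsn; rewrite /b; have [dz|dn0] := eqVneq d 0.
      by rewrite big1.
    have dp : 0 < d by rewrite lt0r dn0.
    rewrite -mulr_suml ler_pdivrMr // mul1r.
    pose M := (\max_(v <- s) cls v).+1.
    have hM v : v \in s -> (L <= cls v < M)%N.
      move=> vs; rewrite tl ?hsn //= ltnS.
      exact: (@leq_bigmax_seq _ s xpredT cls).
    apply: (le_trans (class_sum_le (phi := fun i => sig i `^ d^-1) C00 hc (fun i => powR_ge0 _ _) us' hM)).
    rewrite /Z ler_pM2l //; apply: le_trans (hE2 dp L M); apply: ler_sum => i _.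
    rewrite gp_powR gpM (_ : rho + - alpha * d^-1 = 0); last first.
      by rewrite /alpha mulNr mulfK ?gt_eqF // subrr.
    by rewrite gpE mul0r powRr0 mul1r mulNr.
  - move=> v vns; rewrite -/d -/(sig (cls v)); have [dz|dn0] := eqVneq d 0.
      rewrite dz powRr0 mulr1 /T dz powRr0.
      rewrite /w dz mulr0 addr0 /sig /alpha dz mulr0 oppr0 gpE mul0r powRr0 mul1r.
      rewrite dz mulr0 in hlam.
      apply: (@le_trans _ _ (L.+1%:R `^ (- lambda))).
        rewrite !powRN lef_pV2 ?posrE ?powR_gt0 //.
        by apply: ler_powR2l; rewrite ?(ltW hlam) // ler_nat ltnS tl.
      by rewrite -[leLHS]mul1r ler_wpM2r ?powR_ge0 // lerDl.
    rewrite /b (negbTE dn0) powR_div ?powR_ge0 ?(ltW Z0) // powRVK ?(ltW (sig0 _)) //.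
    rewrite mulrCA -[leLHS]mulr1 ler_pM2l // ler_pdivlMr ?powR_gt0 // mul1r.
    rewrite /Z mulrA powRM ?powR_ge0 ?mulr_ge0 ?(ltW C00) ?(ltW E20) //.
    rewrite -powRrM (_ : (kap + 1) * d = w); last first.
      by rewrite /kap /w mulrDl mulrDl !mulNr -mulrA mulVf // mulr1 mulrBl mul1r; ring.
    by rewrite /T ler_wpM2r ?powR_ge0 // lerDr.
  - move=> v _.
    have x0 : 0 < n%:R / 4 * (h / sig (cls v)) `^ q.
      by rewrite mulr_gt0 ?divr_gt0 // powR_gt0 // divr_gt0.
    apply: (le_trans (hD _ x0)); rewrite ler_expR /e0 -[leRHS]mulrA ler_pM2l //.
    have -> : n%:R `^ 4^-1 = (n%:R `^ (- (a * q))) `^ (- K).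
      rewrite -powRrM /K; congr (_ `^ _); rewrite mulrNN; field.
      by rewrite !gt_eqF.
    have y1 : 0 < 4^-1 / E1 `^ q by apply: divr_gt0 => //; apply: powR_gt0.
    have y2 : 0 < n%:R `^ (- (a * q)) by apply: powR_gt0.
    rewrite -(powRM (- K) (ltW y1) (ltW y2)).
    apply: (ler_powRN (ltW K0)); first exact: mulr_gt0.
    rewrite -mulNr powRrM -/h (powR_div q (ltW h0) (ltW (sig0 _))).
    have hq0 : 0 < h `^ q by apply: powR_gt0.
    have sq0 : 0 < sig (cls v) `^ q by apply: powR_gt0.
    have sE : sig (cls v) `^ q <= E1 `^ q.
      by apply: ler_powR2l; rewrite ?(ltW q0) ?(ltW (sig0 _)).
    rewrite [leLHS](_ : _ = 1 * (4^-1 * h `^ q * (E1 `^ q)^-1)); last by ring.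
    rewrite [leRHS](_ : _ = n%:R * (4^-1 * h `^ q * (sig (cls v) `^ q)^-1)); last by ring.
    have c0 : 0 < 4^-1 * h `^ q by apply: mulr_gt0.
    apply: ler_pM => //; first by rewrite (pmulr_rge0 _ c0) invr_ge0 powR_ge0.
    by rewrite (ler_pM2l c0) lef_pV2 // posrE powR_gt0.
  rewrite big_const_seq count_predT iter_addr addr0 -[leLHS]mulr_natl.
  apply: (@le_trans _ _ (n%:R `^ 2^-1 * e0)); first by rewrite ler_wpM2r.
  rewrite ler_pdivlMr //.
  rewrite /e0 [leLHS](_ : _ = n%:R `^ 2^-1 * n%:R `^ 4^-1 * (8 * (D * (4^-1 * (E1 `^ q)^-1) `^ (- K)))); last by ring.
  apply: (@le_trans _ _ (n%:R `^ 2^-1 * n%:R `^ 4^-1 * n%:R `^ 4^-1)).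
    by rewrite ler_wpM2l // mulr_ge0 ?powR_ge0.
  rewrite -!powRDr // (_ : 2^-1 + 4^-1 + 4^-1 = 1 :> R) ?powRr1 //.
  by clear; field.
rewrite lee_fin -[leRHS]mulrA ler_pM2l // -[leRHS]mulrA ler_pM2l // /Q [leRHS]mulrDl.
have hw : L.+1%:R `^ w <= B `^ `|w| * l `^ w.
  apply: powR_comparable => //.
    by apply: (le_trans Ll); rewrite ler_pM2r // /B lerDl mulr_ge0 // ltW.
  apply: (le_trans lL); apply: (@le_trans _ _ (4 * rho * L.+1%:R)).
    by rewrite ler_pM2l ?mulr_gt0 // ler_nat.
  by rewrite ler_pM2r // /B lerDr ltW.
apply: lerD; last by rewrite /T -mulrA ler_wpM2l // addr_ge0 // powR_ge0.
rewrite -mulrA ler_pM2l //.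
apply: (@le_trans _ _ (n%:R^-1)).
  apply: (@le_trans _ _ ((n%:R `^ 2^-1) `^ (q^-1 + d) * h)).
    by rewrite ler_pM2r //; apply: ler_powR2l => //; rewrite addr_ge0 // ltW.
  rewrite -powRrM -(powRDr _ _ nR) -[leRHS]powR_inv1 ?(ltW nR) //.
  by rewrite (_ : 2^-1 * (q^-1 + d) - a = -1) // /a; field; rewrite gt_eqF.
rewrite -/w (_ : w = - (lambda - (1 - nu) * d)); last by rewrite /w; ring.
by rewrite powRN lef_pV2 ?posrE ?powR_gt0.
Qed.

(** [mesh_power] for the weight [y^(-lambda)] and [eps] of the order of
    [x^(-s) m^(s - lambda)]. *)
Lemma critical_mesh (s lambda A x m y : R) : 0 < s -> 0 < A -> 0 < x -> 0 < m -> 0 < y ->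
  x / 4 * ((4 * A) `^ s * x `^ (- s) * m `^ (s - lambda) / y `^ (- lambda)) `^ s^-1
    = A * m * (y / m) `^ (lambda / s).
Proof.
move=> s0 A0 x0 m0 y0; have si0 : 0 < s^-1 by rewrite invr_gt0.
have p1 := powR_gt0 (s - lambda) m0; have p2 := powR_gt0 (- lambda) y0.
have := mesh_power si0 A0 x0 p1 p2; rewrite invrK => ->.
rewrite -mulrA; congr (_ * _).
rewrite (powR_div _ (ltW p1) (ltW p2)) (powR_div _ (ltW y0) (ltW m0)) -!powRrM.
rewrite mulrBl divff ?gt_eqF // (powRDr _ _ m0) powRr1 ?(ltW m0) // mulNr !powRN invrK.
by rewrite -mulrA [_^-1 * _]mulrC.
Qed.

(** The classes [i] below [log n / (4 rho)] have few points. In the others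
    [t delta^p] is a multiple of [l (i / l)^(lambda / s)] with [l = log n]; since
    [lambda > s] it is at least [A (i + 1)] with [A] above the growth rate of the
    class sizes, so these classes cost a bounded amount. *)
Lemma upper_lt_critical_large (p q : R) C0 rho nu lambda :
  1 < p -> p < q -> 0 < C0 -> 0 < rho -> p^-1 - q^-1 < lambda ->
  upper_law p%:E q C0 rho nu 0 lambda (fun n =>
    n%:R `^ (q^-1 - p^-1) * log2 n%:R `^ (- lambda + p^-1 - q^-1)).
Proof.
move=> p1 pq C00 rho0; set s := p^-1 - q^-1 => sl.
have p0 : 0 < p by lra.
have q0 : 0 < q by lra.
have p1' : 1 <= p by lra.
have s0 : 0 < s by rewrite subr_gt0 ltf_pV2.
pose kap := lambda / s.
have kap1 : 0 < kap - 1 by rewrite subr_gt0 ltr_pdivlMr // mul1r.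
have [A A1 [B B0 hB]] := @cost_linear R C0 rho nu C00 rho0.
have [D D0 hD] := @letter_sum_powR R 1 ltr01.
have [C C1 [n1 hn1]] := small_head nu C00 rho0.
have h20 : 0 < 2^-1 :> R by rewrite invr_gt0.
have [n2 hn2] := @log_small R 2^-1 (kap - 1) (16 * D) h20.
have [n3 hn3] := @log_small R 1 0 (16 * B) ltr01.
have r40 : 0 < 4 * rho by rewrite mulr_gt0.
have rk0 : 0 < (4 * rho) `^ (kap - 1) by rewrite powR_gt0.
have A0 : 0 < A by lra.
pose A2 := A * (4 * rho) `^ (kap - 1) + 1.
have A21 : 1 <= A2 by rewrite /A2 lerDr mulr_ge0 // ltW.
have A20 : 0 < A2 by lra.
exists (C0 * (4 * A2) `^ s), (maxn n1 (maxn n2 n3)); split.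
  by rewrite mulr_gt0 // powR_gt0 // mulr_gt0.
move=> V cls S hc hS n; rewrite !geq_max => /and3P[/hn1[n4 l1 [L [L0 hL lL Ll]]] /hn2[_ _ s2] /hn3[_ _ s3]].
rewrite powRr0 mulr1 powRr1 // in s3.
have nR : 0 < n%:R :> R by rewrite ltr0n (leq_trans _ n4).
set l := log2 n%:R in l1 lL Ll s2 *.
have l0 : 0 < l by exact: lt_le_trans l1.
pose eps := (4 * A2) `^ s * n%:R `^ (- s) * l `^ (s - lambda).
have eps0 : 0 < eps by rewrite !mulr_gt0 ?powR_gt0 // mulr_gt0.
have sigE i : gp (- 0) (- lambda) i = i.+1%:R `^ (- lambda) :> R.
  by rewrite oppr0 gpE mul0r powRr0 mul1r.
have lam0 : 0 < lambda by exact: lt_trans sl.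
have [K hK] : exists K, forall i, (K <= i)%N -> i.+1%:R `^ (- lambda) <= eps.
  exists (Num.truncn ((eps^-1) `^ lambda^-1)).+1 => i Ki.
  rewrite powRN -[leRHS]invrK lef_pV2 ?posrE ?powR_gt0 ?invr_gt0 //.
  rewrite -(@powRVK _ lambda eps^-1) ?gt_eqF ?invr_ge0 ?(ltW eps0) //.
  apply: ler_powR2l; rewrite ?(ltW lam0) ?powR_ge0 //.
  by apply/ltW/(lt_le_trans (truncnS_gt _)); rewrite ler_nat leqW.
have [hs [us hhs _]] := class_range 0 K C00 hc.
pose x i := A2 * l * (i.+1%:R / l) `^ kap.
pose e0 := D * l `^ (kap - 1).
have e00 : 0 <= e0 by rewrite mulr_ge0 ?powR_ge0 // ltW.
have [i iL|v _ Lv|cost hcost hsum] := hB V cls hs x L e0 hc us e00.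
- have il0 : 0 < i.+1%:R / l by rewrite divr_gt0.
  have x0 : 0 < x i by apply: mulr_gt0; [exact: mulr_gt0|exact: powR_gt0].
  apply: (le_trans (hD _ x0)); rewrite ler_expR /e0 ler_pM2l //.
  have -> : l `^ (kap - 1) = (l `^ (1 - kap)) `^ (- 1).
    by rewrite -powRrM; congr (_ `^ _); rewrite mulrN1 opprB.
  apply: ler_powRN => //; first by rewrite powR_gt0.
  have -> : x i = A2 * i.+1%:R `^ kap * l `^ (1 - kap).
    rewrite /x (powR_div _ (ler0n _ _) (ltW l0)) (powRDr _ _ l0) powRr1 ?(ltW l0) // powRN.
    by ring.
  rewrite -[leLHS]mul1r ler_wpM2r ?powR_ge0 // -[leLHS]mul1r.
  have kap0 : 0 <= kap by rewrite divr_ge0 ?(ltW lam0) ?(ltW s0).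
  by apply: ler_pM => //; apply: le1_powR => //; rewrite ler1n.
- have il0 : 0 < (cls v).+1%:R / l by rewrite divr_gt0.
  have -> : x (cls v) = A2 * (cls v).+1%:R * ((cls v).+1%:R / l) `^ (kap - 1).
    rewrite /x (_ : kap = 1 + (kap - 1)); last by rewrite addrC subrK.
    rewrite (powRDr _ _ il0) powRr1 ?(ltW il0) // (_ : 1 + (kap - 1) - 1 = kap - 1); last by rewrite [1 + _]addrC addrK.
    have ll : l / l = 1 by rewrite divff // gt_eqF.
    set Y := _ `^ (kap - 1).
    rewrite [LHS](_ : _ = A2 * (cls v).+1%:R * Y * (l / l)); last by ring.
    by rewrite ll mulr1.
  rewrite mulrAC ler_wpM2r //.
  have h4 : (4 * rho)^-1 <= (cls v).+1%:R / l.
    rewrite ler_pdivlMr // mulrC ler_pdivrMr // mulrC; apply: (le_trans lL).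
    by rewrite ler_pM2l // ler_nat leqW.
  apply: (@le_trans _ _ (A2 * ((4 * rho)^-1) `^ (kap - 1))); last first.
    by rewrite ler_pM2l //; apply: ler_powR2l; rewrite ?(ltW kap1) ?invr_ge0 ?(ltW r40).
  by rewrite powRV ?(ltW r40) // ler_pdivlMr // /A2 lerDl.
apply: (@le_trans _ _ (C0 * eps)%:E).
  apply: (@entropy_upper_lt _ V p q C0 eps _ S hs cost n p1' pq hS n4 eps0).
  - by move=> v; exact: gp_gt0.
  - exact: us.
  - by move=> v; rewrite hhs /= -leqNgt sigE; exact: hK.
  - move=> v vs; apply: le_trans (hcost v vs).
    by rewrite sigE /eps critical_mesh.
  apply: (le_trans hsum).
  rewrite (_ : n%:R / 8 = n%:R / 16 + n%:R / 16); last by clear; field.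
  apply: lerD; last by rewrite ler_pdivlMr // mulrC.
  apply: (@le_trans _ _ (n%:R `^ 2^-1 * e0)); first by rewrite ler_wpM2r.
  rewrite ler_pdivlMr // /e0 [leLHS](_ : _ = n%:R `^ 2^-1 * (16 * D * l `^ (kap - 1))); last by ring.
  apply: (@le_trans _ _ (n%:R `^ 2^-1 * n%:R `^ 2^-1)); first by rewrite ler_wpM2l ?powR_ge0.
  rewrite -powRDr // (_ : 2^-1 + 2^-1 = 1 :> R) ?powRr1 ?(ltW nR) //.
  by clear; field.
rewrite lee_fin -mulrA ler_pM2l // /eps -mulrA.
have -> : q^-1 - p^-1 = - s by rewrite /s opprB.
by have -> : - lambda + p^-1 - q^-1 = s - lambda by rewrite /s -addrA addrC.
Qed.

(** Beyond class [n] the weight is below [n^(-lambda)]. Up to class [n] the ratio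
    [(i + 1) / n] is at most [1], so for [lambda < s] its power [lambda / s] is
    at least [(i + 1) / n], and [cost_linear] applies to all classes at once. *)
Lemma upper_lt_critical_small (p q : R) C0 rho nu lambda :
  1 < p -> p < q -> 0 < C0 -> 0 < rho -> 0 < lambda -> lambda < p^-1 - q^-1 ->
  upper_law p%:E q C0 rho nu 0 lambda (fun n => n%:R `^ (- lambda)).
Proof.
move=> p1 pq C00 rho0 lam0; set s := p^-1 - q^-1 => sl.
have p0 : 0 < p by lra.
have q0 : 0 < q by lra.
have p1' : 1 <= p by lra.
have s0 : 0 < s by exact: lt_trans sl.
pose kap := lambda / s.
have kap1 : 0 < 1 - kap by rewrite subr_gt0 ltr_pdivrMr // mul1r.
have [A A1 [B B0 hB]] := @cost_linear R C0 rho nu C00 rho0.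
have [n3 hn3] := @log_small R 1 0 (8 * B) ltr01.
have A0 : 0 < A by lra.
exists (C0 * (4 * A) `^ s), (maxn 4 n3); split.
  by rewrite mulr_gt0 // powR_gt0 // mulr_gt0.
move=> V cls S hc hS n; rewrite !geq_max => /andP[n4 /hn3[_ _ s3]].
rewrite powRr0 mulr1 powRr1 // in s3.
have nR : 0 < n%:R :> R by rewrite ltr0n (leq_trans _ n4).
have eE : (4 * A) `^ s * n%:R `^ (- s) * n%:R `^ (s - lambda) = (4 * A) `^ s * n%:R `^ (- lambda).
  by rewrite -mulrA -powRDr // addKr.
pose eps := (4 * A) `^ s * n%:R `^ (- s) * n%:R `^ (s - lambda).
have eps0 : 0 < eps by rewrite !mulr_gt0 ?powR_gt0 // mulr_gt0.
have sigE i : gp (- 0) (- lambda) i = i.+1%:R `^ (- lambda) :> R.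
  by rewrite oppr0 gpE mul0r powRr0 mul1r.
have [hs [us hhs _]] := class_range 0 n C00 hc.
pose x i := A * n%:R * (i.+1%:R / n%:R) `^ kap.
have [//|v vs _|cost hcost hsum] := hB V cls hs x 0%N 0 hc us (lexx _).
  move: vs; rewrite hhs => /andP[_ vn].
  have il0 : 0 < (cls v).+1%:R / n%:R :> R by rewrite divr_gt0.
  have in1 : (cls v).+1%:R / n%:R <= 1 :> R by rewrite ler_pdivrMr // mul1r ler_nat.
  rewrite /x -mulrA ler_pM2l //.
  rewrite -[leLHS](@divfK _ n%:R) ?gt_eqF // mulrC ler_pM2l //.
  by rewrite -[leLHS]powRr1 ?(ltW il0) //; apply: ger_powR; rewrite ?il0 ?in1 // -subr_ge0 ltW.
apply: (@le_trans _ _ (C0 * eps)%:E).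
  apply: (@entropy_upper_lt _ V p q C0 eps _ S hs cost n p1' pq hS n4 eps0).
  - by move=> v; exact: gp_gt0.
  - exact: us.
  - move=> v; rewrite hhs /= -leqNgt sigE /eps eE => nv.
    apply: (@le_trans _ _ (n%:R `^ (- lambda))).
      by apply: ler_powRN; rewrite ?(ltW lam0) // ler_nat leqW.
    rewrite -[leLHS]mul1r ler_wpM2r ?powR_ge0 // le1_powR ?(ltW s0) //.
    by rewrite -[leLHS]mulr1; apply: ler_pM; rewrite ?ler1n.
  - by move=> v vs; apply: le_trans (hcost v vs); rewrite sigE /eps critical_mesh.
  apply: (le_trans hsum); rewrite mulr0 add0r.
  by rewrite ler_pdivlMr // mulrC.
by rewrite lee_fin /eps eE mulrA.
Qed.

End UpperCases.

(** * Lower bounds *)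

Section Codes.
Variables (R : realType) (V : choiceType).
Implicit Types (sigma z : V -> R) (hs : seq V).

(** A family of points indexed by words, with distances bounded below by a
    weighted Hamming distance. Its Hamming balls are counted by
    [chernoff_count]. *)
Lemma entropy_lower_code (p : \bar R) (q C theta t : R) sigma S (G A : finType)
    (X : {ffun G -> A} -> V -> R) (W : G -> R) n :
  1 <= q -> like_diagonal q C sigma S ->
  (forall c, (lp_norm p (X c) <= 1)%E) ->
  (0 < #|A|)%N -> 0 <= theta -> 0 < t ->
  (forall c c' B, 0 <= B -> lr_bound q (sigma \* (X c - X c')) B ->
     \sum_(g | c g != c' g) W g <= B `^ q) ->
  (2 ^ n.-1)%:R * (expR (t * theta) * \prod_g (1 + (#|A|%:R - 1) * expR (- (t * W g))))
    < #|A|%:R ^+ #|G| ->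
  ((theta `^ q^-1 / (4 * C))%:E <=
    entropy_number (@lp_norm R V p) (@lp_norm R V q%:E) S n)%E.
Proof.
move=> q1 hS hX cA th0 t0 hdist hcard; have q0 : 0 < q by lra.
pose near (c c' : {ffun G -> A}) := \sum_(g | c g != c' g) W g <= theta.
set F := expR _ * _ in hcard.
have F0 c : #|[pred c' | near c c']|%:R <= F.
  pose k g b : R := t * (W g * (b != c g)%:R).
  have -> : #|[pred c' | near c c']| = #|[pred c' : {ffun G -> A} | \sum_g k g (c' g) <= t * theta]|.
    apply: eq_card => c'; rewrite !inE /near -mulr_sumr ler_pM2l //.
    congr (_ <= _); rewrite big_mkcond; apply: eq_bigr => g _.
    by rewrite eq_sym; case: eqP; rewrite ?mulr1 ?mulr0.
  apply: (le_trans (chernoff_count _ _)); rewrite ler_pM2l ?expR_gt0 //.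
  rewrite le_eqVlt; apply/orP; left; apply/eqP; apply: eq_bigr => g _.
  rewrite (bigD1 (c g)) //= /k eqxx !mulr0 oppr0 expR0; congr (_ + _).
  rewrite (eq_bigr (fun=> expR (- (t * W g)))); last by move=> b /= ->; rewrite mulr1.
  rewrite sumr_const -[LHS]mulr_natl; congr (_ * _).
  by rewrite (cardC1 (c g)) -subn1 natrB.
have FF0 : 0 <= F.
  rewrite mulr_ge0 ?expR_ge0 // prodr_ge0 // => g _.
  by rewrite addr_ge0 // mulr_ge0 ?expR_ge0 // subr_ge0 ler1n.
apply: (entropy_lower q1 hS hX FF0 F0).
  by rewrite card_ffun [ltRHS]natrX.
move=> c c' B B0; rewrite /near -ltNge => far hb.
rewrite -(@powRK _ q B) ?gt_eqF //.
apply: ler_powR2l; rewrite ?invr_ge0 ?(ltW q0) //.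
by apply: (le_trans (ltW far)); exact: hdist.
Qed.

(** Sign vectors whose moduli are [z^(1/p)]. The exponential moment is taken at
    [1 / Wmax], so that [1 + e^(-x) <= 2 e^(-x/4)], valid for [x <= 1], can be
    used at every coordinate; then a Hamming ball whose radius is an eighth of the
    total weight contains less than a fraction [2^(1-n)] of all words. *)
Lemma entropy_lower_signs (p : \bar R) (q C Wmax : R) sigma S hs z n :
  (1 < p)%E -> 1 <= q -> like_diagonal q C sigma S -> uniq hs -> (0 < n)%N ->
  (forall v, 0 <= sigma v) ->
  (forall v, 0 <= z v) -> \sum_(v <- hs) z v <= 1 -> 0 < Wmax ->
  (forall v, v \in hs -> (sigma v * z v `^ recip p) `^ q <= Wmax) ->
  8 * n%:R * Wmax <= \sum_(v <- hs) (sigma v * z v `^ recip p) `^ q ->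
  ((((\sum_(v <- hs) (sigma v * z v `^ recip p) `^ q) / 8) `^ q^-1 / (4 * C))%:E <=
    entropy_number (@lp_norm R V p) (@lp_norm R V q%:E) S n)%E.
Proof.
move=> p1 q1 hS us n0 sig0 z0 z1 Wm0 hW hsum; have q0 : 0 < q by lra.
pose v_ (g : 'I_(size hs)) := tnth (in_tuple hs) g.
have vs g : v_ g \in hs by exact: mem_tnth.
pose W g := (sigma (v_ g) * z (v_ g) `^ recip p) `^ q.
pose X (c : {ffun 'I_(size hs) -> bool}) (v : V) : R :=
  oapp (fun g => (-1) ^+ c g * z v `^ recip p) 0 (insub (index v hs)).
have XE c g : X c (v_ g) = (-1) ^+ c g * z (v_ g) `^ recip p.
  have ig : index (v_ g) hs = g by rewrite /v_ (tnth_nth (v_ g)) index_uniq.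
  by rewrite /X ig valK.
have Xout c v : v \notin hs -> X c v = 0.
  by move=> vns; rewrite /X insubF // index_mem (negbTE vns).
have sW : \sum_(v <- hs) (sigma v * z v `^ recip p) `^ q = \sum_g W g by rewrite big_tnth.
rewrite sW; rewrite sW in hsum.
have W0 g : 0 <= W g by exact: powR_ge0.
apply: (@entropy_lower_code p q C _ (Wmax^-1) sigma S _ _ X W n q1 hS).
- move=> c; apply/(lp_ballP _ p1); exists (fun v => if v \in hs then z v else 0); split => [v|s us'|v].
  + by case: ifP.
  + apply: le_trans z1; rewrite -big_mkcond /= -big_filter.
    by apply: sum_le_subset; rewrite ?filter_uniq // => v; rewrite mem_filter => /andP[].
  + case: (boolP (v \in hs)) => [vh|/Xout ->]; last by rewrite normr0 powR_ge0.
    rewrite /X; case: insubP => [g _ _|]; last by rewrite index_mem vh.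
    by rewrite /= normrMsign ger0_norm // powR_ge0.
- by rewrite card_bool.
- by rewrite divr_ge0 // sumr_ge0.
- by rewrite invr_gt0.
- move=> c c' B B0 /(_ hs us); apply: le_trans.
  rewrite [leRHS]big_tnth big_mkcond /=; apply: ler_sum => g _.
  case: ifP => cg; last exact: powR_ge0.
  rewrite /W normrM (ger0_norm (sig0 _)); apply: ler_powR2l; rewrite ?(ltW q0) ?mulr_ge0 ?powR_ge0 //.
  rewrite ler_wpM2l // -[(X c - X c') _]/(X c (v_ g) - X c' (v_ g)) !XE -mulrBl normrM.
  rewrite (ger0_norm (powR_ge0 _ _)) -[leLHS]mul1r ler_wpM2r ?powR_ge0 //.
  have n2 : `|-1 - 1| = 2 :> R by rewrite -opprD normrN ger0_norm.
  have n2' : `|1 - -1| = 2 :> R by rewrite opprK ger0_norm.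
  by case: (c g) (c' g) cg => [] [] //= _; rewrite expr0 expr1 ?n2 ?n2' ler1n.
rewrite card_bool card_ord.
have step g : 1 + (2%:R - 1) * expR (- (Wmax^-1 * W g)) <= 2 * expR (- (Wmax^-1 * W g / 4)).
  have x0 : 0 <= Wmax^-1 * W g by rewrite mulr_ge0 // invr_ge0 ltW.
  have x1 : Wmax^-1 * W g <= 1 by rewrite mulrC ler_pdivrMr // mul1r hW.
  set x := Wmax^-1 * W g in x0 x1 *.
  rewrite (_ : 2%:R - 1 = 1 :> R) ?mul1r; last by clear; ring.
  have e1 : expR (- x) <= 1 - x / 2.
    rewrite expRN -[leRHS]invrK lef_pV2 ?posrE ?expR_gt0 ?invr_gt0 //; last first.
      by clear -x1 x0; lra.
    have h1 : 0 < 1 - x / 2 by clear -x1 x0; lra.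
    apply: (@le_trans _ _ (1 + x)); last exact: expR_ge1Dx.
    by rewrite -[leLHS]mul1r ler_pdivrMr //; clear -x0 x1; nra.
  have e2 := expR_ge1Dx (- (x / 4)).
  by clear -e1 e2; lra.
apply: (@le_lt_trans _ _ ((2 ^ n.-1)%:R * (expR (Wmax^-1 * ((\sum_g W g) / 8)) * \prod_(g < size hs) (2 * expR (- (Wmax^-1 * W g / 4)))))).
  rewrite ler_wpM2l // ler_pM2l ?expR_gt0 //; apply: ler_prod => g _.
  by rewrite step andbT addr_ge0 // mulr_ge0 ?expR_ge0 // subr_ge0 ler1n.
rewrite big_split /= prodr_const card_ord -expR_sum.
rewrite mulrCA [X in _ * X]mulrCA mulrCA -[ltRHS]mulr1 ltr_pM2l ?exprn_gt0 //.
rewrite mulrCA -expRD.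
set sW' := \sum_g W g in hsum *.
have -> : Wmax^-1 * (sW' / 8) + \sum_g - (Wmax^-1 * W g / 4) = - (sW' / Wmax / 8).
  rewrite sumrN -mulr_suml -mulr_sumr -/sW'.
  by clear -Wm0; field; rewrite gt_eqF.
have hn : n%:R <= sW' / Wmax / 8.
  by rewrite ler_pdivlMr // ler_pdivlMr // [_ * 8]mulrC.
rewrite -powR2n pow2_exp -expRD expR_lt1 subr_lt0; apply: lt_le_trans hn.
have l21 : ln 2 <= 1 :> R.
  have h1 : (-1 : R) < 1 by apply: lt_trans ltr01; rewrite oppr_lt0.
  by have := le_ln1Dx h1; rewrite (_ : 1 + 1 = 2 :> R).
apply: (@le_lt_trans _ _ n.-1%:R); first by rewrite -[leRHS]mulr1 ler_wpM2l.
by rewrite ltr_nat prednK.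
Qed.

(** Words over [2^k] letters: in each of [M] groups of [2^k] coordinates one
    coordinate is chosen. There are [2^(k M)] words, and a Hamming ball of radius
    [M / 2] contains at most [2^(k M / 2 + M)] of them. *)
Lemma entropy_lower_choices (p : \bar R) (q C s : R) sigma S (M k n : nat)
    (pt : 'I_M -> 'I_(2 ^ k) -> V) :
  (1 < p)%E -> 1 <= q -> like_diagonal q C sigma S ->
  (forall g a g' a', pt g a = pt g' a' -> g = g' /\ a = a') ->
  0 < s -> (forall g a, s <= sigma (pt g a)) ->
  (0 < M)%N -> (0 < n)%N -> (4 <= k)%N -> (4 * n <= k * M)%N ->
  ((s * M%:R `^ (q^-1 - recip p) / (8 * C))%:E <=
    entropy_number (@lp_norm R V p) (@lp_norm R V q%:E) S n)%E.
Proof.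
move=> p1 q1 hS pt_inj s0 hs M0 n0 k4 kM; have q0 : 0 < q by lra.
have C0 : 0 < C by case: hS.
have MR : 0 < M%:R :> R by rewrite ltr0n.
pose hit (c : {ffun 'I_M -> 'I_(2 ^ k)}) v := [exists g, v == pt g (c g)].
pose X c v : R := if hit c v then M%:R^-1 `^ recip p else 0.
pose w := (s * M%:R^-1 `^ recip p) `^ q.
have Mi0 : 0 < M%:R^-1 `^ recip p :> R by rewrite powR_gt0 // invr_gt0.
have w0 : 0 < w by rewrite powR_gt0 // mulr_gt0.
have up c : uniq [seq pt g (c g) | g <- enum 'I_M].
  by rewrite map_inj_uniq ?enum_uniq // => g g' /pt_inj[].
have hK : (2 ^ k)%:R = expR (k%:R * ln 2) :> R by rewrite -powR2n pow2_exp.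
have k0 : 0 < k%:R * ln 2 :> R by rewrite mulr_gt0 ?ln2_gt0 // ltr0n (leq_trans _ k4).
have := @entropy_lower_code p q C (w * (M%:R / 2)) (k%:R * ln 2 / w) sigma S _ _ X (fun=> w) n q1 hS.
move=> h; apply: le_trans (h _ _ _ _ _ _); last 1 first.
- rewrite !card_ord divfK ?gt_eqF //.
  have e : (1 + ((2 ^ k)%:R - 1) * expR (- (k%:R * ln 2))) <= 2 :> R.
    rewrite expRN -hK mulrBl divff ?pnatr_eq0 ?expn_eq0 // mul1r.
    by rewrite addrA -[leRHS]addr0 lerD // oppr_le0 invr_ge0.
  have e' : 0 <= 1 + ((2 ^ k)%:R - 1) * expR (- (k%:R * ln 2)) :> R.
    by rewrite addr_ge0 // mulr_ge0 ?expR_ge0 // subr_ge0 ler1n expn_gt0.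
  rewrite prodr_const card_ord.
  apply: (@le_lt_trans _ _ ((2 ^ n.-1)%:R * (expR (k%:R * ln 2 / w * (w * (M%:R / 2))) * 2 ^+ M))).
    rewrite ler_wpM2l // ler_pM2l ?expR_gt0 //.
    by apply: lerXn2r; rewrite // nnegrE.
  have -> : k%:R * ln 2 / w * (w * (M%:R / 2)) = k%:R * M%:R / 2 * ln 2.
    by clear -w0; field; rewrite gt_eqF.
  rewrite -powR2n pow2_exp -(powR_mulrn M) // pow2_exp -!expRD hK -expRM_natr ltr_expR.
  rewrite -!mulrDl [ltRHS]mulrAC ltr_pM2r ?ln2_gt0 //.
  have : (4 * n)%:R <= (k * M)%:R :> R by rewrite ler_nat.
  have : (4 * M)%:R <= (k * M)%:R :> R by rewrite ler_nat leq_mul2r k4 orbT.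
  have : n.-1%:R < n%:R :> R by rewrite ltr_nat prednK.
  by rewrite !natrM; clear; lra.
- have eM : M%:R^-1 `^ recip p = M%:R `^ (- recip p) :> R.
    by rewrite powRV ?(ltW MR) // powRN.
  have sM0 : 0 < s * M%:R^-1 `^ recip p by rewrite mulr_gt0.
  have M20 : 0 <= M%:R / 2 :> R by rewrite divr_ge0.
  rewrite lee_fin (powRM _ (ltW w0) M20) /w powRK ?gt_eqF ?(ltW sM0) // eM.
  rewrite (powR_div _ (ltW MR)) // (powRDr _ _ MR).
  have h2 : 0 < 2 `^ q^-1 :> R by rewrite powR_gt0.
  have h22 : 2 `^ q^-1 <= 2 :> R.
    by rewrite -[leRHS](@powRr1 _ 2) //; apply: ler_powR; rewrite ?ler1n // invf_le1.
  have K0 : 0 < s * M%:R `^ q^-1 * M%:R `^ (- recip p) / (4 * C).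
    by rewrite divr_gt0 ?mulr_gt0 ?powR_gt0.
  rewrite [leLHS](_ : _ = s * M%:R `^ q^-1 * M%:R `^ (- recip p) / (4 * C) * 2^-1); last first.
    by clear -C0; field; rewrite gt_eqF.
  rewrite [leRHS](_ : _ = s * M%:R `^ q^-1 * M%:R `^ (- recip p) / (4 * C) * (2 `^ q^-1)^-1); last first.
    by clear -C0 h2; field; rewrite !gt_eqF.
  by rewrite ler_pM2l // lef_pV2 ?posrE.
- move=> c; apply/(lp_ballP _ p1).
  exists (fun v => if hit c v then M%:R^-1 else 0); split => [v|t ut|v].
  + by case: ifP => // _; rewrite invr_ge0 ltW.
  + apply: (@le_trans _ _ (\sum_(v <- [seq pt g (c g) | g <- enum 'I_M]) M%:R^-1)).
      rewrite -big_mkcond /= -big_filter.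
      apply: (@sum_le_subset _ _ (fun=> M%:R^-1)); rewrite ?filter_uniq //.
      move=> v; rewrite mem_filter => /andP[/existsP[g /eqP ->] _] _.
      by apply/mapP; exists g; rewrite ?mem_enum.
    rewrite big_const_seq count_predT iter_addr addr0 size_map size_enum_ord.
    by rewrite -[leLHS]mulr_natl divff // gt_eqF.
  + rewrite /X; case: ifP => _; last by rewrite normr0 powR_ge0.
    by rewrite ger0_norm // ltW.
- by rewrite card_ord expn_gt0.
- by rewrite mulr_ge0 ?divr_ge0 ?(ltW w0).
- by rewrite divr_gt0.
- move=> c c' B B0.
  pose t := [seq pt g (c g) | g <- enum 'I_M & c g != c' g].
  have ut : uniq t.
    have uf : uniq [seq g <- enum 'I_M | c g != c' g] by exact: filter_uniq (enum_uniq _).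
    by rewrite map_inj_uniq // => g g' /pt_inj[].
  move=> /(_ t ut); apply: le_trans.
  rewrite big_map big_filter /= big_enum_cond /=.
  apply: ler_sum => g cg.
  have h1 : hit c (pt g (c g)) by apply/existsP; exists g.
  have h2 : hit c' (pt g (c g)) = false.
    apply/negbTE; rewrite /hit negb_exists; apply/fintype.forallP => g'.
    apply/negP => /eqP /pt_inj[e e'].
    by move: cg; rewrite e' e eqxx.
  rewrite -[(X c - X c') _]/(X c (pt g (c g)) - X c' (pt g (c g))) /X h1 h2 subr0.
  have sg : 0 <= sigma (pt g (c g)) by apply: le_trans (hs _ _); exact: ltW.
  apply: ler_powR2l; rewrite ?(ltW q0) ?mulr_ge0 ?(ltW s0) ?(ltW Mi0) //.
  by rewrite normrM (ger0_norm sg) (gtr0_norm Mi0) ler_pM2r.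
Qed.

End Codes.

Section LowerLaws.
Variable R : realType.
Implicit Types (a b C rho nu alpha lambda r : R) (i j L K n : nat).

Definition lower_law (p : \bar R) (q C0 rho nu alpha lambda : R) (F : nat -> R) :=
  exists (C : R) (n0 : nat), 0 < C /\
  forall (V : choiceType) (cls : V -> nat) (S : (V -> R) -> V -> R),
    class_sizes C0 rho nu cls ->
    like_diagonal q C0 (fun v => gp (- alpha) (- lambda) (cls v)) S ->
    forall n, (n0 <= n)%N ->
    ((C^-1 * F n)%:E <= entropy_number (@lp_norm R V p) (@lp_norm R V q%:E) S n)%E.

Lemma powR_root8 (q : R) x : 1 <= q -> 0 <= x -> x `^ q^-1 / 8 <= (x / 8) `^ q^-1.
Proof.
move=> q1 x0; have q0 : 0 < q by lra.
rewrite powR_div // ler_wpM2l ?powR_ge0 // lef_pV2 ?posrE ?powR_gt0 //.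
by rewrite -[leRHS](@powRr1 _ 8) //; apply: ler_powR; rewrite ?ler1n // invf_le1.
Qed.

(** All points of one class of size comparable to [n]. *)
Lemma lower_power (p : \bar R) (q : R) C0 rho nu alpha lambda :
  (1 < p)%E -> 1 <= q -> 0 < C0 -> 0 < rho ->
  lower_law p q C0 rho nu alpha lambda (fun n =>
    n%:R `^ (- (alpha / rho) + (q^-1 - recip p)) * log2 n%:R `^ (- lambda - alpha * nu / rho)).
Proof.
move=> p1 q1 C00 rho0; set d := q^-1 - recip p.
have q0 : 0 < q by lra.
have B0 : 0 < 8 * C0 by rewrite mulr_gt0.
have [C C1 [n0 hn]] := scale_exists nu rho0 B0.
have CR : 0 < C by lra.
pose D := C `^ `|alpha / rho| * C `^ `|- lambda - alpha * nu / rho|.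
have D0 : 0 < D by rewrite mulr_gt0 // powR_gt0.
pose E := C0 * C + 1.
have E0 : 0 < E by rewrite addr_gt0 // mulr_gt0.
exists (32 * C0 * (E `^ `|d| * D)), n0; split.
  by rewrite !mulr_gt0 // powR_gt0.
move=> V cls S hc hS n /hn[n4 l1 [L [hL hB]]].
have nR : 0 < n%:R :> R by rewrite ltr0n (leq_trans _ n4).
have l0 : 0 < log2 n%:R :> R by exact: lt_le_trans l1.
have [_ w2] := scale_weight alpha lambda rho0 nR l0 hL.
have [_ gLn _ _] := hL.
have [hs [us hhs _ /andP[sz1 sz2]]] := hc L.
set N : R := (size hs)%:R in sz1 sz2.
have g0 := gp_gt0 rho (- nu) L.
have hN : 8 * n%:R <= N.
  by apply: le_trans sz1; rewrite ler_pdivlMl // mulrCA mulrA.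
have N0 : 0 < N by apply: lt_le_trans hN; rewrite mulr_gt0.
have hN2 : N <= E * n%:R.
  apply: (le_trans sz2); apply: (@le_trans _ _ (C0 * (C * n%:R))).
    by rewrite ler_pM2l.
  by rewrite mulrA ler_pM2r // lerDl.
pose sg := gp (- alpha) (- lambda) L.
have sg0 : 0 < sg by exact: gp_gt0.
pose W := (sg * N^-1 `^ recip p) `^ q.
have Ni0 : 0 < N^-1 by rewrite invr_gt0.
have W0 : 0 < W by rewrite powR_gt0 // mulr_gt0 // powR_gt0.
have n0' : (0 < n)%N by rewrite (leq_trans _ n4).
pose sig (v : V) := gp (- alpha) (- lambda) (cls v).
have eW v : v \in hs -> (sig v * N^-1 `^ recip p) `^ q = W.
  by rewrite hhs /W /sig => /eqP ->.
have sumW : \sum_(v <- hs) (sig v * N^-1 `^ recip p) `^ q = N * W.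
  rewrite (eq_big_seq (fun=> W)) // big_const_seq count_predT iter_addr addr0.
  by rewrite -[LHS]mulr_natl.
have := @entropy_lower_signs R V p q C0 W sig S hs (fun=> N^-1) n p1 q1 hS us n0'.
move=> h; apply: le_trans (h _ _ _ _ _ _).
- rewrite sumW lee_fin.
  have NW0 : 0 <= N * W by rewrite mulr_ge0 ?(ltW N0) ?(ltW W0).
  apply: (@le_trans _ _ ((N * W) `^ q^-1 / 8 / (4 * C0))); last first.
    by rewrite ler_pM2r ?invr_gt0 ?mulr_gt0 //; apply: powR_root8.
  have eNW : (N * W) `^ q^-1 = sg * N `^ d.
    have s0 : 0 <= sg * N^-1 `^ recip p by rewrite mulr_ge0 ?powR_ge0 ?(ltW sg0).
    rewrite (powRM _ (ltW N0) (ltW W0)) powRK ?gt_eqF //.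
    by rewrite powRV ?(ltW N0) // -powRN mulrCA -powRDr.
  rewrite eNW.
  have hd : n%:R `^ d <= E `^ `|d| * N `^ d.
    apply: powR_comparable => //.
    apply: (@le_trans _ _ (8 * n%:R)); first by rewrite -[leLHS]mul1r ler_pM2r // ler1n.
    by apply: (le_trans hN); rewrite -[leLHS]mul1r ler_pM2r // /E lerDr mulr_ge0 ?(ltW C00) ?(ltW CR).
  rewrite [- (alpha / rho) + d]addrC (powRDr d (- (alpha / rho)) nR).
  set ll := log2 n%:R `^ _ in w2 *; set nn := n%:R `^ (- (alpha / rho)) in w2 *.
  have K0 : 0 < 32 * C0 by rewrite mulr_gt0.
  have ED0 : 0 < E `^ `|d| * D by rewrite mulr_gt0 // powR_gt0.
  rewrite [leRHS](_ : _ = sg * N `^ d / (32 * C0)); last by clear -C00; field; rewrite gt_eqF.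
  rewrite ler_pdivlMr // invfM.
  have cancel (x y z : R) : 0 < x -> x^-1 * y^-1 * z * x = y^-1 * z.
    by move=> x0; rewrite mulrAC [x^-1 * _]mulrC mulfVK ?gt_eqF.
  rewrite cancel // -[_ * nn * ll]mulrA ler_pdivrMl // [leRHS](_ : _ = E `^ `|d| * N `^ d * (D * sg)); last by ring.
  by apply: ler_pM => //; rewrite ?powR_ge0 ?mulr_ge0 ?powR_ge0.
- by move=> v; rewrite ltW // gp_gt0.
- by move=> _; exact: ltW.
- rewrite big_const_seq count_predT iter_addr addr0 -[leLHS]mulr_natl divff //.
  by rewrite gt_eqF.
- exact: W0.
- by move=> v /eW ->.
- by rewrite sumW ler_pM2r.
Qed.

(** All points of the classes between [L] and [2 L], with Hölder-optimal
    weights: every class contributes the same amount. *)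
Lemma lower_ge_critical (p : \bar R) (q : R) C0 rho nu lambda :
  (1 < p)%E -> 1 <= q -> 0 < C0 -> 0 < rho -> 0 < q^-1 - recip p ->
  lower_law p q C0 rho nu (rho * (q^-1 - recip p)) lambda (fun n =>
    log2 n%:R `^ (- lambda + (1 - nu) * (q^-1 - recip p))).
Proof.
move=> p1 q1 C00 rho0; set d := q^-1 - recip p => d0.
have q0 : 0 < q by lra.
set alpha := rho * d.
pose kap := - nu - lambda * d^-1.
pose w := - lambda + (1 - nu) * d.
pose sg i := gp (- alpha) (- lambda) i.
have sgd i : sg i `^ d^-1 = gp (- rho) (- lambda * d^-1) i.
  by rewrite gp_powR /alpha -mulNr mulfK // gt_eqF.
have nr : - rho < 0 by rewrite oppr_lt0.
have [E E0 hE] := @gp_sum_dec _ (- rho) (- lambda * d^-1) nr.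
pose c2 := C0^-1 * (2 `^ `|kap|)^-1.
have p20 : 0 < 2 `^ `|kap| :> R by rewrite powR_gt0.
have c20 : 0 < c2 by rewrite mulr_gt0 // invr_gt0.
have B0 : 0 < 8 * E / c2 by rewrite divr_gt0 // mulr_gt0.
have [C C1 [n0 hn]] := scale_exists nu rho0 B0.
have CR : 0 < C by lra.
exists (32 * C0 * (C `^ `|w| / c2 `^ d)), n0; split.
  by rewrite !mulr_gt0 ?invr_gt0 // powR_gt0.
move=> V cls S hc hS n /hn[n4 l1 [L [hL hB]]].
have nR : 0 < n%:R :> R by rewrite ltr0n (leq_trans _ n4).
have l0 : 0 < log2 n%:R :> R by exact: lt_le_trans l1.
have [_ _ lL Ll] := hL.
have L0 : 0 < L.+1%:R :> R by [].
have [hs [us hhs hphi]] := class_range L (L + L.+1) C00 hc.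
pose sig (v : V) := sg (cls v).
pose Z := \sum_(v <- hs) sig v `^ d^-1.
have sig0 v : 0 < sig v by exact: gp_gt0.
have hZ : c2 * L.+1%:R `^ (kap + 1) <= Z.
  have /andP[h1 _] := hphi (fun i => sg i `^ d^-1) (fun i => powR_ge0 _ _).
  apply: le_trans h1; rewrite /c2 -mulrA ler_pM2l ?invr_gt0 //.
  apply: (@le_trans _ _ (\sum_(L <= i < L + L.+1) (2 `^ `|kap|)^-1 * L.+1%:R `^ kap)).
    rewrite sumr_const_nat addKn (powRDr _ _ L0) powRr1 // mulrA.
    by rewrite -[leRHS]mulr_natr.
  apply: ler_sum_nat => i /andP[Li iL].
  rewrite sgd gpM subrr gpE mul0r powRr0 mul1r mulNr -/kap.
  rewrite ler_pdivrMl //; apply: powR_comparable => //.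
    by rewrite -[leLHS]mul1r; apply: ler_pM; rewrite ?ler1n ?ler_nat.
  by rewrite -natrM ler_nat; clear -iL; lia.
have Z0 : 0 < Z by apply: lt_le_trans hZ; rewrite mulr_gt0 // powR_gt0.
pose z v := if v \in hs then sig v `^ d^-1 / Z else 0.
have z0 v : 0 <= z v by rewrite /z; case: ifP => // _; rewrite divr_ge0 ?powR_ge0 ?(ltW Z0).
have sz : \sum_(v <- hs) z v = 1.
  rewrite (eq_big_seq (fun v => sig v `^ d^-1 / Z)); last by move=> v vh; rewrite /z vh.
  by rewrite -mulr_suml divff // gt_eqF.
have Wz v : v \in hs -> (sig v * z v `^ recip p) `^ q = Z `^ (d * q) * z v.
  move=> vh; have zv0 : 0 < z v by rewrite /z vh divr_gt0 // powR_gt0.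
  have -> : sig v = (Z * z v) `^ d.
    by rewrite /z vh mulrCA divff ?gt_eqF // mulr1 powRVK ?gt_eqF // ltW.
  rewrite (powRM _ (ltW Z0) (ltW zv0)) -mulrA -powRDr // /d subrK -/d.
  rewrite powRM ?powR_ge0 // -powRrM; congr (_ * _).
  by rewrite -powRrM mulVf ?gt_eqF // powRr1 // ltW.
have sumW : \sum_(v <- hs) (sig v * z v `^ recip p) `^ q = Z `^ (d * q).
  by rewrite (eq_big_seq _ Wz) -mulr_sumr sz mulr1.
have Zq0 : 0 < Z `^ (d * q) by rewrite powR_gt0.
have n0' : (0 < n)%N by rewrite (leq_trans _ n4).
pose zm := E * gp (- rho) (- lambda * d^-1) L / Z.
have zm0 : 0 < zm by rewrite divr_gt0 // mulr_gt0 // gp_gt0.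
have := @entropy_lower_signs R V p q C0 (Z `^ (d * q) * zm) sig S hs z n p1 q1 hS us n0'.
move=> h; apply: le_trans (h _ _ _ _ _ _).
- rewrite sumW lee_fin.
  apply: (@le_trans _ _ (Z `^ d / 8 / (4 * C0))); last first.
    rewrite ler_pM2r ?invr_gt0 ?mulr_gt0 //.
    by apply: le_trans (powR_root8 q1 (ltW Zq0)); rewrite powRrM powRK ?powR_ge0 // gt_eqF.
  have hw : log2 n%:R `^ w <= C `^ `|w| * L.+1%:R `^ w by apply: powR_comparable.
  have hZd : c2 `^ d * L.+1%:R `^ w <= Z `^ d.
    have -> : w = (kap + 1) * d.
      rewrite /w /kap [RHS](_ : _ = - nu * d - lambda * d^-1 * d + d); last by ring.
      by rewrite divfK ?gt_eqF //; ring.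
    rewrite powRrM -powRM ?powR_ge0 ?(ltW c20) //.
    apply: ler_powR2l => //; first exact: ltW.
    by rewrite mulr_ge0 ?powR_ge0 ?(ltW c20).
  have Cw0 : 0 < C `^ `|w| by rewrite powR_gt0.
  have cd0 : 0 < c2 `^ d by rewrite powR_gt0.
  rewrite -/w [leRHS](_ : _ = (32 * C0)^-1 * Z `^ d); last by clear -C00; field; rewrite gt_eqF.
  rewrite invfM -mulrA ler_pM2l ?invr_gt0 ?mulr_gt0 //.
  apply: le_trans hZd; rewrite invf_div mulrAC ler_pdivrMr //.
  by rewrite -mulrA ler_pM2l // mulrC.
- by move=> v; rewrite ltW.
- exact: z0.
- by rewrite sz.
- by rewrite mulr_gt0.
- move=> v vh; rewrite (Wz _ vh) ler_pM2l // /z vh /zm ler_pM2r ?invr_gt0 //.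
  rewrite /sig sgd; move: vh; rewrite hhs => /andP[Lv _].
  apply: le_trans (hE L (cls v).+1).
  by rewrite big_nat_recr //= lerDr sumr_ge0 // => i _; rewrite ltW // gp_gt0.
- rewrite sumW mulrCA -[leRHS]mulr1 ler_pM2l // /zm mulrA ler_pdivrMr // mul1r.
  apply: le_trans hZ.
  have eg : L.+1%:R `^ (kap + 1) = L.+1%:R * (gp rho (- nu) L * gp (- rho) (- lambda * d^-1) L).
    rewrite gpM subrr gpE mul0r powRr0 mul1r (powRDr kap 1 L0) powRr1 // mulrC.
    by rewrite mulNr.
  have gr0 := gp_gt0 (- rho) (- lambda * d^-1) L.
  rewrite eg [leLHS](_ : _ = 8 * E * n%:R * gp (- rho) (- lambda * d^-1) L); last by ring.
  rewrite !mulrA ler_pM2r //.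
  apply: (@le_trans _ _ (c2 * gp rho (- nu) L)).
    by rewrite -ler_pdivrMl // mulrC mulrAC.
  rewrite ler_pM2r ?gp_gt0 // -[leLHS]mulr1 ler_pM2l //.
  by rewrite ler1n.
Qed.

Lemma pts_of_class C0 rho nu (V : choiceType) (cls : V -> nat) (M K i : nat) :
  class_sizes C0 rho nu cls -> (M * K <= 2 ^ i)%N ->
  exists pt : 'I_M -> 'I_K -> V, (forall g x, cls (pt g x) = i) /\
    (forall g x g' x', pt g x = pt g' x' -> g = g' /\ x = x').
Proof.
move=> hc MK; have [hs [us hhs hsz _]] := hc i.
have lt (g : 'I_M) (x : 'I_K) : (g * K + x < size hs)%N.
  apply: leq_trans hsz; apply: leq_trans MK.
  apply: (@leq_trans (g * K + K)); first by rewrite ltn_add2l.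
  by rewrite addnC -mulSn leq_mul2r ltn_ord orbT.
have [v0 _] : exists v : V, True.
  case: hs us hhs hsz lt => [|v s] _ _; last by exists v.
  by rewrite leqNgt expn_gt0.
exists (fun g x => nth v0 hs (g * K + x)); split => [g x|g x g' x' /eqP].
  by apply/eqP; rewrite -hhs mem_nth.
rewrite nth_uniq // => /eqP e.
have K0 : (0 < K)%N by apply: leq_ltn_trans (ltn_ord x).
have ea : nat_of_ord x = x'.
  by have := congr1 (modn^~ K) e; rewrite /= !modnMDl !modn_small.
split; apply: val_inj => //=.
by move/eqP: e; rewrite ea eqn_add2r eqn_mul2r -[(K == 0)%N]negbK -lt0n K0 /= => /eqP.
Qed.

(** About [n / log n] groups of about [n] coordinates each; a class of the order
    of [log n] has room for them. *)
Lemma lower_lt_critical_large (p : \bar R) (q : R) C0 rho nu lambda :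
  (1 < p)%E -> 1 <= q -> 0 < C0 ->
  lower_law p q C0 rho nu 0 lambda (fun n =>
    n%:R `^ (q^-1 - recip p) * log2 n%:R `^ (- lambda + recip p - q^-1)).
Proof.
move=> p1 q1 C00; set d := q^-1 - recip p.
pose E := 9 `^ `|d| * 4 `^ `|- lambda| : R.
have E0 : 0 < E by rewrite mulr_gt0 // powR_gt0.
exists (8 * C0 * E), 16%N; split; first by rewrite !mulr_gt0.
move=> V cls S hc hS n n16.
have n0 : (0 < n)%N by rewrite (leq_trans _ n16).
have nR : 0 < n%:R :> R by rewrite ltr0n.
pose k := trunc_log 2 n.
have /andP[kn nk] := @trunc_log_bounds 2 n isT n0.
rewrite -/k in kn nk.
have k4 : (4 <= k)%N by rewrite /k; apply: (@trunc_log_max 2 n 4).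
have k0 : (0 < k)%N by rewrite (leq_trans _ k4).
pose M := ((4 * n) %/ k).+1.
have kM : (4 * n <= k * M)%N.
  by rewrite [(k * M)%N]mulnC ltnW // ltn_ceil.
have Mn : (M <= n.+1)%N.
  rewrite ltnS; apply: (@leq_trans ((4 * n) %/ 4)); last by rewrite mulKn.
  exact: leq_div2l.
have MK : (M * 2 ^ k <= 2 ^ (k.+1 + k))%N.
  by rewrite expnD leq_mul2r (leq_trans Mn) // orbT.
have [pt [hcls pt_inj]] := pts_of_class hc MK.
set l := log2 n%:R.
have kl : k%:R <= l by apply: pow2_le_log => //; rewrite powR2n ler_nat.
have lk : l <= k.+1%:R by apply: log2_le_pow => //; rewrite powR2n ler_nat ltnW.
have kR : 4 <= k%:R :> R by rewrite ler_nat.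
have l0 : 0 < l by apply: lt_le_trans kl; rewrite ltr0n.
have lk' : l <= 2 * k%:R by apply: (le_trans lk); rewrite -natr1; clear -kR; lra.
pose s := gp (- 0) (- lambda) (k.+1 + k) : R.
have s0 : 0 < s by exact: gp_gt0.
have M0 : (0 < M)%N by [].
have MR : 0 < M%:R :> R by rewrite ltr0n.
have := @entropy_lower_choices R V p q C0 s _ S M k n pt p1 q1 hS pt_inj s0 _ M0 n0 k4 kM.
move=> h; apply: le_trans (h _); last by move=> g a; rewrite hcls.
rewrite lee_fin.
have hl : l `^ (- lambda) <= 4 `^ `|- lambda| * s.
  rewrite /s oppr0 gpE mul0r powRr0 mul1r; apply: powR_comparable => //.
    apply: (le_trans lk); apply: (@le_trans _ _ ((k.+1 + k).+1%:R)); first by rewrite ler_nat ltnS ltnW // ltnS leq_addr.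
    by rewrite -[leLHS]mul1r ler_pM2r // ler1n.
  apply: (@le_trans _ _ (4 * k%:R)); last by rewrite ler_pM2l.
  by rewrite -natrM ler_nat; clear -k4; lia.
have nl0 : 0 < n%:R / l by rewrite divr_gt0.
have hM : (n%:R / l) `^ d <= 9 `^ `|d| * M%:R `^ d.
  apply: powR_comparable => //.
    rewrite ler_pdivrMr //; apply: (@le_trans _ _ (4 * n%:R)).
      by rewrite -[leLHS]mul1r ler_pM2r // ler1n.
    apply: (@le_trans _ _ (k * M)%:R); first by rewrite -natrM ler_nat.
    rewrite natrM mulrC -mulrA -[leLHS]mul1r; apply: ler_pM; rewrite ?ler1n ?mulr_ge0 //.
    by rewrite ler_pM2l.
  have m1 : (4 * n)%:R / k%:R <= 8 * (n%:R / l).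
    rewrite ler_pdivrMr ?ltr0n // natrM [leRHS](_ : _ = 4 * n%:R * (2 * k%:R / l)); last first.
      by clear; ring.
    by rewrite ler_pMr ?mulr_gt0 // ler_pdivlMr // mul1r.
  have m2 : 1 <= n%:R / l.
    rewrite ler_pdivlMr // mul1r (le_trans lk) // ler_nat.
    by apply: leq_trans kn; rewrite ltn_expl.
  apply: (@le_trans _ _ ((4 * n)%:R / k%:R + 1)); last by clear -m1 m2; lra.
  rewrite -natr1 lerD2r ler_pdivlMr ?ltr0n // -natrM ler_nat.
  exact: leq_trunc_div.
have -> : - lambda + recip p - q^-1 = - d + - lambda by rewrite /d; ring.
rewrite (powRDr (- d) (- lambda) l0) mulrA [l `^ (- d)]powRN -(powR_div _ (ltW nR) (ltW l0)).
rewrite [leRHS](_ : _ = (8 * C0)^-1 * (M%:R `^ d * s)); last by ring.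
rewrite [(8 * C0 * E)^-1]invfM -[leLHS]mulrA.
rewrite ler_pM2l ?invr_gt0 ?mulr_gt0 // ler_pdivrMl // /E.
by rewrite mulrACA; apply: ler_pM; rewrite ?powR_ge0.
Qed.

(** A single group of [2^(4 n)] coordinates, which fits into class [4 n]. *)
Lemma lower_lt_critical_small (p : \bar R) (q : R) C0 rho nu lambda :
  (1 < p)%E -> 1 <= q -> 0 < C0 ->
  lower_law p q C0 rho nu 0 lambda (fun n => n%:R `^ (- lambda)).
Proof.
move=> p1 q1 C00.
pose E := 5 `^ `|- lambda| : R.
have E0 : 0 < E by rewrite powR_gt0.
exists (8 * C0 * E), 1%N; split; first by rewrite !mulr_gt0.
move=> V cls S hc hS n n0.
have nR : 0 < n%:R :> R by rewrite ltr0n.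
have MK : (1 * 2 ^ (4 * n) <= 2 ^ (4 * n))%N by rewrite mul1n.
have [pt [hcls pt_inj]] := pts_of_class hc MK.
pose s := gp (- 0) (- lambda) (4 * n) : R.
have s0 : 0 < s by exact: gp_gt0.
have k4 : (4 <= 4 * n)%N by rewrite leq_pmulr.
have kM : (4 * n <= 4 * n * 1)%N by rewrite muln1.
have := @entropy_lower_choices R V p q C0 s _ S 1 (4 * n) n pt p1 q1 hS pt_inj s0 _ isT n0 k4 kM.
move=> h; apply: le_trans (h _); last by move=> g a; rewrite hcls.
rewrite lee_fin powR1 mulr1.
have hl : n%:R `^ (- lambda) <= E * s.
  rewrite /s oppr0 gpE mul0r powRr0 mul1r; apply: powR_comparable => //.
    by rewrite -natrM ler_nat; clear -n0; lia.
  by rewrite -natrM ler_nat; clear -n0; lia.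
rewrite invfM -mulrA [leRHS]mulrC ler_pM2l ?invr_gt0 ?mulr_gt0 //.
by rewrite ler_pdivrMl.
Qed.

End LowerLaws.

(** * Level sequences in terms of dyadic classes *)

Section LevelSequences.
Variable R : realType.
Implicit Types (a b x C gamma nu : R) (f g : nat -> R) (i j k l : nat).

Definition mutual C f g := forall j, f j <= C * g j /\ g j <= C * f j.

(** Grouping levels dyadically turns polynomial dependence on the level into
    exponential dependence on the class, so that sums over classes are
    geometric. *)
Definition dyadic_class (j : nat) : nat := trunc_log 2 j.+1.

Lemma dyadic_classP j : (2 ^ dyadic_class j <= j.+1 < 2 ^ (dyadic_class j).+1)%N.
Proof. exact: trunc_log_bounds. Qed.

(** All sequences attached to the levels have the form [x^a (log x)^b] with [x]
    comparable to the level; [k] measures the comparison. *)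
Lemma power_log_class k a b : exists2 C : R, 0 < C & forall i x, 1 <= x ->
  2 ^+ i <= 2 ^+ k * x -> x <= 2 ^+ k * 2 ^+ i ->
  x `^ a * log_power b x <= C * gp a b i /\ gp a b i <= C * (x `^ a * log_power b x).
Proof.
pose D := (2 ^+ k : R) `^ `|a| * (k.+2%:R : R) `^ `|b|.
have D0 : 0 < D by rewrite mulr_gt0 // powR_gt0 ?exprn_gt0.
exists D => // i x x1 ix xi.
have x0 : 0 < x by apply: lt_le_trans x1.
have ei : gp a b i = (2 ^+ i) `^ a * i.+1%:R `^ b :> R.
  by rewrite gpE [a * _]mulrC powRrM powR_mulrn.
pose y := log2 (x + 2).
have y1 : 1 <= y.
  by apply: log2_ge1; clear -x1; lra.
have yi : i%:R <= y + k%:R.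
  rewrite -lerBlDr; apply: pow2_le_log; first by clear -x0; lra.
  rewrite (powRDr _ _ (ltr0n _ 2)) powRN !powR_mulrn // ler_pdivrMr ?exprn_gt0 // mulrC.
  by apply: (le_trans ix); rewrite ler_pM2l ?exprn_gt0 // lerDl.
have iy : y <= i%:R + k%:R + 2.
  apply: log2_le_pow; first by clear -x0; lra.
  rewrite (powRDr _ 2 (ltr0n _ 2)) (powRDr i%:R k%:R (ltr0n _ 2)) !powR_mulrn // [2 ^+ i * _]mulrC.
  by clear -x1 xi; lra.
have [h1 h2] : (x `^ a <= (2 ^+ k) `^ `|a| * (2 ^+ i) `^ a) /\ ((2 ^+ i) `^ a <= (2 ^+ k) `^ `|a| * x `^ a).
  by split; apply: powR_comparable; rewrite ?exprn_gt0.
have [h3 h4] : (y `^ b <= k.+2%:R `^ `|b| * i.+1%:R `^ b) /\ (i.+1%:R `^ b <= k.+2%:R `^ `|b| * y `^ b).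
  have e1 : i.+1%:R <= k.+2%:R * y.
    have [ik|ki] := leqP i k.+1.
      by apply: le_trans (_ : k.+2%:R <= _); rewrite ?ler_nat // ler_peMr.
    apply: (@le_trans _ _ (k.+2%:R * (i - k)%:R)).
      by rewrite -natrM ler_nat; clear -ki; nia.
    by rewrite ler_pM2l // natrB ?lerBlDr // ltnW // ltnW.
  have e2 : y <= k.+2%:R * i.+1%:R.
    apply: (le_trans iy); rewrite -2!natrD -natrM ler_nat; clear; nia.
  by split; apply: powR_comparable => //; apply: lt_le_trans y1.
have ly : log_power b x = y `^ b by rewrite /log_power -/y ger0_norm // (le_trans _ y1).
rewrite ei ly /D; split.
  by rewrite mulrACA; apply: ler_pM; rewrite ?powR_ge0.
by rewrite mulrACA; apply: ler_pM; rewrite ?powR_ge0.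
Qed.

Lemma weight_class m a b : (0 < m)%N -> exists2 C : R, 0 < C &
  mutual C (fun j => (m * j + 1)%:R `^ a * log_power b (m * j + 1)%:R)
           (fun j => gp a b (dyadic_class j)).
Proof.
move=> m0; have [C C0 hC] := power_log_class m.+1 a b.
exists C => // j; have /andP[j1 j2] := dyadic_classP j.
have mm : (m < 2 ^ m)%N by exact: ltn_expl.
apply: hC; rewrite -?natrX -?natrM ?ler_nat ?ler1n ?addn1 //.
  apply: (leq_trans j1); apply: (@leq_trans (m * j).+1); first by rewrite ltnS leq_pmull.
  by rewrite leq_pmull // expn_gt0.
apply: (@leq_trans (m * j.+1)); first by rewrite mulnS -add1n leq_add2r.
rewrite expnSr -mulnA -expnS; apply: leq_mul (ltnW mm) (ltnW j2).
Qed.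

(** A finite number of indices only affects the constant. *)
Lemma mutual_eventually C j0 f g : 0 < C -> (forall j, 0 < f j) -> (forall j, 0 < g j) ->
  (forall j, (j0 <= j)%N -> f j <= C * g j /\ g j <= C * f j) ->
  exists2 C' : R, 0 < C' & mutual C' f g.
Proof.
move=> C0 f0 g0 h.
pose E j := f j / g j + g j / f j.
have E0 j : 0 <= E j by rewrite addr_ge0 // divr_ge0 // ltW.
exists (C + \sum_(j < j0) E j); first by rewrite ltr_wpDr // sumr_ge0.
move=> j; have S0 : 0 <= \sum_(j < j0) E j by rewrite sumr_ge0.
have [/h[h1 h2]|jj] := leqP j0 j.
  split; [apply: (le_trans h1)|apply: (le_trans h2)];
    by rewrite ler_pM2r // lerDl.
have hE : E j <= C + \sum_(j < j0) E j.
  rewrite (bigD1 (Ordinal jj)) //= addrA [C + _]addrC -addrA lerDl.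
  by rewrite addr_ge0 ?(ltW C0) // sumr_ge0.
split; rewrite -ler_pdivrMr //; apply: le_trans hE; rewrite /E ?lerDl ?lerDr divr_ge0 ?(ltW (f0 j)) ?(ltW (g0 j)) //.
Qed.

(** The values of [h] at the scales of the levels: their quotients are, up
    to the factor [c], the numbers of descendants. *)
Definition profile (h : R -> R) m j := h (2 `^ (- (m * j)%:R)).

Lemma level_in_domain m j : 0 < (2 : R) `^ (- (m * j)%:R) <= 1.
Proof.
rewrite powR_gt0 //= powRN powR_mulrn // invf_le1 ?exprn_gt0 //.
by rewrite -natrX ler1n expn_gt0.
Qed.

Lemma profile_class gamma nu h m : (0 < m)%N ->
  admissible_h 0 gamma (log_power nu) h -> exists2 C : R, 0 < C &
  mutual C (profile h m) (fun j => gp gamma nu (dyadic_class j)).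
Proof.
move=> m0 [hpos _ [/= eps eps0 hnear]].
have [C C0 hC] := power_log_class m.+1 gamma nu.
have [j0 hj0] : exists j0, forall j, (j0 <= j)%N -> 2 `^ (- (m * j)%:R) < eps.
  exists (Num.truncn (- log2 eps)).+1 => j jj.
  rewrite ltNge; apply/negP => /(log2_le_pow eps0); apply/negP; rewrite -ltNge ltrNl.
  apply: (lt_le_trans (truncnS_gt _)); rewrite ler_nat (leq_trans jj) //.
  by rewrite leq_pmull.
apply: (@mutual_eventually C j0.+1) => // [j|j|j jj].
- by apply: hpos; exact: level_in_domain.
- exact: gp_gt0.
have mj : (0 < m * j)%N by rewrite muln_gt0 m0; case: (j) jj.
rewrite /profile hnear /=; last 2 first.
- by rewrite sub0r normrN gtr0_norm ?powR_gt0 // hj0 // ltnW.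
- by rewrite powR_gt0.
rewrite powRr0 mul1r log2_pow2 normrN normr_nat.
have /andP[j1 j2] := dyadic_classP j.
have mm : (m < 2 ^ m)%N by exact: ltn_expl.
apply: hC; rewrite -?natrX -?natrM ?ler_nat ?ler1n //.
  apply: (leq_trans j1); apply: (@leq_trans (2 * (m * j))); last by rewrite leq_mul2r expnS leq_pmulr ?expn_gt0 ?orbT.
  by rewrite mul2n -addnn -addn1 leq_add // leq_pmull.
apply: (@leq_trans (m * j.+1)); first by rewrite leq_mul2l leqnSn orbT.
by rewrite expnSr -mulnA -expnS; apply: leq_mul (ltnW mm) (ltnW j2).
Qed.

(** Near zero [h] is comparable to a power of the logarithm, while monotonicity
    bounds it by [h 1]. *)
Lemma admissible_h_gamma gamma nu h :
  admissible_h 0 gamma (log_power nu) h -> gamma <= 0.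
Proof.
move=> hh; have [C C0 hC] := profile_class (isT : (0 < 1)%N) hh.
have [hpos hmon _] := hh.
rewrite leNgt; apply/negP => g0.
have H0 : 0 < profile h 1 0 by apply: hpos; exact: level_in_domain.
have e0 : 0 < (2 * C * profile h 1 0)^-1 by rewrite invr_gt0 !mulr_gt0.
have Ng : - gamma < 0 by rewrite oppr_lt0.
have [K hK] := gp_vanish (- nu) Ng e0.
pose j := (2 ^ K).-1.
have jK : dyadic_class j = K by rewrite /dyadic_class prednK ?expn_gt0 // trunc_expnK.
have [_] := hC j; rewrite jK => h1.
have h2 : profile h 1 j <= profile h 1 0.
  have /andP[a1 a2] := level_in_domain 1 j.
  rewrite /profile muln0 oppr0 powRr0.
  by apply: hmon.
have h3 : gp gamma nu K <= C * profile h 1 0 by apply: (le_trans h1); rewrite ler_pM2l.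
have := hK K (leqnn K); rewrite -gpV lef_pV2 ?posrE ?gp_gt0 ?mulr_gt0 // => h4.
by have := le_trans h4 h3; rewrite -mulrA ger_pMl ?mulr_gt0 // leNgt ltr1n.
Qed.

(** Adding [l] to a level multiplies its successor by at most [l + 1], hence
    raises its class by at most [log2 (l + 1) + 1]. *)
Lemma class_shift a b : exists C B : R, 0 < C /\ forall j l,
  gp a b (dyadic_class (j + l)) <= C * l.+1%:R `^ B * gp a b (dyadic_class j).
Proof.
exists (2 `^ `|a| * 2 `^ `|b|), (`|a| + `|b|); split; first by rewrite mulr_gt0 ?powR_gt0.
move=> j l.
have /andP[j1 j2] := dyadic_classP j.
have /andP[k1 k2] := dyadic_classP (j + l).
set i := dyadic_class j in j1 j2 *; set i' := dyadic_class (j + l) in k1 k2 *.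
have ii : (i <= i')%N by rewrite leq_trunc_log // ltnS leq_addr.
have h : (2 ^ (i' - i) <= 2 * l.+1)%N.
  rewrite -(@leq_pmul2r (2 ^ i)) ?expn_gt0 // -expnD subnK //.
  apply: (leq_trans k1); rewrite mulnAC -expnS.
  have : (2 ^ i <= j.+1)%N := j1.
  clear -j2; nia.
have e (z : R) k : gp z b k = (2 ^+ k) `^ z * k.+1%:R `^ b :> R.
  by rewrite gpE [z * _]mulrC powRrM powR_mulrn.
rewrite !e (powRDr _ _ (ltr0Sn R l)) [2 `^ `|a| * _ * (l.+1%:R `^ _ * _)]mulrACA -(powRM _ (ler0n R 2) (ler0n R l.+1)) -(powRM _ (ler0n R 2) (ler0n R l.+1)).
rewrite mulrACA -[2 * l.+1%:R]natrM.
apply: ler_pM; rewrite ?powR_ge0 //.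
  apply: powR_comparable; rewrite ?exprn_gt0 // -!natrX -!natrM ler_nat.
    rewrite -(subnK ii) expnD; apply: leq_mul => //.
  by apply: (@leq_trans (2 ^ i')); [rewrite leq_exp2l|rewrite leq_pmull].
have ik : (i' - i < 2 * l.+1)%N by apply: leq_trans h; exact: ltn_expl.
apply: powR_comparable; rewrite // -!natrM ler_nat; clear -ii ik; nia.
Qed.

End LevelSequences.

(** * Branches and levels of a tree *)

Section Branches.
Variables (V : choiceType) (e : rel V) (root : V).
Hypothesis tree : is_tree e.
Implicit Types (x y z : V) (s : seq V).

(** The simple path to [x] without its first vertex. Existence is part of the
    hypothesis, so the default value never occurs. *)
Definition tree_path x : seq V := xget [::] [set s | simple_path e root x s].

Definition branch x : seq V := root :: tree_path x.

Definition level x := size (tree_path x).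

Definition parent x := last root (belast root (tree_path x)).

Lemma simple_path_unique x y s s' : simple_path e x y s -> simple_path e x y s' -> s = s'.
Proof. by case: tree => _ _ /(_ x y)[t [_ h]] /h <- /h <-. Qed.

Lemma tree_pathP x : simple_path e root x (tree_path x).
Proof. by apply: (@xgetPex _ [::] [set s | simple_path e root x s]); case: tree => _ _ /(_ root x)[t [h _]]; exists t. Qed.

Lemma tree_path_eq x s : simple_path e root x s -> s = tree_path x.
Proof. by move=> h; apply: simple_path_unique h (tree_pathP x). Qed.

Lemma branch_uniq x : uniq (branch x).
Proof. by case: (tree_pathP x). Qed.

Lemma tree_leE x y : tree_le e root x y <-> x \in branch y.
Proof.
split => [[s /tree_path_eq ->] //|h].
by exists (tree_path y) => //; exact: tree_pathP.
Qed.

Lemma tree_path_root : tree_path root = [::].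
Proof. by apply/esym/tree_path_eq; split. Qed.

Lemma level0 x : level x = 0%N -> x = root.
Proof. by case: (tree_pathP x) => _; rewrite /level; case: (tree_path x) => //= ->. Qed.

(** Both pieces of a simple path are simple, so uniqueness identifies them. *)
Lemma branch_split x y : y \in branch x ->
  exists2 s, tree_path x = tree_path y ++ s & simple_path e y x s.
Proof.
move=> yx; have [] := tree_pathP x.
case/splitPl: {2 3 4}(tree_path x) / yx (erefl (tree_path x)) => [p1 p2 ly] ex.
rewrite ex cat_path last_cat ly -cat_cons cat_uniq => /andP[h1 h2] h3 /and3P[h4 h5 h6].
have e1 : p1 = tree_path y by apply: tree_path_eq; split.
exists p2; first by rewrite -e1.
split => //=; rewrite h6 andbT; apply: contra h5 => yp2.
by apply/hasP; exists y => //; rewrite -ly mem_last.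
Qed.

(** Loops can be removed from any path, and what remains is the unique simple
    path. *)
Lemma dist_simple_path x y s l : simple_path e x y s -> graph_dist e x y l <-> size s = l.
Proof.
move=> hs.
have h t : path e x t -> last x t = y -> (size s <= size t)%N.
  move=> pt lt; case/shortenP: pt (lt) => t' pt' ut' st' lt'.
  rewrite (simple_path_unique hs (And3 pt' lt' ut')).
  by apply: uniq_leq_size => //; case/andP: ut'.
have [ps ls us] := hs; split => [[[t [pt lt <-]] ht]|<-].
  by apply/eqP; rewrite eqn_leq h // ht.
by split => //; exists s.
Qed.

Lemma descendantsP l y x :
  descendants e root l y x <-> y \in branch x /\ level x = (level y + l)%N.
Proof.
rewrite /descendants /= tree_leE.
split => -[yx hd]; split => //; have [s ex hs] := branch_split yx.
  by rewrite /level ex size_cat; congr addn; apply/(dist_simple_path _ hs).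
apply/(dist_simple_path _ hs)/(@addnI (level y)).
by rewrite -hd /level ex size_cat.
Qed.

Lemma root_branch x : root \in branch x.
Proof. exact: mem_head. Qed.

Lemma tree_path_rcons x : (0 < level x)%N ->
  tree_path x = rcons (tree_path (parent x)) x.
Proof.
rewrite /parent /level; have [] := tree_pathP x.
case/lastP: (tree_path x) => // s z.
rewrite rcons_path last_rcons belast_rcons -rcons_cons rcons_uniq => /andP[ps _] -> /andP[_ us] _.
by rewrite -(@tree_path_eq (last root s) s).
Qed.

Lemma level_parent x : (0 < level x)%N -> level x = (level (parent x)).+1.
Proof. by move=> /tree_path_rcons; rewrite {1}/level => ->; rewrite size_rcons. Qed.

Lemma branch_parent x : (0 < level x)%N -> branch x = rcons (branch (parent x)) x.
Proof. by move=> /tree_path_rcons; rewrite /branch => ->. Qed.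

Lemma parent_child x : (0 < level x)%N -> descendants e root 1 (parent x) x.
Proof.
move=> x0; apply/descendantsP; rewrite addn1 -level_parent //; split => //.
have [_ lp _] := tree_pathP (parent x).
by rewrite branch_parent // mem_rcons inE orbC -[X in X \in _]lp mem_last.
Qed.

Lemma level_branch x y : y \in branch x -> (level y <= level x)%N.
Proof. by move=> /branch_split[s ex _]; rewrite /level ex size_cat leq_addr. Qed.

(** A branch meets each level up to its own exactly once, so summing along it
    amounts to summing over levels. *)
Lemma sum_branch (R : realType) (F : nat -> R) x :
  \sum_(y <- branch x) F (level y) = \sum_(i < (level x).+1) F i.
Proof.
have [n] := ubnP (level x); elim: n x => // n IH x xn.
have [/level0 ->|x0] := posnP (level x).
  by rewrite /branch tree_path_root big_seq1 /level tree_path_root big_ord_recr big_ord0 /= add0r.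
have lx := level_parent x0.
have lp : (level (parent x) < n)%N by rewrite lx in xn.
by rewrite (branch_parent x0) big_rcons /= (IH _ lp) lx [RHS]big_ord_recr /= addrC -lx.
Qed.

End Branches.

(** * The summation operator behaves like a diagonal operator *)

Section Summation.
Variable R : realType.
Implicit Types (q B C D K : R) (l : nat).

(** Each [z y] is at most the [l_q]-norm of [z]. Bounding the sum so crudely is
    affordable because the decay of the coefficients can be split between [a] and
    [z]. *)
Lemma sum_powR_le (T : eqType) (s : seq T) (a z : T -> R) q : 0 < q ->
  (forall y, 0 <= a y) -> (forall y, 0 <= z y) ->
  (\sum_(y <- s) a y * z y) `^ q <= (\sum_(y <- s) a y) `^ q * \sum_(y <- s) z y `^ q.
Proof.
move=> q0 a0 z0; pose M := \sum_(y <- s) z y `^ q.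
have M0 : 0 <= M by apply: sumr_ge0 => y _; exact: powR_ge0.
have A0 : 0 <= \sum_(y <- s) a y by apply: sumr_ge0.
have : \sum_(y <- s) a y * z y <= (\sum_(y <- s) a y) * M `^ q^-1.
  rewrite mulr_suml big_seq [leRHS]big_seq; apply: ler_sum => y ys.
  apply: ler_wpM2l => //; apply: (powR_le_inv q0) => //; first exact: powR_ge0.
  rewrite powRVK ?gt_eqF // /M (big_rem y ys) /= lerDl.
  by apply: sumr_ge0 => i _; exact: powR_ge0.
move=> h; apply: (@le_trans _ _ (((\sum_(y <- s) a y) * M `^ q^-1) `^ q)).
  by apply: ler_powR2l => //; [exact: ltW|apply: sumr_ge0 => y _; exact: mulr_ge0].
by rewrite powRM ?powR_ge0 // powRVK ?gt_eqF.
Qed.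

(** Fubini: if each [y] is charged at most [K] in total by the points of [t],
    the charges can be paid by the points themselves. *)
Lemma sum_charge (V : choiceType) (A : V -> seq V) (k : V -> V -> R) (Phi : V -> R) (t : seq V) K :
  (forall x, uniq (A x)) -> (forall y, 0 <= Phi y) ->
  (forall y, \sum_(x <- t | y \in A x) k x y <= K) ->
  exists2 s : seq V, uniq s &
    \sum_(x <- t) \sum_(y <- A x) k x y * Phi y <= K * \sum_(y <- s) Phi y.
Proof.
move=> uA P0 hK; pose s := undup (flatten (map A t)).
exists s; first exact: undup_uniq.
have -> : \sum_(x <- t) \sum_(y <- A x) k x y * Phi y =
    \sum_(x <- t) \sum_(y <- s) (if y \in A x then k x y * Phi y else 0).
  rewrite big_seq [RHS]big_seq; apply: eq_bigr => x xt.
  rewrite -big_mkcond -big_filter; apply: perm_big; apply: uniq_perm => //.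
    by rewrite filter_uniq // undup_uniq.
  move=> y; rewrite mem_filter mem_undup; case: (boolP (y \in A x)) => //= yA.
  by apply/esym/flattenP; exists (A x) => //; exact: map_f.
rewrite exchange_big /= mulr_sumr; apply: ler_sum => y _.
by rewrite -big_mkcond /= -mulr_suml ler_wpM2r.
Qed.

Lemma sum_by_distance (T : eqType) (d : T -> nat) (k : nat -> R) (t : seq T) :
  exists M, \sum_(x <- t) k (d x) = \sum_(l < M) k l * (size [seq x <- t | d x == l])%:R.
Proof.
exists (\max_(x <- t) d x).+1.
have hM x : x \in t -> (d x < (\max_(x <- t) d x).+1)%N by move=> xt; rewrite ltnS leq_bigmax_seq.
move: _.+1 hM => M hM.
transitivity (\sum_(x <- t) \sum_(l < M) if d x == l then k l else 0).
  rewrite big_seq [RHS]big_seq; apply: eq_bigr => x xt.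
  rewrite (bigD1 (Ordinal (hM _ xt))) //= eqxx big1 ?addr0 // => l.
  by rewrite -val_eqE /= eq_sym => /negPf ->.
rewrite exchange_big /=; apply: eq_bigr => l _.
rewrite -big_mkcond -big_filter big_const_seq count_predT iter_addr addr0.
by rewrite mulr_natr.
Qed.

Variables (V : countType) (e : rel V) (root : V) (u w : V -> R).
Hypothesis tree : is_tree e.

Let S := summation_operator e root u w.

Lemma summation_operatorE f x :
  S f x = w x * \sum_(y <- branch e root x) u y * f y.
Proof.
rewrite /S /summation_operator (fsbig_seq _ _ (branch_uniq root tree x)); congr (_ * _).
suff -> : [set y | tree_le e root y x] = [set` branch e root x] by [].
by apply/seteqP; split => y /=; rewrite tree_leE.
Qed.

Lemma summation_operatorB f g : S (f - g) = S f - S g.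
Proof.
apply/funext => x; rewrite -[RHS]/(S f x - S g x) !summation_operatorE -mulrBr -sumrB.
by congr (_ * _); apply: eq_bigr => y _; rewrite -mulrBr.
Qed.

Hypotheses (u0 : forall x, 0 < u x) (w0 : forall x, 0 < w x).

(** The difference of [S f / w] along the edge from the parent of [x] to [x]. *)
Lemma summation_step f x : (0 < level e root x)%N ->
  u x * w x * f x = S f x - w x / w (parent e root x) * S f (parent e root x).
Proof.
move=> x0; rewrite !summation_operatorE (branch_parent tree x0) big_rcons /=.
by field; rewrite gt_eqF.
Qed.

Lemma summation_root f : u root * w root * f root = S f root.
Proof. by rewrite summation_operatorE /branch (tree_path_root root tree) big_seq1 mulrCA mulrA. Qed.

Let lev := level e root.

(** The terms of [S f x] decay like [r] in the distance. One half of the decay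
    makes the sum over the branch converge, the other half pays for the
    descendants of every [y] when the sums over [x] and [y] are exchanged. *)
Lemma summation_bound q D (r : nat -> R) A K f B :
  0 < q -> 0 <= D -> 0 <= B -> (forall l, 0 < r l) ->
  (forall x y, y \in branch e root x -> w x <= D * r (lev x - lev y)%N * w y) ->
  (forall n, \sum_(l < n) r l `^ 2^-1 <= A) ->
  (forall y t, uniq t -> \sum_(x <- t | y \in branch e root x) r (lev x - lev y)%N `^ (q / 2) <= K) ->
  lr_bound q (u \* w \* f) B -> lr_bound q (S f) (D * A * K `^ q^-1 * B).
Proof.
move=> q0 D0 B0 rgt0 hw hr hk hf t ut.
have r0 l : 0 <= r l by exact: ltW.
have A0 : 0 <= A by have := hr 0%N; rewrite big_ord0.
have K0 : 0 <= K by have := hk root [::] isT; rewrite big_nil.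
pose g y : R := `|u y * w y * f y|.
have g0 y : 0 <= g y by exact: normr_ge0.
have step x : `|S f x| `^ q <= (D * A) `^ q *
    \sum_(y <- branch e root x) r (lev x - lev y)%N `^ (q / 2) * g y `^ q.
  have h1 : `|S f x| <= D * \sum_(y <- branch e root x)
      r (lev x - lev y)%N `^ 2^-1 * (r (lev x - lev y)%N `^ 2^-1 * g y).
    rewrite summation_operatorE normrM (gtr0_norm (w0 x)) mulr_sumr.
    apply: (@le_trans _ _ (w x * \sum_(y <- branch e root x) `|u y * f y|)).
      by rewrite ler_pM2l // ler_norm_sum.
    rewrite mulr_sumr big_seq [leRHS]big_seq; apply: ler_sum => y yx.
    rewrite [r _ `^ _ * (_ * _)]mulrA -(powRDr _ _ (rgt0 _)).
    rewrite (_ : 2^-1 + 2^-1 = 1); last by rewrite [RHS]splitr !mul1r.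
    rewrite powRr1 // /g -mulrA !normrM (gtr0_norm (u0 y)) (gtr0_norm (w0 y)).
    rewrite [leRHS](_ : _ = (D * r (lev x - lev y)%N * w y) * (u y * `|f y|)); last by ring.
    by apply: ler_wpM2r; [rewrite mulr_ge0 // ltW|exact: hw].
  apply: (le_trans (ler_powR2l (ltW q0) (normr_ge0 _) h1)).
  rewrite !powRM // ?sumr_ge0 //; last by move=> y _; rewrite !mulr_ge0 ?powR_ge0 // /g.
  rewrite -mulrA; apply: ler_wpM2l; first exact: powR_ge0.
  have rg y : 0 <= r (lev x - lev y)%N `^ 2^-1 * g y by rewrite mulr_ge0 ?powR_ge0.
  apply: (le_trans (@sum_powR_le _ _ (fun y => r (lev x - lev y)%N `^ 2^-1) _ _ q0 (fun=> powR_ge0 _ _) rg)).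
  apply: ler_pM; rewrite ?powR_ge0 //; first by rewrite sumr_ge0 // => y _; exact: powR_ge0.
    apply: ler_powR2l; [exact: ltW|by apply: sumr_ge0 => y _; exact: powR_ge0|].
    rewrite (@sum_branch _ e root tree R (fun l => r (lev x - l)%N `^ 2^-1)).
    rewrite (reindex_inj rev_ord_inj) /=.
    apply: le_trans (hr (lev x).+1); apply: ler_sum => l _.
    by rewrite subSS subKn // -ltnS.
  by apply: ler_sum => y _; rewrite powRM ?powR_ge0 // -powRrM [2^-1 * q]mulrC.
have [s us hs] := @sum_charge V (branch e root) (fun x y => r (lev x - lev y)%N `^ (q / 2))
  (fun y => g y `^ q) t K (branch_uniq root tree) (fun y => powR_ge0 _ _) (fun y => hk y t ut).
apply: (@le_trans _ _ ((D * A) `^ q * (K * B `^ q))).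
  apply: (le_trans (ler_sum _ (fun x _ => step x))); rewrite -mulr_sumr.
  apply: ler_wpM2l; first exact: powR_ge0.
  by apply: (le_trans hs); apply: ler_wpM2l => //; exact: hf.
by rewrite !powRM ?mulr_ge0 ?powR_ge0 // powRVK ?gt_eqF // !mulrA.
Qed.

(** By [summation_step]; a value of [S f] is used once by its own vertex and once
    by each child. *)
Lemma summation_inverse q E K f B :
  0 < q -> 0 <= E -> 0 <= B ->
  (forall x, (0 < lev x)%N -> w x <= E * w (parent e root x)) ->
  (forall y t, uniq t ->
    (forall x, x \in t -> (0 < lev x)%N /\ parent e root x = y) -> (size t)%:R <= K) ->
  lr_bound q (S f) B -> lr_bound q (u \* w \* f) (2 * (1 + E `^ q * K) `^ q^-1 * B).
Proof.
move=> q0 E0 B0 hw hc hf t ut.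
have K0 : 0 <= K by have := hc root [::] isT; apply.
pose par x := if (0 < lev x)%N then [:: parent e root x] else [::].
have step x : `|u x * w x * f x| `^ q <=
    2 `^ q * (`|S f x| `^ q + E `^ q * \sum_(y <- par x) 1 * `|S f y| `^ q).
  rewrite /par; case: ifP => x0; last first.
    rewrite big_nil mulr0 addr0.
    have -> : x = root by apply: (@level0 _ e root tree); apply/eqP; rewrite -leqn0 leqNgt x0.
    rewrite summation_root ler_peMl ?powR_ge0 //.
    by rewrite -[leLHS](powRr0 2) ler_powR ?ler1n // ltW.
  rewrite big_seq1 mul1r summation_step //.
  apply: (le_trans (powR_normB _ _ (ltW q0))).
  apply: ler_wpM2l; first exact: powR_ge0.
  rewrite lerD2l normrM powRM //; apply: ler_wpM2r; first exact: powR_ge0.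
  apply: ler_powR2l; rewrite ?(ltW q0) //.
  by rewrite ger0_norm ?divr_ge0 ?(ltW (w0 _)) // ler_pdivrMr // hw.
have hK y : \sum_(x <- t | y \in par x) 1 <= K.
  rewrite -big_filter big_const_seq count_predT iter_addr addr0 /=.
  apply: (hc y); first exact: filter_uniq.
  move=> x; rewrite mem_filter /par => /andP[+ _].
  by case: ifP => // x0; rewrite inE => /eqP ->.
have up x : uniq (par x) by rewrite /par; case: ifP.
have [s us hs] := @sum_charge V par (fun _ _ => 1) (fun y => `|S f y| `^ q) t K up (fun y => powR_ge0 _ _) hK.
apply: (@le_trans _ _ (2 `^ q * (B `^ q + E `^ q * (K * B `^ q)))).
  apply: (le_trans (ler_sum _ (fun x _ => step x))); rewrite -mulr_sumr.
  apply: ler_wpM2l; first exact: powR_ge0.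
  rewrite big_split /= -mulr_sumr; apply: lerD; first exact: hf.
  apply: ler_wpM2l; first exact: powR_ge0.
  by apply: (le_trans hs); apply: ler_wpM2l => //; exact: hf.
have P0 : 0 <= 1 + E `^ q * K by rewrite addr_ge0 // mulr_ge0 // powR_ge0.
rewrite !powRM ?mulr_ge0 ?powR_ge0 // powRVK ?gt_eqF //.
by rewrite [leRHS](_ : _ = 2 `^ q * (B `^ q + E `^ q * (K * B `^ q))) //; ring.
Qed.

End Summation.

(** The decay of [w] beats the growth of the number of descendants, since the
    former is exponential and the latter polynomial in the distance. *)
Lemma summation_like_diagonal (R : realType) (q D kappa B0 N B1 : R) :
  0 < q -> 0 < D -> 0 < kappa -> 0 < N -> exists2 C : R, 0 < C &
  forall (V : countType) (e : rel V) (root : V) (u w : V -> R), is_tree e ->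
    (forall x, 0 < u x) -> (forall x, 0 < w x) ->
    (forall x y, y \in branch e root x ->
       w x <= D * gp (- kappa) B0 (level e root x - level e root y) * w y) ->
    (forall y l t, uniq t -> (forall x, x \in t -> descendants e root l y x) ->
       (size t)%:R <= N * l.+1%:R `^ B1) ->
    like_diagonal q C (u \* w) (summation_operator e root u w).
Proof.
move=> q0 D0 k0 N0.
have a1 : - kappa * 2^-1 < 0 by rewrite pmulr_llt0 // oppr_lt0.
have a2 : - kappa * (q / 2) < 0 by rewrite pmulr_llt0 ?divr_gt0 // oppr_lt0.
have [A A0 hA] := geo_poly_sum (B0 * 2^-1) a1.
have [K K0 hK] := geo_poly_sum (B0 * (q / 2) + B1) a2.
pose E := D * gp (- kappa) B0 1; pose N1 := N * 2 `^ B1.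
have E0 : 0 < E by rewrite mulr_gt0 ?gp_gt0.
have N10 : 0 < N1 by rewrite mulr_gt0 ?powR_gt0.
pose C1 := D * A * (N * K) `^ q^-1; pose C2 := 2 * (1 + E `^ q * N1) `^ q^-1.
have C10 : 0 < C1 by rewrite !mulr_gt0 // powR_gt0 // mulr_gt0.
have C20 : 0 < C2 by rewrite mulr_gt0 // powR_gt0 // ltr_wpDl // mulr_gt0 ?powR_gt0.
exists (C1 + C2) => [|V e root u w tree u0 w0 hw hN]; first exact: addr_gt0.
split; [exact: addr_gt0|exact: summation_operatorB|].
move=> f B B00; split=> hf.
  apply: (@lr_boundW _ _ _ _ (C1 * B) _ (ltW q0) (mulr_ge0 (ltW C10) B00)).
    by rewrite ler_wpM2r // lerDl ltW.
  apply: (summation_bound tree u0 w0 q0 (ltW D0) B00 _ hw) => //.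
  - by move=> l; exact: gp_gt0.
  - move=> n; apply: le_trans (hA n); apply: ler_sum => l _; by rewrite gp_powR.
  move=> y t ut; rewrite -big_filter.
  set t' := [seq _ <- t | _].
  have ut' : uniq t' by exact: filter_uniq.
  have [M ->] := sum_by_distance (fun x => level e root x - level e root y)%N
    (fun l => gp (- kappa) B0 l `^ (q / 2)) t'.
  apply: (@le_trans _ _ (N * \sum_(l < M) gp (- kappa * (q / 2)) (B0 * (q / 2) + B1) l)); last first.
    by apply: ler_wpM2l => //; exact: ltW.
  rewrite mulr_sumr; apply: ler_sum => l _; rewrite gp_powR.
  have -> : gp (- kappa * (q / 2)) (B0 * (q / 2) + B1) l =
      gp (- kappa * (q / 2)) (B0 * (q / 2)) l * l.+1%:R `^ B1.
    by rewrite !gpE -mulrA; congr (_ * _); rewrite powRDr.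
  rewrite [leRHS]mulrCA; apply: ler_wpM2l; first by apply: ltW; exact: gp_gt0.
  apply: (hN y); first exact: filter_uniq.
  move=> x; rewrite !mem_filter => /and3P[/eqP <- yx _].
  by apply/(descendantsP root tree); split => //; rewrite subnKC // level_branch.
apply: (@lr_boundW _ _ _ _ (C2 * B) _ (ltW q0) (mulr_ge0 (ltW C20) B00)).
  by rewrite ler_wpM2r // lerDr ltW.
apply: (summation_inverse tree w0 q0 (ltW E0) B00 _ _ hf).
  move=> x x0; have /(descendantsP root tree)[px lx] := parent_child tree x0.
  have := hw x _ px.
  by rewrite lx addnC addnK.
move=> y t ut ht; rewrite /N1; apply: (hN y) => // x /ht[x0 <-].
exact: parent_child.
Qed.

(** * Counting vertices *)

Lemma card_seq (T : choiceType) (A : set T) k : (A #= `I_k)%card ->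
  exists s : seq T, [/\ uniq s, size s = k & forall x, x \in s <-> A x].
Proof.
move=> Ak; have /finite_seqP[s0 es0] : finite_set A by exists k.
pose s := undup s0.
have hs x : x \in s <-> A x by rewrite mem_undup es0.
have /card_set_bijP[f [fi finj fs]] := Ak.
exists s; split=> //; first exact: undup_uniq.
have inj : {in s &, injective f}.
  by move=> x y /hs xA /hs yA; apply: finj; rewrite inE.
rewrite -(size_map f) -(size_iota 0 k); apply: perm_size; apply: uniq_perm.
- by rewrite map_inj_in_uniq // undup_uniq.
- exact: iota_uniq.
move=> y; rewrite mem_iota /= add0n; apply/mapP/idP => [[x /hs xA ->]|yk].
  exact: fi.
by have [x xA <-] := fs y yk; exists x => //; apply/hs.
Qed.

Section Counting.
Variables (R : realType) (m : nat) (c : R) (h : R -> R).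
Variables (V : countType) (e : rel V) (root : V) (I : nat -> Type)
  (eta : forall j, I j -> V).
Hypothesis adm : admissible_tree m c h e root eta.

Let tree : is_tree e. Proof. by case: adm. Qed.

(** The index [j] of [eta] is the distance from the root. By induction along the
    branch, as the children of the vertices of index [j] have index [j + 1]; the
    root has index [0], because it is nobody's child. *)
Lemma admissible_level x : exists i : I (level e root x), x = eta i.
Proof.
have [_ [ix K1 K2] hp _] := adm.
have step j (i : I j) y : descendants e root 1 (eta i) y -> exists i' : I j.+1, y = eta i'.
  move=> hy; have [hc _ _] := hp j.
  have : range (@eta j.+1) y by rewrite -hc; exists i.
  by case=> i' _ <-; exists i'.
have [n] := ubnP (level e root x); elim: n x => // n IH x xn.
have [x0|x0] := posnP (level e root x); last first.
  have lx := level_parent tree x0.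
  have [i hi] := IH (parent e root x) ltac:(by rewrite lx in xn).
  rewrite lx; apply: (step _ i); rewrite -hi; exact: parent_child.
have rx := level0 tree x0; rewrite x0 rx.
case E : (ix root) => [[|j] i].
  by exists i; have := K2 root; rewrite E.
have [hc _ _] := hp j.
have : range (@eta j.+1) root by exists i => //; have := K2 root; rewrite E.
rewrite -hc => -[i' _ /(descendantsP root tree)[_]].
by rewrite addn1 /level (tree_path_root root tree).
Qed.

Lemma descendants_count j l (y : V) : level e root y = j -> exists s : seq V,
  [/\ uniq s, forall x, x \in s <-> descendants e root l y x &
      c^-1 * (profile h m j / profile h m (j + l)) <= (size s)%:R
        <= c * (profile h m j / profile h m (j + l))].
Proof.
move=> <-; have [i yi] := admissible_level y.
have [_ _ _ hc] := adm; have [k hk hb] := hc _ l i.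
have [s [us sk hs]] := card_seq hk.
by exists s; split; [|rewrite yi|rewrite sk].
Qed.

End Counting.

(** * Reduction of the tree to its classes *)

Section Comparison.
Variables (R : realType) (V : choiceType).
Implicit Types (B C M q rho nu : R) (f g sigma : V -> R).

Lemma lr_bound_le q M f g B : 0 < q -> 0 <= M -> 0 <= B ->
  (forall v, `|f v| <= M * `|g v|) -> lr_bound q g B -> lr_bound q f (M * B).
Proof.
move=> q0 M0 B0 fg hg s us; rewrite powRM //.
apply: le_trans (ler_wpM2l (powR_ge0 _ _) (hg s us)); rewrite mulr_sumr.
by apply: ler_sum => v _; rewrite -powRM //; apply: ler_powR2l => //; exact: ltW.
Qed.

Lemma class_sizesW C (C' : R) rho nu (cls : V -> nat) : 0 < C -> C <= C' ->
  class_sizes C rho nu cls -> class_sizes C' rho nu cls.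
Proof.
move=> C0 CC h i; have [s [us hs h2 /andP[h3 h4]]] := h i.
exists s; split=> //; apply/andP; split.
  apply: le_trans h3; rewrite ler_pM2r ?gp_gt0 // lef_pV2 ?posrE //.
  exact: lt_le_trans CC.
by apply: (le_trans h4); rewrite ler_pM2r ?gp_gt0.
Qed.

Lemma like_diagonal_weight q C C' M sigma sigma' (S : (V -> R) -> V -> R) :
  0 < q -> 0 < M -> C * M <= C' ->
  (forall v, 0 <= sigma v) -> (forall v, 0 <= sigma' v) ->
  (forall v, sigma v <= M * sigma' v /\ sigma' v <= M * sigma v) ->
  like_diagonal q C sigma S -> like_diagonal q C' sigma' S.
Proof.
move=> q0 M0 CM s0 s0' hM [C0 hS h].
have C'0 : 0 < C' by apply: lt_le_trans CM; exact: mulr_gt0.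
have CMB B : 0 <= B -> C * M * B <= C' * B by move=> B0; rewrite ler_wpM2r.
split=> // f B B0; split=> hf.
  apply: (@lr_boundW _ _ _ _ (C * M * B) _ (ltW q0)); rewrite ?CMB //.
    by rewrite !mulr_ge0 // ltW.
  rewrite -mulrA; apply: (h f (M * B) _).1; first by rewrite mulr_ge0 // ltW.
  apply: (lr_bound_le q0 (ltW M0) B0 _ hf) => v.
  rewrite /= !normrM mulrA; apply: ler_wpM2r => //.
  by rewrite !ger0_norm //; case: (hM v).
apply: (@lr_boundW _ _ _ _ (C * M * B) _ (ltW q0)); rewrite ?CMB //.
  by rewrite !mulr_ge0 // ltW.
rewrite [C * M]mulrC -mulrA; apply: (lr_bound_le q0 (ltW M0) _ _ ((h f B B0).2 hf)).
  by rewrite mulr_ge0 // ltW.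
move=> v; rewrite /= !normrM mulrA; apply: ler_wpM2r => //.
by rewrite !ger0_norm //; case: (hM v).
Qed.

End Comparison.

Section Reduction.
Variables (R : realType) (m : nat) (c gamma nu : R) (h : R -> R).
Hypotheses (m0 : (0 < m)%N) (c1 : 1 <= c)
  (hh : admissible_h 0 gamma (log_power nu) h).


(** The levels are nonempty and disjoint, so each of the [2^i] levels of class
    [i] contributes at least one vertex, and about [h(1) / h(2^(-mj))]. *)
Lemma tree_class_sizes : exists2 C : R, 0 < C &
  forall (V : countType) (e : rel V) (root : V) (I : nat -> Type) (eta : forall j, I j -> V),
    admissible_tree m c h e root eta ->
    class_sizes C (1 - gamma) nu (fun x : V => dyadic_class (level e root x)).
Proof.
have [D D0 hD] := profile_class m0 hh.
have hp j : 0 < profile h m j by have [hpos _ _] := hh; apply: hpos; exact: level_in_domain.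
have c0 : 0 < c by exact: lt_le_trans c1.
pose H := profile h m 0; have H0 : 0 < H by exact: hp.
pose C := c * D * (H + H^-1).
have HV : 0 < H^-1 by rewrite invr_gt0.
have C0 : 0 < C by rewrite !mulr_gt0 // addr_gt0.
exists C => // V e root I eta adm i.
have tree : is_tree e by case: adm.
have lev_root : level e root root = 0%N by rewrite /level (tree_path_root root tree).
have lv j : exists s : seq V, [/\ uniq s, forall x, (x \in s) = (level e root x == j) &
    c^-1 * (H / profile h m j) <= (size s)%:R <= c * (H / profile h m j)].
  have [s [us hs hb]] := descendants_count adm j lev_root.
  exists s; split => // x; apply/idP/eqP => [/hs/(descendantsP root tree)[_ ->]|xj].
    by rewrite lev_root.
  by apply/hs/(descendantsP root tree); rewrite lev_root xj; split => //; exact: root_branch.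
pose g : R := gp (- gamma) (- nu) i.
have g0 : 0 < g by exact: gp_gt0.
have lvb j : dyadic_class j = i -> exists s : seq V,
    [/\ uniq s, forall x, (x \in s) = (level e root x == j), (0 < size s)%N &
      C^-1 * g <= (size s)%:R <= C * g].
  move=> ji; have [s [us hs /andP[b1 b2]]] := lv j.
  have [d1 d2] := hD j; rewrite ji in d1 d2.
  have e1 : D^-1 * g <= (profile h m j)^-1.
    by rewrite /g -gpV -invfM lef_pV2 ?posrE ?mulr_gt0 ?gp_gt0.
  have e2 : (profile h m j)^-1 <= D * g.
    rewrite /g -gpV -[D]invrK -invfM lef_pV2 ?posrE ?mulr_gt0 ?invr_gt0 ?gp_gt0 //.
    by rewrite mulrC ler_pdivrMr // mulrC.
  exists s; split => //.
    rewrite -(ltr0n R); apply: lt_le_trans b1.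
    by rewrite mulr_gt0 ?divr_gt0 ?invr_gt0.
  apply/andP; split.
    apply: le_trans b1; apply: (@le_trans _ _ (c^-1 * (H * (D^-1 * g)))); last first.
      by rewrite ler_pM2l ?invr_gt0 // ler_pM2l.
    rewrite [leRHS](_ : _ = (c^-1 * D^-1 * H) * g); last by ring.
    rewrite ler_pM2r // /C !invfM ler_pM2l ?mulr_gt0 ?invr_gt0 //.
    by rewrite -[leRHS]invrK lef_pV2 ?posrE ?invr_gt0 ?addr_gt0 // lerDr ltW.
  apply: (le_trans b2); apply: (@le_trans _ _ (c * (H * (D * g)))).
    by rewrite ler_pM2l // ler_pM2l.
  rewrite [leLHS](_ : _ = (c * D * H) * g); last by ring.
  by rewrite ler_pM2r // /C ler_pM2l ?mulr_gt0 // lerDl ltW.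
have stack n : (n <= 2 ^ i)%N -> exists s : seq V, [/\ uniq s,
    forall x, (x \in s) = ((2 ^ i).-1 <= level e root x < (2 ^ i).-1 + n)%N, (n <= size s)%N &
    n%:R * (C^-1 * g) <= (size s)%:R <= n%:R * (C * g)].
  elim: n => [_|n IH ni].
    exists [::]; split => // [x|]; last by rewrite !mul0r lexx.
    by rewrite addn0 in_nil; apply/esym/negP => /andP[a1]; rewrite ltnNge a1.
  have [s [us hs b1 /andP[b2 b3]]] := IH (ltnW ni).
  have [s' [us' hs' b1' /andP[b2' b3']]] : exists s : seq V,
      [/\ uniq s, forall x, (x \in s) = (level e root x == (2 ^ i).-1 + n)%N, (0 < size s)%N &
      C^-1 * g <= (size s)%:R <= C * g].
    apply: lvb; apply: trunc_log_eq => //; rewrite expnS.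
    have : (0 < 2 ^ i)%N by rewrite expn_gt0.
    clear -ni; lia.
  exists (s ++ s'); split.
  - rewrite cat_uniq us us' andbT; apply/hasPn => x; rewrite hs hs' => /eqP ->.
    by rewrite ltnn andbF.
  - move=> x; rewrite mem_cat hs hs'; clear; lia.
  - by rewrite size_cat; clear -b1 b1'; lia.
  - rewrite size_cat natrD -natr1 !mulrDl !mul1r; apply/andP; split; exact: lerD.
have [s [us hs b1 b2]] := stack _ (leqnn _).
have ge : (2 ^ i)%:R * g = gp (1 - gamma) (- nu) i.
  rewrite /g !gpE -powR2n mulrA; congr (_ * _).
  by rewrite -powRDr // mulrBl mulNr mul1r.
exists s; split => // [x|].
  rewrite hs; apply/idP/eqP => [hx|<-].
    apply: trunc_log_eq => //; rewrite expnS.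
    have : (0 < 2 ^ i)%N by rewrite expn_gt0.
    clear -hx; lia.
  have := dyadic_classP (level e root x).
  set k := dyadic_class _; rewrite expnS.
  have : (0 < 2 ^ k)%N by rewrite expn_gt0.
  clear; lia.
by move: b2; rewrite -ge ![(2 ^ i)%:R * (_ * _)]mulrCA.
Qed.

Lemma tree_descendants : exists N B1 : R, 0 < N /\
  forall (V : countType) (e : rel V) (root : V) (I : nat -> Type) (eta : forall j, I j -> V),
    admissible_tree m c h e root eta ->
    forall y l (t : seq V), uniq t -> (forall x, x \in t -> descendants e root l y x) ->
      (size t)%:R <= N * l.+1%:R `^ B1.
Proof.
have [D D0 hD] := profile_class m0 hh.
have hp j : 0 < profile h m j by have [hpos _ _] := hh; apply: hpos; exact: level_in_domain.
have c0 : 0 < c by exact: lt_le_trans c1.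
have [E [B1 [E0 hE]]] := @class_shift R (- gamma) (- nu).
exists (c * (D * D * E)), B1; split; first by rewrite !mulr_gt0.
move=> V e root I eta adm y l t ut ht.
have [s [us hs /andP[_ b]]] := descendants_count adm l (erefl (level e root y)).
have st : (size t <= size s)%N by apply: uniq_leq_size => // x /ht/hs.
apply: (@le_trans _ _ (size s)%:R); first by rewrite ler_nat.
apply: (le_trans b); rewrite -mulrA ler_pM2l //.
set j := level e root y.
have [d1 _] := hD j; have [_ d2] := hD (j + l)%N.
have := hE j l; rewrite -!gpV => hg.
have e2 : (profile h m (j + l))^-1 <= D * (gp gamma nu (dyadic_class (j + l)))^-1.
  by rewrite -ler_pdivrMl // -invfM lef_pV2 ?posrE ?mulr_gt0 ?gp_gt0 // mulrC.
rewrite ler_pdivrMr //; apply: (le_trans d1).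
have G0 k : 0 < gp gamma nu k :> R by exact: gp_gt0.
set X := E * _ in hg.
rewrite [leRHS](_ : _ = D * (D * profile h m (j + l) * X)); last by rewrite /X; ring.
rewrite ler_pM2l //; move: hg; rewrite ler_pdivlMr // mulrC ler_pdivrMr // => hg.
by apply: (le_trans hg); rewrite mulrC ler_pM2r // /X mulr_gt0 // powR_gt0.
Qed.

End Reduction.

Section Weights.
Variables (R : realType) (m : nat).
Hypothesis m0 : (0 < m)%N.

Lemma log_power_gt0 (a : R) k : 0 < log_power a k%:R.
Proof.
rewrite powR_gt0 // normr_gt0 gt_eqF // /log2 divr_gt0 ?ln2_gt0 // ln_gt0 //.
by rewrite -natrD ltr1n addn2.
Qed.

Lemma log_powerD (a b : R) k : log_power (a + b) k%:R = log_power a k%:R * log_power b k%:R.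
Proof.
rewrite /log_power powRDr // normr_gt0 gt_eqF // /log2 divr_gt0 ?ln2_gt0 // ln_gt0 //.
by rewrite -natrD ltr1n addn2.
Qed.

Lemma weight_seq_gt0 (kappa alpha lambda : R) j :
  0 < weight_seq m kappa alpha (log_power lambda) j.
Proof.
by rewrite /weight_seq mulr_gt0 ?log_power_gt0 // mulr_gt0 // powR_gt0 // ltr0n addn1.
Qed.

Lemma weight_seqM (kappa alpha_u alpha_w lambda_u lambda_w : R) j :
  weight_seq m (- kappa) alpha_u (log_power lambda_u) j *
    weight_seq m kappa alpha_w (log_power lambda_w) j =
  (m * j + 1)%:R `^ (- (alpha_u + alpha_w)) * log_power (lambda_u + lambda_w) (m * j + 1)%:R.
Proof.
rewrite /weight_seq log_powerD opprD addn1 (powRDr _ _ (ltr0Sn R (m * j))) mulNr opprK.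
have e : 2 `^ (kappa * (m * j)%:R) * 2 `^ (- (kappa * (m * j)%:R)) = 1 :> R.
  by rewrite -powRDr // subrr powRr0.
have regroup (a b x y s t : R) : a * x * s * (b * y * t) = a * b * (x * y * (s * t)) by ring.
by rewrite regroup e mul1r.
Qed.

Lemma weight_seq_decay (kappa alpha lambda : R) : exists D B : R, 0 < D /\ forall j l,
  weight_seq m kappa alpha (log_power lambda) (j + l) <=
    D * gp (- (kappa * m%:R)) B l * weight_seq m kappa alpha (log_power lambda) j.
Proof.
have [C C0 hC] := weight_class (- alpha) lambda m0.
have [E [B [E0 hE]]] := class_shift (- alpha) lambda.
exists (C * E * C), B; split; first by rewrite !mulr_gt0.
move=> j l; rewrite /weight_seq -mulrA -[X in _ <= _ * X]mulrA.
set g := fun j => (m * j + 1)%:R `^ (- alpha) * log_power lambda (m * j + 1)%:R : R.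
rewrite [X in _ * X <= _](_ : _ = g (j + l)%N) // [X in _ <= _ * (_ * X)](_ : _ = g j) //.
have [h1 _] := hC (j + l)%N; have [_ h2] := hC j.
rewrite mulnDr natrD mulrDr opprD powRDr // gpE.
rewrite (_ : - (kappa * m%:R) * l%:R = - (kappa * (m * l)%:R)); last by rewrite natrM; ring.
set a := 2 `^ _; set b := 2 `^ _.
rewrite [leRHS](_ : _ = a * b * (C * (E * l.+1%:R `^ B * (C * g j)))); last first.
  by move: (g j) => gj; ring.
rewrite ler_pM2l ?mulr_gt0 ?powR_gt0 //.
apply: (le_trans h1); rewrite ler_pM2l //; apply: (le_trans (hE j l)).
by rewrite ler_pM2l // mulr_gt0 // powR_gt0.
Qed.

End Weights.

Section Assembly.
Variables (R : realType) (p : \bar R) (q : R) (m : nat) (c gamma nu : R) (h : R -> R).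
Variables (kappa alpha_u alpha_w lambda_u lambda_w : R).
Hypotheses (q1 : 1 <= q) (m0 : (0 < m)%N) (c1 : 1 <= c)
  (hh : admissible_h 0 gamma (log_power nu) h) (k0 : 0 < kappa).

Let useq := weight_seq m (- kappa) alpha_u (log_power (- lambda_u)).
Let wseq := weight_seq m kappa alpha_w (log_power (- lambda_w)).
Let alpha := alpha_u + alpha_w.
Let lambda := lambda_u + lambda_w.

Lemma tree_like_diagonal : exists2 C : R, 0 < C &
  forall (V : countType) (e : rel V) (root : V) (I : nat -> Type) (eta : forall j, I j -> V)
    (u w : V -> R),
    admissible_tree m c h e root eta ->
    (forall j i, u (eta j i) = useq j) -> (forall j i, w (eta j i) = wseq j) ->
    like_diagonal q C (fun x => gp (- alpha) (- lambda) (dyadic_class (level e root x)))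
      (summation_operator e root u w).
Proof.
have q0 : 0 < q by exact: lt_le_trans q1.
have [D [B0 [D0 hD]]] := weight_seq_decay m0 kappa alpha_w (- lambda_w).
have [N [B1 [N0 hN]]] := tree_descendants m0 c1 hh.
have [M M0 hM] := weight_class (- alpha) (- lambda) m0.
have km : 0 < kappa * m%:R by rewrite mulr_gt0 // ltr0n.
have [C C0 hC] := summation_like_diagonal B0 B1 q0 D0 km N0.
exists (C * M) => [|V e root I eta u w adm hu hw]; first exact: mulr_gt0.
have tree : is_tree e by case: adm.
have ux x : u x = useq (level e root x) by have [i {1}->] := admissible_level adm x.
have wx x : w x = wseq (level e root x) by have [i {1}->] := admissible_level adm x.
have ud x : 0 < u x by rewrite ux weight_seq_gt0.
have wd x : 0 < w x by rewrite wx weight_seq_gt0.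
have uwx x : u x * w x = (m * level e root x + 1)%:R `^ (- alpha) *
    log_power (- lambda) (m * level e root x + 1)%:R.
  by rewrite ux wx weight_seqM // -opprD.
apply: (like_diagonal_weight q0 M0 (lexx _) _ _ _ (hC V e root u w tree ud wd _ (hN _ _ _ _ _ adm))).
- by move=> x; rewrite mulr_ge0 ?(ltW (ud x)) ?(ltW (wd x)).
- by move=> x; apply: ltW; exact: gp_gt0.
- by move=> x; rewrite /= uwx.
- move=> x y yx; rewrite !wx -{1}(subnKC (level_branch tree yx)).
  exact: hD.
Qed.

(** The laws are applied with a single constant that serves both for the class
    sizes and for the comparison with the diagonal operator. *)
Lemma asymp_of_laws F : (forall n, 0 <= F n) ->
  (forall C0, 0 < C0 -> upper_law p q C0 (1 - gamma) nu alpha lambda F) ->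
  (forall C0, 0 < C0 -> lower_law p q C0 (1 - gamma) nu alpha lambda F) ->
  entropy_asymp p q%:E m c h useq wseq F.
Proof.
move=> F0 hU hL.
have q0 : 0 < q by exact: lt_le_trans q1.
have [A A0 hA] := tree_class_sizes m0 c1 hh.
have [B B0 hB] := tree_like_diagonal.
have AB : 0 < A + B by rewrite addr_gt0.
have [C [n0 [C0 h1]]] := hU _ AB.
have [C' [n0' [C0' h2]]] := hL _ AB.
exists (C + C'), (maxn n0 n0'); split; first exact: addr_gt0.
move=> V e root I eta u w adm hu hw n; rewrite geq_max => /andP[n1 n2].
have hc : class_sizes (A + B) (1 - gamma) nu (fun x : V => dyadic_class (level e root x)).
  by apply: class_sizesW (hA _ _ _ _ _ adm) => //; rewrite lerDl ltW.
have hd : like_diagonal q (A + B) (fun x => gp (- alpha) (- lambda) (dyadic_class (level e root x)))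
    (summation_operator e root u w).
  have g0 (x : V) : 0 <= gp (- alpha) (- lambda) (dyadic_class (level e root x)) :> R by apply: ltW; exact: gp_gt0.
  apply: (like_diagonal_weight q0 (@ltr01 R) _ g0 g0 _ (hB V e root I eta u w adm hu hw)).
    by rewrite mulr1 lerDr ltW.
  by move=> x; rewrite mul1r.
apply/andP; split.
  apply: le_trans (h2 V _ _ hc hd n n2); rewrite lee_fin; apply: ler_wpM2r => //.
  by rewrite lef_pV2 ?posrE ?addr_gt0 // lerDr ltW.
apply: (le_trans (h1 V _ _ hc hd n n1)); rewrite lee_fin; apply: ler_wpM2r => //.
by rewrite lerDl ltW.
Qed.

End Assembly.

Theorem theorem7 (R : realType) (p : \bar R) (q : R) (m : nat) (c : R)
    (h : R -> R)
    (theta gamma nu kappa_u kappa_w alpha_u alpha_w lambda_u lambda_w : R)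
    (hp : (1 < p)%E) (hq : 1 <= q) (hm : (0 < m)%N) (hc : 1 <= c)
    (hh : admissible_h theta gamma (log_power nu) h)
    (htheta : theta = 0) (hkappa : kappa_u + kappa_w = 0)
    (hkappa_w : 0 < kappa_w) :
  let useq := weight_seq m kappa_u alpha_u (log_power (- lambda_u)) in
  let wseq := weight_seq m kappa_w alpha_w (log_power (- lambda_w)) in
  let alpha := alpha_u + alpha_w in
  let lambda := lambda_u + lambda_w in
  let d := q^-1 - recip p in
  let dplus := Num.max d 0 in
  let asymp := entropy_asymp p q%:E m c h useq wseq in
  (0 < alpha - (1 - gamma) * dplus ->
    asymp (fun n => n%:R `^ (- (alpha / (1 - gamma)) + d)
      * log2 n%:R `^ (- lambda - alpha * nu / (1 - gamma))))
  /\
  (alpha - (1 - gamma) * dplus = 0 -> (1 - nu) * dplus < lambda ->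
    ((q%:E <= p)%E ->
      asymp (fun n => log2 n%:R `^ (- lambda + (1 - nu) * d)))
    /\
    ((p < q%:E)%E -> lambda != recip p - q^-1 ->
      (recip p - q^-1 < lambda ->
        asymp (fun n => n%:R `^ d * log2 n%:R `^ (- lambda + recip p - q^-1)))
      /\
      (lambda < recip p - q^-1 ->
        asymp (fun n => n%:R `^ (- lambda))))).
Proof.
move=> useq wseq alpha lambda d dplus asymp.
rewrite htheta in hh; clear htheta theta.
have kE : kappa_u = - kappa_w by apply/eqP; rewrite -addr_eq0 hkappa.
rewrite /asymp /useq kE; clear asymp useq kE.
have rho0 : 0 < 1 - gamma.
  by rewrite subr_gt0; apply: le_lt_trans (admissible_h_gamma hh) ltr01.
have laws F := @asymp_of_laws R p q m c gamma nu h kappa_w alpha_u alpha_w lambda_u lambda_w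
  hq hm hc hh hkappa_w F.
have small : (p < q%:E)%E -> dplus = 0.
  move=> pq; rewrite /dplus max_r // /d subr_le0 ltW //; exact: recip_lt.
have large : (q%:E <= p)%E -> dplus = d.
  by move=> qp; rewrite /dplus max_l // /d subr_ge0; exact: recip_le.
have finite : (p < q%:E)%E -> exists r : R, [/\ p = r%:E, 1 < r & r < q].
  by move: hp; case: (p) => [r||] //; rewrite !lte_fin => r1 rq; exists r.
split=> [a0|a0 l0].
  have alpha0 : 0 < alpha.
    apply: (lt_le_trans a0); rewrite lerBlDr lerDl mulr_ge0 ?(ltW rho0) //.
    by rewrite /dplus le_max lexx orbT.
  apply: laws => [n|C0 C00|C0 C00]; first by rewrite mulr_ge0 ?powR_ge0.
    have [qp|pq] := leP q%:E p.
      apply: upper_ge_power => //; first exact: recip_le.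
      by rewrite -/d -(large qp).
    have [r [pr r1 rq]] := finite pq; rewrite /d pr recip_EFin.
    exact: upper_lt_power.
  exact: lower_power.
have aE : alpha = (1 - gamma) * dplus by apply/eqP; rewrite -subr_eq0 a0.
split=> [qp|pq lne].
  rewrite (large qp) in aE l0.
  apply: laws => [n|C0 C00|C0 C00]; first exact: powR_ge0.
    by rewrite -/alpha -/lambda aE; apply: upper_ge_critical => //; exact: recip_le.
  rewrite -/alpha -/lambda aE.
  have d0 : 0 <= d by rewrite subr_ge0; exact: recip_le.
  (* for [d = 0] Hoelder's inequality loses nothing and one class suffices *)
  move: d0; rewrite le_eqVlt => /orP[/eqP d0|d0]; last exact: lower_ge_critical.
  have := @lower_power R p q C0 (1 - gamma) nu 0 lambda hp hq C00 rho0.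
  rewrite -/d -d0 !mulr0 !mul0r !addr0 oppr0.
  by under eq_fun do rewrite powRr0 mul1r addr0.
rewrite (small pq) mulr0 in aE; rewrite (small pq) mulr0 in l0.
have [r [pr r1 rq]] := finite pq.
split=> hl.
  apply: laws => [n|C0 C00|C0 C00]; first by rewrite mulr_ge0 ?powR_ge0.
    rewrite -/alpha -/lambda aE /d pr recip_EFin; apply: upper_lt_critical_large => //.
    by move: hl; rewrite pr recip_EFin.
  by rewrite -/alpha -/lambda aE; exact: lower_lt_critical_large.
apply: laws => [n|C0 C00|C0 C00]; first exact: powR_ge0.
  rewrite -/alpha -/lambda aE pr; apply: upper_lt_critical_small => //.
  by move: hl; rewrite pr recip_EFin.
by rewrite -/alpha -/lambda aE; exact: lower_lt_critical_small.
Qed.
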